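(* Let $r\in\mathbb N$, $1\le q\le\infty$, and let $\alpha=k$ be an integer with $1\le k<r$. Then $\mathbf B^{k}_q=(\mathbf E,\mathbf E^r)^K_{k/r,q}$ coincides with the set of $f\in\mathbf E^{k-1}$ for which (Zygmund-type condition) $$\|f\|_{\mathbf E^{k-1}}+\sum_{(j_1,\dots,j_{k-1})\in\{1,2\}^{k-1}}\Big(\int_0^\infty\big(s^{-1}\,\Omega^{2}(s,\mathbb A_{j_1}\cdots\mathbb A_{j_{k-1}}f)\big)^q\frac{ds}{s}\Big)^{1/q}<\infty$$ (usual modification for $q=\infty$; for $k=1$ the sum consists of the single term with $f$ itself), and this quantity is a norm equivalent to the norm of $\mathbf B^k_q$.
   Context: Let $G=\mathbb R_+\times\mathbb R$ be the ''$ax+b$'' group with multiplication $(a_1,b_1)(a_2,b_2)=(a_1a_2,\,a_1b_2+b_1)$. Let $T$ be a strongly continuous representation of $G$ in a Banach space $\mathbf E$ with $\|T(g)f\|_{\mathbf E}\le\|f\|_{\mathbf E}$. Put $T_1(t)=T(e^{t},0)$, $T_2(t)=T(1,t)$, with (closed) generators $\mathbb A_1,\mathbb A_2$. For $r\in\mathbb N$, $\mathbf E^{r}$ is the space of $f\in\mathbf E$ for which all products $\mathbb A_{j_1}\cdots\mathbb A_{j_k}f$, $1\le k\le r$, $j_i\in\{1,2\}$, are defined, with norm $\|f\|_{\mathbf E^r}=\|f\|_{\mathbf E}+\sum_{k=1}^r\sum_{(j_1,\dots,j_k)\in\{1,2\}^k}\|\mathbb A_{j_1}\cdots\mathbb A_{j_k}f\|_{\mathbf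 E}$; $\mathbf E^0=\mathbf E$. Mixed modulus of order $m$: $\Omega^{m}(s,f)=\sum_{(j_1,\dots,j_m)\in\{1,2\}^m}\sup_{0\le t_{1},\dots,t_{m}\le s}\|(T_{j_1}(t_{1})-I)\cdots(T_{j_m}(t_{m})-I)f\|_{\mathbf E}$. $K(t,f,\mathbf E,\mathbf E^r)=\inf\{\|f_0\|_{\mathbf E}+t\|f_1\|_{\mathbf E^r}: f=f_0+f_1\}$. The Besov space $\mathbf B^\alpha_q=(\mathbf E,\mathbf E^r)^K_{\alpha/r,q}$ is the set of $f\in\mathbf E$ with finite norm $\|f\|_{\mathbf E}+\big(\int_0^\infty(s^{-\alpha}K(s^r,f,\mathbf E,\mathbf E^r))^q\frac{ds}{s}\big)^{1/q}$. *)

(* Defs.v *)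
From HB Require Import structures.
From mathcomp Require Import all_boot all_order all_algebra.
From mathcomp Require Import all_classical all_reals all_analysis.
Set Implicit Arguments. Unset Strict Implicit. Unset Printing Implicit Defensive.
Import Order.TTheory GRing.Theory Num.Theory.
Import numFieldNormedType.Exports.
Local Open Scope classical_set_scope.
Local Open Scope ring_scope.

Section Defs.
Context {R : realType} {E : completeNormedModType R}.

(* A representation of the ax+b group G = R_+ x R given by T a b = T(a,b),
   only meaningful for a > 0. *)
Definition contractive_rep (T : R -> R -> E -> E) : Prop :=
  [/\ (forall a b, 0 < a -> forall (x y : E) (c : R),
          T a b (x + y) = T a b x + T a b y /\ T a b (c *: x) = c *: T a b x),
      (forall f, T 1 0 f = f),
      (forall a1 b1 a2 b2, 0 < a1 -> 0 < a2 -> forall f,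
          T (a1 * a2) (a1 * b2 + b1) f = T a1 b1 (T a2 b2 f)),
      (forall f, {within [set p : R * R | 0 < p.1],
                   continuous (fun p : R * R => T p.1 p.2 f)}) &
      (forall a b, 0 < a -> forall f, `|T a b f| <= `|f|) ].

(* one-parameter subgroups: j = false is T_1, j = true is T_2 *)
Definition Tj (T : R -> R -> E -> E) (j : bool) (t : R) : E -> E :=
  if j then T 1 t else T (expR t) 0.

Definition gen_dom (S : R -> E -> E) (f : E) : Prop :=
  exists g : E, (fun t : R => t^-1 *: (S t f - f)) @ 0^'+ --> g.
Definition gen (S : R -> E -> E) (f : E) : E :=
  lim ((fun t : R => t^-1 *: (S t f - f)) @ 0^'+).

Definition Aprod (T : R -> R -> E -> E) (js : seq bool) (f : E) : E :=
  foldr (fun j g => gen (Tj T j) g) f js.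

Fixpoint Adom (T : R -> R -> E -> E) (js : seq bool) (f : E) : Prop :=
  match js with
  | [::] => True
  | j :: js' => Adom T js' f /\ gen_dom (Tj T j) (Aprod T js' f)
  end.

Definition inEr (T : R -> R -> E -> E) (r : nat) (f : E) : Prop :=
  forall k : nat, (1 <= k <= r)%N -> forall js : k.-tuple bool, Adom T js f.

Definition normEr (T : R -> R -> E -> E) (r : nat) (f : E) : R :=
  `|f| + \sum_(1 <= k < r.+1) \sum_(js : k.-tuple bool) `|Aprod T js f|.

Definition Kfun (T : R -> R -> E -> E) (r : nat) (t : R) (f : E) : R :=
  inf [set x : R | exists f1 : E, inEr T r f1 /\ x = `|f - f1| + t * normEr T r f1].

Definition Omega (T : R -> R -> E -> E) (m : nat) (s : R) (f : E) : R :=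
  \sum_(js : m.-tuple bool)
     sup [set x : R | exists ts : m.-tuple R,
            (forall i : 'I_m, 0 <= tnth ts i <= s) /\
            x = `|foldr (fun p g => Tj T p.1 p.2 g - g) f (zip js ts)| ].

Definition Lq_dsds (q : \bar R) (F : R -> R) : \bar R :=
  match q with
  | q'%:E => poweR (\int[lebesgue_measure]_(s in `]0%R, +oo[) ((powR (F s) q') / s)%:E)%E q'^-1
  | _ => ereal_sup [set (F s)%:E | s in `]0%R, +oo[]
  end.

Definition Bnorm (T : R -> R -> E -> E) (r : nat) (alpha : R) (q : \bar R) (f : E)
  : \bar R :=
  ((`|f|)%:E + Lq_dsds q (fun s => (powR s (- alpha) * Kfun T r (s ^+ r) f)%R))%E.

Definition Zyg (T : R -> R -> E -> E) (k : nat) (q : \bar R) (f : E) : \bar R :=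
  ((normEr T k.-1 f)%:E +
   \sum_(js : k.-1.-tuple bool) Lq_dsds q (fun s => (s^-1 * Omega T 2 s (Aprod T js f))%R))%E.

End Defs.

(* Main.v *)
(* Choose P_s = s^-2 \int_0^s \int_0^s T_1(t) T_2(u) dt du.  Both A_1 P_s and A_2 P_s are s^-1 times averages
   of differences, and T_1(t) T_2(u) = T_2(e^t u) T_1(t) shows that A_j moves past every operator built from
   averages and differences at the cost of operators of the same kind and the same order of vanishing in s.
   Commutator errors are of lower order but carry extra powers of s, and Marchaud's inequality absorbs them
   into Omega^2(s, f) + s^2 |f|.  Polynomials in P_s thus give Jackson and Bernstein estimates in every E^i,
   hence K(s^r, f) <= C s^(k-1) (sum_J Omega^2(s, A_J f) + s^2 |f|_{E^(k-1)}) for s <= 1.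
   Conversely, f is telescoped along near-optimal elements at the scales 2^-i; interpolating between E and
   E^r bounds both the tails in E^(k-1) and the partial sums in E^(k+1), and two discrete Hardy inequalities
   turn these bounds into the Zygmund condition. *)

Require Import Defs.
From HB Require Import structures.
From mathcomp Require Import all_boot all_order all_algebra.
From mathcomp Require Import all_classical all_reals all_analysis.
From mathcomp Require Import ring lra measurable_realfun.
Import Order.TTheory GRing.Theory Num.Theory.
Import numFieldNormedType.Exports.
Local Open Scope classical_set_scope.
Local Open Scope ring_scope.

(** * Linear equations in modules *)

(** The obstacle is that [A_1] and [A_2] do not commute: expanding [A_J P_s^N] directly breeds ever
    new commutators. They are contained by a class of operator families, [good i d], closed under
    sums and products, in which [A_j B = sum_l B'_{jl} A_l] holds again with members of the class;
    estimates are then proved once, for the class. The two rules behind it are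
    [A_2 T_1(t) = e^{-t} T_1(t) A_2] and [A_1 T_2(t) = T_2(t) (A_1 + t A_2)]: passing a generator
    changes a weight or produces a factor [t]. Orders of vanishing are measured by [bd a s], which
    includes a term [s^a |f|] (with [a] capped at 2). An order can therefore be given up for a
    factor [4 / s], so that a factor [t <= s] left by a commutator is worth one order. Since
    [I - P_s] has order 1 only, order 2 is reached by [(I - P_s^N)^2]; its complement
    [P_s^N (2 I - P_s^N)] still gains N derivatives, and N = r in the end. The terms with [s^2] are
    harmless: below scale 1 they sum geometrically, and above scale 1 trivial bounds suffice. *)

Section LinearReflection.
Variables (K : comPzRingType) (V : lmodType K).

(** Syntax of linear combinations of atoms. Two of them agree once all their coefficients agree, so
    that an identity in a module reduces to finitely many identities in [K], which [ring] or [field]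
    can settle. *)
Inductive lexp :=
  | LVar of nat | LZero | LAdd of lexp & lexp | LOpp of lexp | LScale of K & lexp.

Fixpoint leval (env : seq V) (e : lexp) : V :=
  match e with
  | LVar i => nth 0 env i
  | LZero => 0
  | LAdd a b => leval env a + leval env b
  | LOpp a => - leval env a
  | LScale c a => c *: leval env a
  end.

Fixpoint lcoef (e : lexp) (i : nat) : K :=
  match e with
  | LVar j => if Nat.eqb i j then 1 else 0
  | LZero => 0
  | LAdd a b => lcoef a i + lcoef b i
  | LOpp a => - lcoef a i
  | LScale c a => c * lcoef a i
  end.

Fixpoint lcoefs_eq (a b : lexp) (n : nat) : Prop :=
  match n with
  | 0%N => True
  | m.+1 => lcoef a m = lcoef b m /\ lcoefs_eq a b m
  end.

Lemma levalE env e :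
  leval env e = \sum_(i < size env) lcoef e i *: nth 0 env i.
Proof.
elim: e => [j||a IHa b IHb|a IHa|c a IHa] /=.
- have [jn|jn] := ltnP j (size env).
    rewrite (bigD1 (Ordinal jn)) //= PeanoNat.Nat.eqb_refl scale1r big1 ?addr0 // => i ij.
    case E: (Nat.eqb i j); last by rewrite scale0r.
    by move/PeanoNat.Nat.eqb_eq: E ij => E; rewrite -val_eqE /= E eqxx.
  rewrite nth_default // big1 // => i _.
  case E: (Nat.eqb i j); last by rewrite scale0r.
  move/PeanoNat.Nat.eqb_eq: E => E.
  by move: (ltn_ord i); rewrite E ltnNge jn.
- by rewrite big1 // => i _; rewrite scale0r.
- rewrite IHa IHb -big_split /=; apply: eq_bigr => i _.
  by rewrite scalerDl.
- by rewrite IHa -sumrN; apply: eq_bigr => i _; rewrite scaleNr.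
- by rewrite IHa scaler_sumr; apply: eq_bigr => i _; rewrite scalerA.
Qed.

Lemma leval_eq env a b : lcoefs_eq a b (size env) -> leval env a = leval env b.
Proof.
move=> H; rewrite !levalE.
have {H}: forall i, (i < size env)%N -> lcoef a i = lcoef b i.
  elim: (size env) H => [//|n IH] /= [H1 /IH H2] i.
  by rewrite ltnS leq_eqVlt => /orP[/eqP ->|/H2].
by move=> H; apply: eq_bigr => i _; rewrite H.
Qed.
End LinearReflection.
Arguments LZero {K}.
Arguments LVar {K}.

Ltac lmod_index x env :=
  lazymatch env with
  | x :: _ => constr:(0%N)
  | _ :: ?t => let n := lmod_index x t in constr:(S n)
  end.
Ltac lmod_atoms t env :=
  lazymatch t with
  | GRing.add ?a ?b => let env := lmod_atoms a env in lmod_atoms b env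
  | GRing.opp ?a => lmod_atoms a env
  | GRing.scale _ ?a => lmod_atoms a env
  | GRing.zero => env
  | _ => match env with
         | context [ t :: _ ] => env
         | _ => constr:(t :: env)
         end
  end.
Ltac lmod_reify K t env :=
  lazymatch t with
  | GRing.add ?a ?b =>
      let a := lmod_reify K a env in let b := lmod_reify K b env in constr:(@LAdd K a b)
  | GRing.opp ?a => let a := lmod_reify K a env in constr:(@LOpp K a)
  | GRing.scale ?c ?a => let a := lmod_reify K a env in constr:(@LScale K c a)
  | GRing.zero => constr:(@LZero K)
  | _ => let n := lmod_index t env in constr:(@LVar K n)
  end.
(* Reduces an equation between linear combinations of vectors to the equality of coefficients. *)
Ltac lmod_eq K :=
  lazymatch goal with
  | |- @eq ?T ?a ?b =>
      let e0 := constr:(@nil T) in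
      let e1 := lmod_atoms a e0 in
      let env := lmod_atoms b e1 in
      let a' := lmod_reify K a env in
      let b' := lmod_reify K b env in
      apply: (@leval_eq K _ env a' b');
      rewrite /lcoefs_eq /lcoef /=; do ! split
  end.
Ltac lmod K := lmod_eq K; try ring.

Set Implicit Arguments.
Unset Strict Implicit.

(** * Calculus of vector-valued functions *)

(** Compactness of [[a, b]] as a gluing principle: with [c] the supremum of the points reached from
    [a], the local hypothesis at [c] leads on to [b] or to a point beyond [c], and the latter is
    absurd. It serves the mean value inequality and the existence of the integral. *)
Lemma cousin (R : realType) (P : R -> R -> Prop) (a b : R) : a < b ->
  (forall x y z, a <= x -> x < y -> y < z -> z <= b -> P x y -> P y z -> P x z) ->
  (forall x, a <= x <= b -> exists d, 0 < d /\
     forall y z, a <= y -> z <= b -> y < z -> x - d < y -> y <= x -> x <= z -> z < x + d -> P y z) ->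
  P a b.
Proof.
move=> ab Padd Ploc.
pose A := [set x | a < x <= b /\ P a x].
have [d0 [d0p H0]] := Ploc a (ltac:(lra) : a <= a <= b).
pose x0 := a + Num.min (d0 / 2) (b - a).
have x0P : a < x0 <= b /\ x0 < a + d0 by rewrite /x0; case: (lerP (d0 / 2) (b - a)); lra.
have Ax0 : A x0.
  by split; [lra|apply: H0; lra].
have ubA : ubound A b by move=> x [] /andP[].
have hsA : has_sup A by split; [exists x0|exists b].
have ubc y : A y -> y <= sup A.
  by move=> Ay; apply: (ub_le_sup (ex_intro _ b ubA)).
set c := sup A in ubc *.
have cb : c <= b by apply: ge_sup => //; exists x0.
have x0c : x0 <= c by exact: ubc.
have [d [dp H]] := Ploc c (ltac:(lra) : a <= c <= b).
have [y [/andP[ay yb] Py] cy] := sup_adherent dp hsA.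
have yc : y <= c.
  by apply: ubc; split; [rewrite ay yb|].
pose z := Num.min b (c + d / 2).
have zP : z <= b /\ z < c + d /\ c <= z /\ (z = b \/ z = c + d / 2).
  by rewrite /z; case: (lerP b (c + d / 2)); lra.
case: zP => zb [zd [cz zE]].
have Pz : P a z.
  have [yz|zy] := ltP y z.
    by apply: (Padd a y z) => //; apply: H => //; lra.
  by have -> : z = y by lra.
case: zE => [<- //|zE].
suff : z <= c by lra.
by apply: ubc; split => //; lra.
Qed.

Section Calculus.
Context {R : realType} {E : completeNormedModType R}.
Implicit Types (u F G : R -> E).

Definition seqlim (x : nat -> E) (l : E) := forall e : R, 0 < e ->
  exists N, forall n, (N <= n)%N -> `|x n - l| <= e.

(** The centre [z] may depend on [e] and need not belong to the sequence, which is the form in which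
    [cousin] delivers the Cauchy property of Riemann sums. *)
Lemma seqlim_complete (x : nat -> E) :
  (forall e : R, 0 < e -> exists N z, forall n, (N <= n)%N -> `|x n - z| <= e) ->
  exists l, seqlim x l.
Proof.
move=> H.
have : cvg (x @ \oo).
  apply/cauchy_cvgP/cauchy_exP => e e0 /=.
  have [N [z Hz]] := H (e / 2) (ltac:(lra)).
  exists z; exists N => // n /= Nn.
  rewrite -ball_normE /ball_ /= distrC; apply: le_lt_trans (Hz n Nn) _; lra.
move=> cx; exists (lim (x @ \oo)) => e e0.
have /cvgrPdist_le/(_ e e0) [N _ HN] := cx.
by exists N => n Nn; rewrite distrC; apply: HN.
Qed.

(* Derivative at x of a function on [0, +oo[ (one-sided at 0) *)
Definition hasder F (x : R) v := forall e : R, 0 < e -> exists d : R, 0 < d /\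
  forall y, 0 <= y -> `|y - x| <= d -> `|F y - F x - (y - x) *: v| <= e * `|y - x|.

Definition contu u := forall x, 0 <= x -> forall e : R, 0 < e -> exists d : R, 0 < d /\
  forall y, 0 <= y -> `|y - x| <= d -> `|u y - u x| <= e.

(** For vector values no intermediate point exists. The slack [e] makes the estimate true on small
    intervals around each point, by splitting the increment there, and [cousin] glues these. *)
Lemma mean_value F u (M x : R) : 0 <= x -> (forall t, 0 <= t <= x -> hasder F t (u t)) ->
  (forall t, 0 <= t <= x -> `|u t| <= M) -> `|F x - F 0| <= M * x.
Proof.
move=> x0 HF Hu.
have [->|xn0] := eqVneq x 0; first by rewrite subrr normr0 mulr0.
have {xn0}x0' : 0 < x by rewrite lt_neqAle eq_sym xn0.
suff H : forall e, 0 < e -> `|F x - F 0| <= (M + e) * x.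
  apply/ler_addgt0Pr => e e0.
  have := H (e / x) (divr_gt0 e0 x0'); rewrite mulrDl mulfVK //; exact: lt0r_neq0.
move=> e e0.
suff : `|F x - F 0| <= (M + e) * (x - 0) by rewrite subr0.
apply: (@cousin R (fun a b => `|F b - F a| <= (M + e) * (b - a))) => //.
- move=> a b c _ _ _ _ H1 H2.
  have -> : F c - F a = (F b - F a) + (F c - F b) by lmod R.
  by apply: le_trans (ler_normD _ _) _; nra.
- move=> t t0; have [d [d0 H]] := HF t t0 e e0.
  exists d; split => // y z y0 zx yz xy yx xz zd.
  have -> : F z - F y = (F z - F t - (z - t) *: u t) - (F y - F t - (y - t) *: u t)
                        + (z - y) *: u t by lmod R.
  have nz : `|z - t| = z - t by rewrite ger0_norm // subr_ge0.
  have ny : `|y - t| = t - y by rewrite distrC ger0_norm // subr_ge0.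
  have Hz : `|F z - F t - (z - t) *: u t| <= e * `|z - t|.
    by apply: H; [lra|rewrite nz; lra].
  have Hy : `|F y - F t - (y - t) *: u t| <= e * `|y - t|.
    by apply: H; [lra|rewrite ny; lra].
  rewrite nz in Hz; rewrite ny in Hy.
  have Hut := Hu t t0.
  apply: le_trans (ler_normD _ _) _; rewrite normrZ (ger0_norm (_ : 0 <= z - y)); last by lra.
  have := ler_normB (F z - F t - (z - t) *: u t) (F y - F t - (y - t) *: u t).
  nra.
Qed.

Lemma hasderD F G x v w : hasder F x v -> hasder G x w -> hasder (fun t => F t + G t) x (v + w).
Proof.
move=> HF HG e e0.
have [d [d0 Hd]] := HF (e / 2) (ltac:(lra)); have [d' [d0' Hd']] := HG (e / 2) (ltac:(lra)).
exists (Num.min d d'); split; first by rewrite lt_min d0.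
move=> y y0; rewrite le_min => /andP[yd yd'].
have -> : F y + G y - (F x + G x) - (y - x) *: (v + w) =
  (F y - F x - (y - x) *: v) + (G y - G x - (y - x) *: w) by lmod R.
apply: le_trans (ler_normD _ _) _; have := Hd y y0 yd; have := Hd' y y0 yd'; lra.
Qed.

Definition blin (L : E -> E) := (forall (c : R) (x y : E), L (c *: x + y) = c *: L x + L y) /\
  exists C : R, 0 <= C /\ forall x : E, `|L x| <= C * `|x|.

Lemma blinZ L : blin L -> forall (c : R) (x : E), L (c *: x) = c *: L x.
Proof.
move=> [H _] c x.
have L0 : L 0 = 0.
  by have := H (-1) 0 0; rewrite scaler0 addr0 scaleN1r addNr.
by have := H c x 0; rewrite L0 !addr0.
Qed.
Lemma blin0 L : blin L -> L 0 = 0.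
Proof. by move=> /blinZ/(_ 0 0); rewrite !scale0r. Qed.
Lemma blinD L : blin L -> forall x y : E, L (x + y) = L x + L y.
Proof. by move=> [H _] x y; have := H 1 x y; rewrite !scale1r. Qed.
Lemma blinN L : blin L -> forall x : E, L (- x) = - L x.
Proof. by move=> H x; rewrite -scaleN1r (blinZ H) scaleN1r. Qed.
Lemma blinB L : blin L -> forall x y : E, L (x - y) = L x - L y.
Proof. by move=> H x y; rewrite (blinD H) (blinN H). Qed.

Lemma blin_id : blin id.
Proof. by split => //; exists 1; split => // x; rewrite mul1r. Qed.
Lemma blin_scale (c : R) : blin (fun x : E => c *: x).
Proof.
split=> [c' x y|]; first by lmod R.
by exists `|c|; split => // x; rewrite normrZ.
Qed.
Lemma blin_add L L' : blin L -> blin L' -> blin (fun x => L x + L' x).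
Proof.
move=> HL HL'; split=> [c x y|].
  rewrite !(blinD HL) !(blinD HL') !(blinZ HL) !(blinZ HL'); lmod R.
move: HL HL' => [_ [C [C0 HC]]] [_ [C' [C0' HC']]]; exists (C + C'); split; first exact: addr_ge0.
by move=> x; apply: le_trans (ler_normD _ _) _; rewrite mulrDl lerD.
Qed.
Lemma blin_comp L L' : blin L -> blin L' -> blin (fun x => L (L' x)).
Proof.
move=> HL HL'; split=> [c x y|].
  by rewrite !(blinD HL') !(blinD HL) !(blinZ HL') !(blinZ HL).
move: HL HL' => [_ [C [C0 HC]]] [_ [C' [C0' HC']]]; exists (C * C'); split; first exact: mulr_ge0.
by move=> x; apply: le_trans (HC _) _; rewrite -mulrA ler_wpM2l.
Qed.

Lemma hasder_lin L F x v : blin L -> hasder F x v -> hasder (fun t => L (F t)) x (L v).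
Proof.
move=> HL HF e e0; have [_ [C [C0 HC]]] := HL.
have [d [d0 Hd]] := HF (e / (C + 1)) (ltac:(apply: divr_gt0; lra)).
exists d; split => // y y0 yd.
rewrite -(blinZ HL) -!(blinB HL).
apply: le_trans (HC _) _.
have := Hd y y0 yd; rewrite mulrAC ler_pdivlMr; last lra.
have := normr_ge0 (F y - F x - (y - x) *: v); nra.
Qed.

Lemma hasder_cst c x : hasder (fun=> c) x 0.
Proof.
move=> e e0; exists 1; split => // y _ _.
by rewrite subrr scaler0 subrr normr0; apply: mulr_ge0 => //; lra.
Qed.

Lemma hasder_shift F x h v : 0 <= h -> hasder F (x + h) v -> hasder (fun t => F (t + h)) x v.
Proof.
move=> h0 HF e e0; have [d [d0 Hd]] := HF e e0.
exists d; split => // y y0 yd.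
have E1 : y - x = (y + h) - (x + h) by ring.
by rewrite E1; apply: Hd; [lra|rewrite -E1].
Qed.

Lemma hasder_scale F x (a : R) v : 0 < a -> hasder F (a * x) v ->
  hasder (fun t => F (a * t)) x (a *: v).
Proof.
move=> a0 HF e e0; have [d [d0 Hd]] := HF (e / a) (divr_gt0 e0 a0).
exists (d / a); split; first exact: divr_gt0.
move=> y y0; rewrite ler_pdivlMr // => yd.
have E1 : `|a * y - a * x| = `|y - x| * a by rewrite -mulrBr normrM gtr0_norm // mulrC.
rewrite scalerA.
have -> : (y - x) * a = a * y - a * x by ring.
have ay0 : 0 <= a * y by apply: mulr_ge0 => //; exact: ltW.
have := Hd (a * y) ay0; rewrite E1 => /(_ yd).
have -> : e / a * (`|y - x| * a) = e * `|y - x| by field; rewrite lt0r_neq0.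
by [].
Qed.

Lemma zero_der_const F x : 0 <= x -> (forall t, 0 <= t <= x -> hasder F t 0) -> F x = F 0.
Proof.
move=> x0 H.
have : `|F x - F 0| <= 0 * x.
  by apply: (@mean_value F (fun=> 0)) => // t _; rewrite normr0.
by rewrite mul0r normr_le0 subr_eq0 => /eqP.
Qed.

Lemma der_unique F G x u : 0 <= x -> F 0 = G 0 -> (forall t, 0 <= t <= x -> hasder F t (u t)) ->
  (forall t, 0 <= t <= x -> hasder G t (u t)) -> F x = G x.
Proof.
move=> x0 FG0 HF HG.
have : F x + (- 1) *: G x = F 0 + (-1) *: G 0.
  apply: (@zero_der_const (fun t => F t + (-1) *: G t)) => // t tx.
  have -> : (0 : E) = u t + (-1) *: u t by rewrite scaleN1r subrr.
  apply: hasderD; first exact: HF.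
  by apply: hasder_lin; [exact: blin_scale|exact: HG].
by rewrite !scaleN1r FG0 subrr => /eqP; rewrite subr_eq0 => /eqP.
Qed.
End Calculus.

(** * The vector-valued integral over [[0, x]] *)

Section Primitive.
Context {R : realType} {E : completeNormedModType R}.
Implicit Types (u F G : R -> E).

(** Left-endpoint Riemann sums on a grid of mesh [1 / (n + 1)] that does not depend on [x], so that
    increments over adjacent intervals add up exactly. *)
Definition stepsum u (n : nat) (x : R) : E :=
  n.+1%:R^-1 *: \sum_(0 <= i < Num.trunc (n.+1%:R * x)) u (i%:R / n.+1%:R).

(** The first sample point may lie up to one mesh to the left of [a], whence the range of [t]. The
    number of sample points times the mesh differs from [b - a] by at most one mesh, whence the two
    error terms. *)
Lemma stepsum_est u (n : nat) (a b e : R) (v : E) : 0 <= a -> a < b -> 0 <= e ->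
  (forall t, 0 <= t -> a - n.+1%:R^-1 <= t <= b -> `|u t - v| <= e) ->
  `|stepsum u n b - stepsum u n a - (b - a) *: v|
     <= e * (b - a + n.+1%:R^-1) + n.+1%:R^-1 * `|v|.
Proof.
move=> a0 ab e0 H; rewrite /stepsum.
set N : R := n.+1%:R; set h := N^-1.
have N0 : 0 < N by rewrite ltr0n.
have h0 : 0 < h by rewrite invr_gt0.
have hN : h * N = 1 by rewrite mulVf // lt0r_neq0.
set p := Num.trunc (N * a); set q := Num.trunc (N * b).
have /truncn_itv/andP[p1 p2] : 0 <= N * a by apply: mulr_ge0 => //; lra.
have /truncn_itv/andP[q1 q2] : 0 <= N * b by apply: mulr_ge0; lra.
rewrite -/p -natr1 in p1 p2; rewrite -/q -natr1 in q1 q2.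
have pq : (p <= q)%N by apply: le_truncn; rewrite ler_pM2l // ltW.
have ph : p%:R * h <= a < p%:R * h + h.
  have -> : a = h * (N * a) by rewrite mulrA hN mul1r.
  apply/andP; split; nra.
have qh : q%:R * h <= b < q%:R * h + h.
  have -> : b = h * (N * b) by rewrite mulrA hN mul1r.
  apply/andP; split; nra.
rewrite (big_cat_nat (leq0n p) pq) /= scalerDr [X in X - _ - _]addrC addrK.
have -> : h *: \sum_(p <= i < q) u (i%:R / N) - (b - a) *: v =
  h *: \sum_(p <= i < q) (u (i%:R / N) - v) + ((q - p)%:R * h - (b - a)) *: v.
  have -> : \sum_(p <= i < q) (u (i%:R / N) - v) =
      \sum_(p <= i < q) u (i%:R / N) - (q - p)%:R *: v.
    by rewrite sumrB sumr_const_nat scaler_nat.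
  lmod R.
have S : `|\sum_(p <= i < q) (u (i%:R / N) - v)| <= (q - p)%:R * e.
  rewrite mulr_natl -sumr_const_nat.
  apply: le_trans (ler_norm_sum _ _ _) _.
  apply: ler_sum_nat => i /andP[pi iq].
  have {}pi : (p%:R : R) <= i%:R by rewrite ler_nat.
  have {}iq : (i%:R + 1 : R) <= q%:R by rewrite natr1 ler_nat.
  apply: H; first by rewrite divr_ge0 // ltW.
  by rewrite -/h; apply/andP; split; nra.
rewrite natrB // in S *.
apply: le_trans (ler_normD _ _) _; rewrite !normrZ (gtr0_norm h0).
have v0 := normr_ge0 v.
have D : `|(q%:R - p%:R) * h - (b - a)| <= h by rewrite ler_norml; apply/andP; split; nra.
have Q : (q%:R - p%:R) * h <= b - a + h by nra.
apply: lerD; last by rewrite ler_wpM2r.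
by apply: (@le_trans _ _ (h * ((q%:R - p%:R) * e))); nra.
Qed.

Lemma small_inv (e : R) : 0 < e -> exists N : nat, forall n, (N <= n)%N -> n.+1%:R^-1 <= e.
Proof.
move=> e0; exists (Num.trunc e^-1) => n Hn.
have /truncn_itv/andP[_ H] : 0 <= e^-1 by rewrite invr_ge0 ltW.
rewrite -[e]invrK lef_pV2 ?posrE ?invr_gt0 ?ltr0n //.
by apply: le_trans (ltW H) _; rewrite ler_nat.
Qed.

Lemma stepsum_loc u x (e : R) : contu u -> 0 <= x -> 0 < e -> exists d : R, 0 < d /\
  forall y z, 0 <= y -> y < z -> x - d < y -> y <= x -> x <= z -> z < x + d ->
  exists N, forall n, (N <= n)%N -> `|stepsum u n z - stepsum u n y - (z - y) *: u x| <= e * (z - y).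
Proof.
move=> uc x0 e0; have [d [d0 H]] := uc x x0 (e / 2) (ltac:(lra)).
exists (d / 2); split; first lra.
move=> y z y0 yz xy yx xz zx.
have v0 := normr_ge0 (u x).
(* [N1] keeps the sample points in the neighbourhood of [x]; [N2] makes the edge terms at most
   [e / 2 * (z - y)]. *)
have [N1 H1] := small_inv (ltac:(lra) : 0 < d / 2).
have [N2 H2] := small_inv (ltac:(apply: divr_gt0; nra) : 0 < e / 2 * (z - y) / (e / 2 + `|u x|)).
exists (maxn N1 N2) => n; rewrite geq_max => /andP[/H1 {}H1 /H2 {}H2].
have h0 : 0 < n.+1%:R^-1 :> R by rewrite invr_gt0 ltr0n.
apply: le_trans (@stepsum_est u n y z (e / 2) (u x) y0 yz (ltac:(lra)) _) _.
  move=> t t0 /andP[]; move: H1; set h := _^-1 => H1 ty tz; apply: H => //; rewrite ler_norml; apply/andP; split; lra.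
move: h0 H2; set h := _^-1 => h0; rewrite ler_pdivlMr; last lra.
by nra.
Qed.

Lemma stepsum0 u n : stepsum u n 0 = 0.
Proof. by rewrite /stepsum mulr0 truncn0 big_nil scaler0. Qed.

(** Being eventually within [e / x] times the length of a fixed vector is additive over intervals
    and true locally, so [cousin] applies and no uniform continuity has to be established. *)
Lemma stepsum_cvg u x : contu u -> 0 <= x -> exists l, seqlim (fun n => stepsum u n x) l.
Proof.
move=> uc x0; have [->|xn0] := eqVneq x 0.
  by exists 0 => e e0; exists 0%N => n _; rewrite stepsum0 subrr normr0 ltW.
have {xn0}x0' : 0 < x by rewrite lt_neqAle eq_sym xn0.
apply: seqlim_complete => e e0.
have : exists N z, forall n, (N <= n)%N -> `|stepsum u n x - stepsum u n 0 - z| <= e / x * (x - 0).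
  apply: (@cousin R (fun a b => exists N z, forall n, (N <= n)%N ->
     `|stepsum u n b - stepsum u n a - z| <= e / x * (b - a))) => //.
  - move=> a b c _ _ _ _ [N1 [z1 H1]] [N2 [z2 H2]].
    exists (maxn N1 N2), (z1 + z2) => n; rewrite geq_max => /andP[/H1 {}H1 /H2 {}H2].
    have -> : stepsum u n c - stepsum u n a - (z1 + z2) =
      (stepsum u n b - stepsum u n a - z1) + (stepsum u n c - stepsum u n b - z2) by lmod R.
    by apply: le_trans (ler_normD _ _) _; lra.
  - move=> t /andP[t0 tx]; have [d [d0 H]] := stepsum_loc uc t0 (divr_gt0 e0 x0').
    exists d; split => // y z y0 zx yz xy yx xz zd.
    by have [N HN] := H y z y0 yz xy yx xz zd; exists N; eexists; exact: HN.
rewrite subr0 divfK ?lt0r_neq0 // => -[N [z H]].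
by exists N, z => n /H; rewrite stepsum0 subr0.
Qed.

(** The integral of [u] from [0] to [x]; the default [0] is returned only where the sums do not
    converge. *)
Definition prim u (x : R) : E := xget 0 [set l | seqlim (fun n => stepsum u n x) l].

Lemma primP u x : contu u -> 0 <= x -> seqlim (fun n => stepsum u n x) (prim u x).
Proof.
by move=> uc x0; rewrite /prim; case: xgetP => //= H; have [l Hl] := stepsum_cvg uc x0; case: (H l).
Qed.

Lemma seqlim_unique (x : nat -> E) l l' : seqlim x l -> seqlim x l' -> l = l'.
Proof.
move=> H H'; apply/eqP; rewrite -subr_eq0 -normr_le0; apply/ler_addgt0Pr => e e0; rewrite add0r.
have [N HN] := H (e / 2) (ltac:(lra)); have [N' HN'] := H' (e / 2) (ltac:(lra)).
have := HN _ (leq_maxl N N'); have := HN' _ (leq_maxr N N').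
set y := x _ => A B.
have -> : l - l' = (y - l') - (y - l) by lmod R.
by apply: le_trans (ler_normB _ _) _; lra.
Qed.

Lemma prim0 u : contu u -> prim u 0 = 0.
Proof.
move=> uc; apply: (seqlim_unique (primP uc (lexx 0))) => e e0.
by exists 0%N => n _; rewrite stepsum0 subr0 normr0 ltW.
Qed.

Lemma prim_der u x : contu u -> 0 <= x -> hasder (prim u) x (u x).
Proof.
move=> uc x0 e e0.
have [d [d0 H]] := stepsum_loc uc x0 e0.
have {}H y z : 0 <= y -> y < z -> x - d < y -> y <= x -> x <= z -> z < x + d ->
    `|prim u z - prim u y - (z - y) *: u x| <= e * (z - y).
  move=> y0 yz xy yx xz zx; have [N HN] := H y z y0 yz xy yx xz zx.
  apply/ler_addgt0Pr => e' e'0.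
  have [N1 H1] := primP uc y0 (ltac:(lra) : 0 < e' / 2).
  have [N2 H2] := primP uc (ltac:(lra) : 0 <= z) (ltac:(lra) : 0 < e' / 2).
  pose n := maxn N (maxn N1 N2).
  have {}HN := HN n (leq_maxl _ _).
  have {}H1 := H1 n (leq_trans (leq_maxl _ _) (leq_maxr N _)).
  have {}H2 := H2 n (leq_trans (leq_maxr _ _) (leq_maxr N _)).
  have -> : prim u z - prim u y - (z - y) *: u x =
    (stepsum u n z - stepsum u n y - (z - y) *: u x) + (stepsum u n y - prim u y)
     - (stepsum u n z - prim u z) by lmod R.
  apply: le_trans (ler_normB _ _) _.
  apply: le_trans (lerD (ler_normD _ _) (lexx _)) _; lra.
exists (d / 2); split; first lra.
move=> y y0; rewrite ler_distl => /andP[yd1 yd2].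
have [yx|xy|->] := ltgtP y x.
- rewrite [`|y - x|]distrC (gtr0_norm (_ : 0 < x - y)) ?subr_gt0 //.
  have -> : prim u y - prim u x - (y - x) *: u x = - (prim u x - prim u y - (x - y) *: u x) by lmod R.
  by rewrite normrN; apply: H => //; lra.
- by rewrite (gtr0_norm (_ : 0 < y - x)) ?subr_gt0 //; apply: H => //; lra.
- by rewrite !subrr scale0r subr0 !normr0 mulr0.
Qed.

End Primitive.

Section PrimitiveTheory.
Context {R : realType} {E : completeNormedModType R}.
Implicit Types (u F G : R -> E).

(** Turns identities between integrals into a comparison of derivatives: linearity, substitution and
    the integral form of the generator come from it. *)
Lemma prim_unique F u x : contu u -> 0 <= x -> F 0 = 0 ->
  (forall t, 0 <= t <= x -> hasder F t (u t)) -> F x = prim u x.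
Proof.
move=> uc x0 F0 HF; apply: (der_unique x0 _ HF); first by rewrite F0 prim0.
by move=> t /andP[t0 _]; exact: prim_der.
Qed.

Lemma contu_lin L u : blin L -> contu u -> contu (fun t => L (u t)).
Proof.
move=> HL uc x x0 e e0; have [_ [C [C0 HC]]] := HL.
have [d [d0 Hd]] := uc x x0 (e / (C + 1)) (ltac:(apply: divr_gt0; lra)).
exists d; split => // y y0 yd; rewrite -(blinB HL).
apply: le_trans (HC _) _; have := Hd y y0 yd.
rewrite ler_pdivlMr; last lra.
by have := normr_ge0 (u y - u x); nra.
Qed.

Lemma contuD u v : contu u -> contu v -> contu (fun t => u t + v t).
Proof.
move=> uc vc x x0 e e0.
have [d [d0 Hd]] := uc x x0 (e / 2) (ltac:(lra)); have [d' [d0' Hd']] := vc x x0 (e / 2) (ltac:(lra)).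
exists (Num.min d d'); split; first by rewrite lt_min d0.
move=> y y0; rewrite le_min => /andP[yd yd'].
have -> : u y + v y - (u x + v x) = (u y - u x) + (v y - v x) by lmod R.
by apply: le_trans (ler_normD _ _) _; have := Hd y y0 yd; have := Hd' y y0 yd'; lra.
Qed.

Lemma contu_cst (c : E) : contu (fun _ : R => c).
Proof. by move=> x x0 e e0; exists 1; split => // y _ _; rewrite subrr normr0 ltW. Qed.

Lemma prim_lin L u x : blin L -> contu u -> 0 <= x -> L (prim u x) = prim (fun t => L (u t)) x.
Proof.
move=> HL uc x0; apply: (prim_unique (F := fun t => L (prim u t))) => //.
- exact: contu_lin.
- by rewrite prim0 // (blin0 HL).
- by move=> t /andP[t0 _]; apply: hasder_lin => //; exact: prim_der.
Qed.

Lemma primD u v x : contu u -> contu v -> 0 <= x ->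
  prim (fun t => u t + v t) x = prim u x + prim v x.
Proof.
move=> uc vc x0; apply/esym; apply: (prim_unique (F := fun t => prim u t + prim v t)) => //.
- exact: contuD.
- by rewrite !prim0 // addr0.
- by move=> t /andP[t0 _]; apply: hasderD; exact: prim_der.
Qed.

Lemma prim_norm u (M x : R) : contu u -> 0 <= x -> (forall t, 0 <= t <= x -> `|u t| <= M) ->
  `|prim u x| <= M * x.
Proof.
move=> uc x0 H; rewrite -[prim u x]subr0 -[X in _ - X](prim0 uc).
apply: (@mean_value _ _ _ u) => // t /andP[t0 _]; exact: prim_der.
Qed.

Lemma prim_bound L u (M x : R) : blin L -> contu u -> 0 <= x ->
  (forall t, 0 <= t <= x -> `|L (u t)| <= M) -> `|L (prim u x)| <= M * x.
Proof.
by move=> HL uc x0 H; rewrite prim_lin //; apply: prim_norm => //; exact: contu_lin.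
Qed.

Lemma prim_eq u v x : contu u -> contu v -> 0 <= x -> (forall t, 0 <= t <= x -> u t = v t) ->
  prim u x = prim v x.
Proof.
move=> uc vc x0 uv; apply: prim_unique => //; first by rewrite prim0.
by move=> t /[dup] /uv <- /andP[t0 _]; exact: prim_der.
Qed.

Lemma prim_cst (c : E) x : 0 <= x -> prim (fun _ : R => c) x = x *: c.
Proof.
move=> x0; apply/esym; apply: (prim_unique (F := fun t => t *: c)) => //.
- exact: contu_cst.
- by rewrite scale0r.
move=> t _ e e0; exists 1; split => // y _ _.
by rewrite -scalerBl subrr normr0 mulr_ge0 // ltW.
Qed.

Lemma contu_scale u (a : R) : 0 < a -> contu u -> contu (fun t => u (a * t)).
Proof.
move=> a0 uc x x0 e e0.
have [d [d0 Hd]] := uc (a * x) (ltac:(apply: mulr_ge0; lra)) e e0.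
exists (d / a); split; first exact: divr_gt0.
move=> y y0; rewrite ler_pdivlMr // => yd; apply: Hd; first by apply: mulr_ge0; lra.
by rewrite -mulrBr normrM gtr0_norm // mulrC.
Qed.

Lemma prim_scale u (a x : R) : 0 < a -> contu u -> 0 <= x ->
  prim (fun t => u (a * t)) x = a^-1 *: prim u (a * x).
Proof.
move=> a0 uc x0; apply/esym.
apply: (prim_unique (F := fun t => a^-1 *: prim u (a * t))) => //.
- exact: contu_scale.
- by rewrite mulr0 prim0 // scaler0.
move=> t /andP[t0 _].
have -> : u (a * t) = a^-1 *: (a *: u (a * t)) by lmod_eq R; field; rewrite lt0r_neq0.
apply: hasder_lin; first exact: blin_scale.
by apply: hasder_scale => //; apply: prim_der => //; apply: mulr_ge0 => //; exact: ltW.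
Qed.

Lemma contu_rscale (w : R -> R) u :
  (forall x, 0 <= x -> forall e : R, 0 < e -> exists d : R, 0 < d /\
     forall y, 0 <= y -> `|y - x| <= d -> `|w y - w x| <= e) ->
  contu u -> contu (fun t => w t *: u t).
Proof.
move=> wc uc x x0 e e0.
have ux := normr_ge0 (u x); have wx := normr_ge0 (w x).
have [d [d0 Hd]] := wc x x0 (Num.min 1 (e / 2 / (`|u x| + 1)))
   (ltac:(rewrite lt_min ltr01 /=; apply: divr_gt0; lra)).
have [d' [d0' Hd']] := uc x x0 (e / 2 / (`|w x| + 1)) (ltac:(apply: divr_gt0; lra)).
exists (Num.min d d'); split; first by rewrite lt_min d0.
move=> y y0; rewrite le_min => /andP[yd yd'].
have -> : w y *: u y - w x *: u x = w y *: (u y - u x) + (w y - w x) *: u x by lmod R.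
apply: le_trans (ler_normD _ _) _; rewrite !normrZ.
have := Hd y y0 yd; rewrite le_min ler_pdivlMr; last lra.
move=> /andP[H1 H2].
have := Hd' y y0 yd'; rewrite ler_pdivlMr; last lra.
move=> H3.
have H4 : `|w y| <= `|w x| + 1.
  have -> : w y = w x + (w y - w x) by ring.
  by apply: le_trans (ler_normD _ _) _; lra.
have := normr_ge0 (u y - u x); have := normr_ge0 (w y - w x); have := normr_ge0 (w y); nra.
Qed.
End PrimitiveTheory.

(** * One-parameter groups and their generators *)

Section Representation.
Context {R : realType} {E : completeNormedModType R}.
Variable T : R -> R -> E -> E.
Hypothesis hT : contractive_rep T.
Local Notation S := (Tj T).

Lemma S_blin j t : blin (S j t).
Proof.
have [H _ _ _ H'] := hT.
have p : 0 < (if j then 1 else expR t : R) by case: j; rewrite ?expR_gt0.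
split=> [c x y|]; last first.
  by exists 1; split => // x; rewrite mul1r /Tj; case: (j) p => p; exact: H'.
rewrite /Tj; case: (j) p => p.
  by have [-> _] := H 1 t p (c *: x) y c; have [_ ->] := H 1 t p x y c.
by have [-> _] := H (expR t) 0 p (c *: x) y c; have [_ ->] := H (expR t) 0 p x y c.
Qed.

Lemma S_norm j t f : `|S j t f| <= `|f|.
Proof. by have [_ _ _ _ H] := hT; rewrite /Tj; case: j; apply: H; rewrite ?expR_gt0. Qed.

Lemma S_0 j f : S j 0 f = f.
Proof. by have [_ H _ _ _] := hT; rewrite /Tj expR0; case: j. Qed.

Lemma S_add j t u f : S j (t + u) f = S j t (S j u f).
Proof.
have [_ _ H _ _] := hT; rewrite /Tj; case: j; rewrite -H ?expR_gt0 //.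
  by rewrite !mul1r addrC.
by rewrite expRD mulr0 addr0.
Qed.

Lemma S_comm t u f : S false t (S true u f) = S true (expR t * u) (S false t f).
Proof.
have [_ _ H _ _] := hT; rewrite /Tj -!H ?expR_gt0 //.
by rewrite mulr1 mul1r addr0 mul1r add0r.
Qed.

Lemma S_cont j f : forall x e : R, 0 < e -> exists d : R, 0 < d /\
  forall y, `|y - x| <= d -> `|S j y f - S j x f| <= e.
Proof.
move=> x e e0.
have [_ _ _ H _] := hT.
have oA : open [set p : R * R | 0 < p.1].
  rewrite (_ : [set p | _] = fst @^-1` [set x : R | 0 < x]) //.
  by apply: open_comp; [move=> p _; exact: cvg_fst|exact: open_gt].
have {}H := H f; rewrite continuous_open_subspace // in H.
have c : S j y f @[y --> x] --> S j x f.
  rewrite /Tj; case: j.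
  - have H1 : {for (1, x), continuous (fun p : R * R => T p.1 p.2 f)}.
      by move: (H (1, x)); rewrite inE /= => /(_ ltr01).
    apply: (@continuous_comp R (R * R)%type E (fun y : R => (1, y)) _ x _ H1).
    exact: (@cvg_pair _ _ _ _ (nbhs (1 : R)) (nbhs x) _ _ _ (fun=> 1) id (cvg_cst _) cvg_id).
  - have H1 : {for (expR x, 0), continuous (fun p : R * R => T p.1 p.2 f)}.
      by move: (H (expR x, 0)); rewrite inE /= => /(_ (expR_gt0 x)).
    apply: (@continuous_comp R (R * R)%type E (fun y : R => (expR y, 0)) _ x _ H1).
    exact: (@cvg_pair _ _ _ _ (nbhs (expR x)) (nbhs (0 : R)) _ _ _ (@expR R) (fun=> 0)
      (@continuous_expR R x) (cvg_cst _)).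
have /cvgrPdist_le/(_ e e0) := c.
move=> /nbhs_ballP[d /= d0 Hd]; exists (d / 2); split; first lra.
move=> y yd; rewrite distrC; apply: Hd; rewrite /ball /= distrC; lra.
Qed.

Lemma S_contu j f : contu (S j ^~ f).
Proof.
by move=> x x0 e e0; have [d [d0 H]] := S_cont j f x e0; exists d; split => // y _; exact: H.
Qed.

(** The generator as a relation, with a remainder estimate in place of the limit. Existence and
    value travel together, whereas [gen] returns a value even outside the domain. *)
Definition isgen j f g := forall e : R, 0 < e -> exists d : R, 0 < d /\
  forall t, 0 < t -> t <= d -> `|S j t f - f - t *: g| <= e * t.

Lemma isgenP j f g : isgen j f g <-> (fun t : R => t^-1 *: (S j t f - f)) @ 0^'+ --> g.
Proof.
have key t : 0 < t -> `|g - t^-1 *: (S j t f - f)| = `|S j t f - f - t *: g| / t.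
  move=> t0; rewrite distrC.
  have -> : t^-1 *: (S j t f - f) - g = t^-1 *: (S j t f - f - t *: g).
    by lmod_eq R; field; rewrite lt0r_neq0.
  by rewrite normrZ gtr0_norm ?invr_gt0 // mulrC.
split=> [H|/cvgrPdist_le H].
  apply/cvgrPdist_le => e e0; have [d [d0 Hd]] := H e e0.
  near=> t; have t0 : 0 < t by [].
  rewrite key // ler_pdivrMr //; apply: Hd => //; near: t; exact: nbhs_right_le.
move=> e e0; have := H e e0.
rewrite /at_right near_withinE => /nbhs_ballP[d /= d0 Hd]; exists (d / 2); split; first lra.
move=> t t0 td; have := Hd t; rewrite /ball /= sub0r normrN gtr0_norm // => /(_ _ t0).
by rewrite key // ler_pdivrMr //; apply; lra.
Unshelve. all: by end_near. Qed.

Lemma isgen_gen j f g : isgen j f g -> gen (S j) f = g.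
Proof. by move=> /isgenP H; rewrite /gen; apply: cvg_lim. Qed.

Lemma isgen_dom j f g : isgen j f g -> gen_dom (S j) f.
Proof. by move=> /isgenP H; exists g. Qed.

Lemma gen_domP j f : gen_dom (S j) f -> isgen j f (gen (S j) f).
Proof. by move=> [g /isgenP H]; rewrite (isgen_gen H). Qed.

Lemma isgen_unique j f g g' : isgen j f g -> isgen j f g' -> g = g'.
Proof. by move=> /isgen_gen <- /isgen_gen <-. Qed.

End Representation.

(** Inversion of [1 - h <= expR (- h)], together with [(1 - h) (1 + h + 2 h^2) >= 1] for
    [h <= 1/2]. *)
Lemma expR_le_quad (R : realType) (h : R) : 0 <= h -> h <= 1 / 2 -> expR h <= 1 + h + 2 * h ^+ 2.
Proof.
move=> h0 h1; have e0 := expR_gt0 h.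
have := expR_ge1Dx (- h); rewrite expRN => H.
have : (1 - h) * expR h <= 1.
  by have := ler_wpM2r (ltW e0) H; rewrite mulVf ?lt0r_neq0.
nra.
Qed.

Lemma expR_le_lin (R : realType) (t : R) : 0 <= t -> t <= 1 -> expR t <= 1 + 3 * t.
Proof.
move=> t0 t1.
have H := @expR_le_quad R (t / 2) (ltac:(lra)) (ltac:(lra)).
have e0 := expR_gt0 (t / 2).
have -> : expR t = expR (t / 2) ^+ 2 by rewrite expr2 -expRD -splitr.
have : expR (t / 2) <= 1 + t by nra.
nra.
Qed.

(** * Generators of the two subgroups and their commutation rules *)

Section Generators.
Context {R : realType} {E : completeNormedModType R}.
Variable T : R -> R -> E -> E.
Hypothesis hT : contractive_rep T.
Local Notation S := (Tj T).
Local Notation isgen := (isgen T).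
Let Sb := S_blin hT.

Lemma S_comm_self j t u f : S j t (S j u f) = S j u (S j t f).
Proof. by rewrite -!(S_add hT) addrC. Qed.

(** The group law carries the right derivative at [0] to [x]. From the left, the increment starts at
    [y], and strong continuity replaces [S j y g] by [S j x g]. *)
Lemma isgen_der j f g x : isgen j f g -> hasder (S j ^~ f) x (S j x g).
Proof.
move=> H e e0; have [d [d0 Hd]] := H (e / 2) (ltac:(lra)).
have [d' [d'0 Hd']] := S_cont hT j g x (ltac:(lra) : 0 < e / 2).
exists (Num.min d d'); split; first by rewrite lt_min d0.
move=> y _; rewrite le_min => /andP[].
have [yx|xy|->] := ltgtP y x.
- rewrite ltr0_norm ?subr_lt0 // opprB => yd yd'.
  have -> : S j x f = S j y (S j (x - y) f) by rewrite -(S_add hT) addrC subrK.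
  have -> : S j y f - S j y (S j (x - y) f) - (y - x) *: S j x g =
     - S j y (S j (x - y) f - f - (x - y) *: g) - (x - y) *: (S j y g - S j x g).
    rewrite !(blinB (Sb _ _)) (blinZ (Sb _ _)); lmod R.
  apply: le_trans (ler_normB _ _) _; rewrite normrN normrZ.
  have := le_trans (S_norm hT j y _) (Hd (x - y) (ltac:(lra)) yd).
  have := Hd' y; rewrite distrC gtr0_norm ?subr_gt0 // => /(_ yd').
  nra.
- rewrite gtr0_norm ?subr_gt0 // => yd yd'.
  have -> : S j y f = S j x (S j (y - x) f) by rewrite -(S_add hT) addrC subrK.
  rewrite -(blinB (Sb _ _)) -(blinZ (Sb _ _)) -(blinB (Sb _ _)).
  apply: le_trans (S_norm hT j x _) _.
  apply: le_trans (Hd (y - x) _ yd) _; [lra|].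
  by rewrite ler_wpM2r; lra.
- by rewrite !subrr scale0r subr0 !normr0 mulr0.
Qed.

Lemma isgen_prim j f g h : isgen j f g -> 0 <= h -> S j h f - f = prim (S j ^~ g) h.
Proof.
move=> H h0; apply: (prim_unique (F := fun t => S j t f - f)) => //; first exact: S_contu.
  by rewrite (S_0 hT) subrr.
move=> t _; rewrite -[S j t g]addr0; apply: hasderD; first exact: isgen_der.
exact: hasder_cst.
Qed.

(** The integral equation, unlike the difference quotient, is stable under limits, bounded operators
    and integration; closedness of the generator is proved through it. *)
Lemma isgen_of_prim j f g : (forall h, 0 <= h -> S j h f - f = prim (S j ^~ g) h) -> isgen j f g.
Proof.
move=> H e e0.
have [d [d0 Hd]] := prim_der (S_contu hT j g) (lexx 0) e0.
exists d; split => // t t0 td; rewrite H; last exact: ltW.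
have := Hd t (ltW t0); rewrite subr0 (prim0 (S_contu hT j g)) subr0 (S_0 hT) gtr0_norm //.
exact.
Qed.

Lemma isgenD j f g f' g' : isgen j f g -> isgen j f' g' -> isgen j (f + f') (g + g').
Proof.
move=> H H' e e0; have [d [d0 Hd]] := H (e / 2) (ltac:(lra)).
have [d' [d0' Hd']] := H' (e / 2) (ltac:(lra)).
exists (Num.min d d'); split; first by rewrite lt_min d0.
move=> y y0; rewrite le_min => /andP[yd yd'].
have -> : S j y (f + f') - (f + f') - y *: (g + g') =
  (S j y f - f - y *: g) + (S j y f' - f' - y *: g').
  rewrite (blinD (Sb _ _)); lmod R.
by apply: le_trans (ler_normD _ _) _; have := Hd y y0 yd; have := Hd' y y0 yd'; lra.
Qed.

Lemma isgen_lin L j f g : blin L -> (forall t x, L (S j t x) = S j t (L x)) ->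
  isgen j f g -> isgen j (L f) (L g).
Proof.
move=> HL LS H; apply: isgen_of_prim => h h0.
rewrite -LS -(blinB HL) (isgen_prim H h0) prim_lin //; last exact: S_contu.
by apply: prim_eq => //; [apply: contu_lin => //|]; move=> *; rewrite ?LS //; exact: S_contu.
Qed.

Lemma isgenZ j c f g : isgen j f g -> isgen j (c *: f) (c *: g).
Proof.
apply: (@isgen_lin (fun x => c *: x)); first exact: blin_scale.
by move=> t x; rewrite (blinZ (Sb _ _)).
Qed.

Lemma isgenB j f g f' g' : isgen j f g -> isgen j f' g' -> isgen j (f - f') (g - g').
Proof.
by move=> H H'; have := isgenD H (isgenZ (-1) H'); rewrite !scaleN1r.
Qed.

Lemma isgen0 j : isgen j 0 0.
Proof.
move=> e e0; exists 1; split => // t t0 _.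
by rewrite (blin0 (Sb _ _)) scaler0 !subr0 normr0 mulr_ge0 // ltW.
Qed.

Lemma isgen_S j f g t : isgen j f g -> isgen j (S j t f) (S j t g).
Proof.
by apply: (@isgen_lin (S j t)); [exact: Sb|move=> u x; exact: S_comm_self].
Qed.

Lemma blin_prim j h : 0 <= h -> blin (fun z => prim (S j ^~ z) h).
Proof.
move=> h0; split=> [c x y|]; last first.
  exists h; split => // x; rewrite mulrC; apply: prim_norm => //; first exact: S_contu.
  by move=> t _; exact: S_norm.
have cS z : contu (S j ^~ z) by exact: S_contu.
have cZ : contu (fun t => c *: S j t x) by apply: (contu_lin (blin_scale c)).
have -> : c *: prim (S j ^~ x) h = prim (fun t => c *: S j t x) h.
  exact: (prim_lin (blin_scale c)).
rewrite -primD //; apply: prim_eq => //; first exact: contuD.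
by move=> t _; rewrite (blinD (Sb _ _)) (blinZ (Sb _ _)).
Qed.

(* The generator is closed, hence commutes with integration *)
Lemma isgen_prim_closed j (u v : R -> E) x : contu u -> contu v -> 0 <= x ->
  (forall t, 0 <= t <= x -> isgen j (u t) (v t)) -> isgen j (prim u x) (prim v x).
Proof.
move=> uc vc x0 H; apply: isgen_of_prim => h h0.
have bL : blin (fun z => S j h z + (-1) *: z).
  by apply: blin_add; [exact: Sb|exact: blin_scale].
transitivity (prim (fun t => S j h (u t) + (-1) *: u t) x).
  by rewrite -(prim_lin bL) // scaleN1r.
rewrite (prim_lin (blin_prim j h0)) //; apply: prim_eq => //.
- exact: (contu_lin bL).
- exact: (contu_lin (blin_prim j h0)).
by move=> t tx; rewrite scaleN1r -(isgen_prim (H t tx)).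
Qed.

Lemma isgen_limit j (f g : nat -> E) f0 g0 : seqlim f f0 -> seqlim g g0 ->
  (forall n, isgen j (f n) (g n)) -> isgen j f0 g0.
Proof.
move=> ff gg H; apply: isgen_of_prim => h h0.
apply/eqP; rewrite -subr_eq0 -normr_le0; apply/ler_addgt0Pr => e e0; rewrite add0r.
have [N HN] := ff (e / 4) (ltac:(lra)).
have [N' HN'] := gg (e / 4 / (h + 1)) (ltac:(apply: divr_gt0; lra)).
have {}HN := HN _ (leq_maxl N N'); have {}HN' := HN' _ (leq_maxr N N').
move: HN HN'; set n := maxn _ _ => HN HN'.
have bJ := blin_prim j h0.
have -> : S j h f0 - f0 - prim (S j ^~ g0) h =
  (f n - f0) - S j h (f n - f0) + prim (S j ^~ (g n - g0)) h.
  rewrite (blinB bJ) -(isgen_prim (H n)) // (blinB (Sb _ _)); lmod R.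
apply: le_trans (ler_normD _ _) _; apply: le_trans (lerD (ler_normB _ _) (lexx _)) _.
have := S_norm hT j h (f n - f0).
have : `|prim (S j ^~ (g n - g0)) h| <= `|g n - g0| * h.
  by apply: prim_norm => //; [exact: S_contu|move=> t _; exact: S_norm].
move: HN'; rewrite ler_pdivlMr; last lra.
by have := normr_ge0 (g n - g0); nra.
Qed.

(** Translation by [t] moves the integral over [[0, h]] to [[t, t + h]]; only two end pieces of
    length [t] change, and their means tend to [S j h f] and [f]. *)
Lemma isgen_smooth j f h : 0 <= h -> isgen j (prim (S j ^~ f) h) (S j h f - f).
Proof.
move=> h0 e e0.
have cS := S_contu hT j f.
have [d [d0 Hd]] := prim_der cS h0 (ltac:(lra) : 0 < e / 2).
have [d' [d'0 Hd']] := prim_der cS (lexx 0) (ltac:(lra) : 0 < e / 2).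
exists (Num.min d d'); split; first by rewrite lt_min d0.
move=> t t0; rewrite le_min => /andP[td td'].
have -> : S j t (prim (S j ^~ f) h) = prim (S j ^~ f) (h + t) - prim (S j ^~ f) t.
  apply: (der_unique (F := fun x => S j t (prim (S j ^~ f) x))
    (G := fun x => prim (S j ^~ f) (x + t) - prim (S j ^~ f) t) (u := fun x => S j (x + t) f)) => //.
  - by rewrite (prim0 cS) (blin0 (Sb _ _)) add0r subrr.
  - move=> x /andP[x0 _]; rewrite (S_add hT) S_comm_self.
    by apply: hasder_lin; [exact: Sb|exact: prim_der].
  - move=> x /andP[x0 _]; rewrite -[S j _ f]addr0; apply: hasderD; last exact: hasder_cst.
    by apply: hasder_shift; [exact: ltW|apply: prim_der => //; lra].
have := Hd (h + t) (ltac:(lra)); rewrite (_ : h + t - h = t); last by ring.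
rewrite gtr0_norm // => /(_ td).
have := Hd' t (ltW t0); rewrite subr0 gtr0_norm // => /(_ td').
rewrite (prim0 cS) subr0 (S_0 hT) => A B.
have -> : prim (S j ^~ f) (h + t) - prim (S j ^~ f) t - prim (S j ^~ f) h - t *: (S j h f - f)
 = (prim (S j ^~ f) (h + t) - prim (S j ^~ f) h - t *: S j h f) - (prim (S j ^~ f) t - t *: f)
  by lmod R.
by apply: le_trans (ler_normB _ _) _; lra.
Qed.

(** [A_2 T_1(t) = e^{-t} T_1(t) A_2]: a step [h] of [T_2] to the left of [T_1(t)] becomes a step
    [e^{-t} h] to its right. *)
Lemma isgen_S12 t f g : isgen true f g -> isgen true (S false t f) (expR (- t) *: S false t g).
Proof.
move=> H e e0.
have et0 := expR_gt0 t.
have [d [d0 Hd]] := H (e * expR t) (mulr_gt0 e0 et0).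
exists (d * expR t); split; first exact: mulr_gt0.
move=> h h0 hd.
have -> : S true h (S false t f) = S false t (S true (expR (- t) * h) f).
  by rewrite (S_comm hT) mulrA -expRD subrr expR0 mul1r.
rewrite -(blinB (Sb _ _)) -!(blinZ (Sb _ _)) -(blinB (Sb _ _)).
apply: le_trans (S_norm hT _ _ _) _.
have p : 0 < expR (- t) * h by apply: mulr_gt0 => //; exact: expR_gt0.
rewrite scalerA [h * _]mulrC; apply: le_trans (Hd _ p _) _.
  by rewrite expRN mulrC ler_pdivrMr.
rewrite expRN (_ : _ * _ * (_ * _) = e * h) //; field; exact: lt0r_neq0.
Qed.

(** [A_1 T_2(t) = T_2(t) (A_1 + t A_2)]: moving [T_1(h)] to the right stretches [t] to [e^h t], and
    the displacement [(e^h - 1) t], close to [h t], is felt through [A_2]. *)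
Lemma isgen_S21 t f g1 g2 : 0 <= t -> isgen false f g1 -> isgen true f g2 ->
  isgen false (S true t f) (S true t g1 + t *: S true t g2).
Proof.
move=> t0 H1 H2 e e0.
have [d1 [d10 Hd1]] := H1 (e / 4) (ltac:(lra)).
have [d2 [d20 Hd2]] := S_cont hT true g1 t (ltac:(lra) : 0 < e / 4).
have [d3 [d30 Hd3]] := isgen_der t H2 (ltac:(apply: divr_gt0; lra) : 0 < e / (12 * (t + 1))).
have g0 := normr_ge0 g2.
(* Since [y - t <= 3 h t], the divisors [3 (t + 1)] bring [y] within [d2] and [d3] of [t]; [d5]
   tames the quadratic remainder of [expR h]. *)
pose d4 := Num.min (d2 / (3 * (t + 1))) (d3 / (3 * (t + 1))).
pose d5 := Num.min (e / (8 * (t * `|g2| + 1))) (1 / 2).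
exists (Num.min d1 (Num.min d4 d5)); split.
  by rewrite !lt_min d10 !divr_gt0 //=; nra.
move=> h h0; rewrite !le_min ler_pdivlMr; last nra.
rewrite ler_pdivlMr; last nra.
rewrite ler_pdivlMr; last nra.
move=> /andP[hd1 /andP[/andP[hd2 hd3] /andP[hd5 h2]]].
have e1 := @expR_le_quad R h (ltW h0) h2.
have e2 := @expR_le_lin R h (ltW h0) (ltac:(lra)).
have e3 := expR_ge1Dx h.
rewrite (S_comm hT).
set y := expR h * t.
have ty : t <= y by rewrite /y; nra.
have yt : `|y - t| = y - t by rewrite ger0_norm // subr_ge0.
have yt3 : y - t <= 3 * h * t by rewrite /y; nra.
have -> : S true y (S false h f) - S true t f - h *: (S true t g1 + t *: S true t g2) =
   S true y (S false h f - f - h *: g1) + h *: (S true y g1 - S true t g1)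
   + (S true y f - S true t f - (y - t) *: S true t g2)
   + ((expR h - 1 - h) * t) *: S true t g2.
  rewrite !(blinB (Sb _ _)) (blinZ (Sb _ _)) /y; lmod R.
have A1 : `|S true y (S false h f - f - h *: g1)| <= e / 4 * h.
  by apply: le_trans (S_norm hT _ _ _) (Hd1 h h0 hd1).
have A2 : `|h *: (S true y g1 - S true t g1)| <= h * (e / 4).
  by rewrite normrZ gtr0_norm // ler_wpM2l ?(ltW h0) //; apply: Hd2; rewrite yt; nra.
have A3 : `|S true y f - S true t f - (y - t) *: S true t g2| <= e / 4 * h.
  apply: le_trans (Hd3 y _ _) _; first lra.
    by rewrite yt; nra.
  by rewrite yt mulrAC ler_pdivrMr; nra.
have A4 : `|((expR h - 1 - h) * t) *: S true t g2| <= e / 4 * h.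
  rewrite normrZ ger0_norm; last by apply: mulr_ge0 => //; lra.
  have := S_norm hT true t g2.
  have : (expR h - 1 - h) * t <= 2 * h ^+ 2 * t by rewrite ler_wpM2r //; lra.
  set a := (expR h - 1 - h) * t => B1 B2.
  apply: (@le_trans _ _ (2 * h ^+ 2 * t * `|g2|)).
    apply: ler_pM => //; rewrite /a; apply: mulr_ge0 => //; lra.
  by have : 0 <= t * `|g2|; [apply: mulr_ge0|nra].
apply: le_trans (ler_normD _ _) _.
apply: le_trans (lerD (ler_normD _ _) (lexx _)) _.
apply: le_trans (lerD (lerD (ler_normD _ _) (lexx _)) (lexx _)) _.
lra.
Qed.

End Generators.

Local Arguments Tj : simpl never.

(** * Moduli of smoothness *)

Section Moduli.
Context {R : realType} {E : completeNormedModType R}.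
Variable T : R -> R -> E -> E.
Hypothesis hT : contractive_rep T.
Local Notation S := (Tj T).
Local Notation isgen := (isgen T).
Let Sb := S_blin hT.

Definition Dif j t (f : E) : E := S j t f - f.

Lemma Dif_blin j t : blin (Dif j t).
Proof.
split=> [c x y|]; first by rewrite /Dif (blinD (Sb _ _)) (blinZ (Sb _ _)); lmod R.
exists 2; split => // x; rewrite /Dif; apply: le_trans (ler_normB _ _) _.
by have := S_norm hT j t x; lra.
Qed.

Lemma Dif_norm j t f : `|Dif j t f| <= 2 * `|f|.
Proof. by apply: le_trans (ler_normB _ _) _; have := S_norm hT j t f; lra. Qed.

Lemma Dif0 j f : Dif j 0 f = 0.
Proof. by rewrite /Dif (S_0 hT) subrr. Qed.

Lemma Dif_add j t u f : Dif j (t + u) f = Dif j t f + Dif j u f + Dif j t (Dif j u f).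
Proof. by rewrite /Dif (S_add hT) (blinB (Sb _ _)); lmod R. Qed.

(* The functionals whose norms make up the scale of seminorms [|f|],
   [s |f| + Omega^1(s, f)] and [s^2 |f| + Omega^2(s, f)]; every order above 2 is identified with 2. *)
Definition test (a : nat) (s : R) (L : E -> E) : Prop :=
  match a with
  | 0%N => L = id
  | 1%N => L = (fun x => s *: x) \/ exists j t, 0 <= t <= s /\ L = Dif j t
  | _ => L = (fun x => s ^+ 2 *: x) \/ exists j l t u,
           [/\ 0 <= t <= s, 0 <= u <= s & L = fun x => Dif j t (Dif l u x)]
  end.

Definition bd a s (f : E) (c : R) := forall L, test a s L -> `|L f| <= c.

Lemma test_blin a s L : test a s L -> blin L.
Proof.
case: a => [->|[|a]]; first exact: blin_id.
  by case=> [->|[j [t [_ ->]]]]; [exact: blin_scale|exact: Dif_blin].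
case=> [->|[j [l [t [u [_ _ ->]]]]]]; first exact: blin_scale.
by apply: blin_comp; exact: Dif_blin.
Qed.

Lemma test_ex a s : exists L, test a s L.
Proof. by case: a => [|[|a]]; eexists; first reflexivity; left; reflexivity. Qed.

Lemma bd_ge0 a s f c : bd a s f c -> 0 <= c.
Proof. by have [L HL] := test_ex a s => /(_ L HL); exact: le_trans. Qed.

Lemma bd_le a s f c c' : bd a s f c -> c <= c' -> bd a s f c'.
Proof. by move=> H cc L /H; move/le_trans; apply. Qed.

Lemma bdD a s f g c c' : bd a s f c -> bd a s g c' -> bd a s (f + g) (c + c').
Proof.
move=> H H' L HL; rewrite (blinD (test_blin HL)).
by apply: le_trans (ler_normD _ _) _; apply: lerD; [exact: H|exact: H'].
Qed.

Lemma bdZ a s k f c : bd a s f c -> bd a s (k *: f) (`|k| * c).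
Proof. by move=> H L HL; rewrite (blinZ (test_blin HL)) normrZ ler_wpM2l //; exact: H. Qed.

Lemma bd0v a s : bd a s 0 0.
Proof. by move=> L HL; rewrite (blin0 (test_blin HL)) normr0. Qed.

Lemma bd_avg a s u c : contu u -> (forall t, 0 <= t <= 1 -> bd a s (u t) c) -> bd a s (prim u 1) c.
Proof.
move=> uc H L HL; rewrite -[c]mulr1; apply: prim_bound => //; first exact: test_blin HL.
by move=> t /H; exact.
Qed.

Lemma bd0E s f c : bd 0 s f c <-> `|f| <= c.
Proof. by split=> [/(_ id erefl)|H L ->]. Qed.

Lemma bd1E s f c : 0 <= s -> bd 1 s f c <->
  s * `|f| <= c /\ forall j t, 0 <= t <= s -> `|Dif j t f| <= c.
Proof.
move=> s0; split=> [H|[H1 H2] L [->|[j [t [ts ->]]]]]; last exact: H2.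
  split; first by have := H _ (or_introl erefl); rewrite normrZ ger0_norm.
  by move=> j t ts; apply: (H (Dif j t)); right; exists j, t.
by rewrite normrZ ger0_norm.
Qed.

Lemma bd2E a s f c : bd a.+2 s f c <->
  s ^+ 2 * `|f| <= c /\ forall j l t u, 0 <= t <= s -> 0 <= u <= s -> `|Dif j t (Dif l u f)| <= c.
Proof.
have s0 := sqr_ge0 s.
split=> [H|[H1 H2] L [->|[j [l [t [u [ts us ->]]]]]]]; last exact: H2.
  split; first by have := H _ (or_introl erefl); rewrite normrZ ger0_norm.
  move=> j l t u ts us; apply: (H (fun x => Dif j t (Dif l u x))); right.
  by exists j, l, t, u.
by rewrite normrZ ger0_norm.
Qed.

Lemma Dif_mul j (n : nat) t g : `|Dif j (n%:R * t) g| <= n%:R * `|Dif j t g|.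
Proof.
elim: n => [|n IH]; first by rewrite !mul0r Dif0 normr0.
rewrite -natr1 mulrDl mul1r mulrDl mul1r /Dif (S_add hT).
have -> : S j (n%:R * t) (S j t g) - g = S j (n%:R * t) (S j t g - g) + (S j (n%:R * t) g - g).
  rewrite (blinB (Sb _ _)); lmod R.
rewrite addrC; apply: le_trans (ler_normD _ _) _.
by apply: lerD => //; exact: S_norm.
Qed.

Lemma Dif_far j (n : nat) s x c g : (0 < n)%N -> (forall y, 0 <= y <= s -> `|Dif j y g| <= c) ->
  0 <= x -> x <= n%:R * s -> `|Dif j x g| <= n%:R * c.
Proof.
move=> n0 H x0 xs.
have n0' : (0 : R) < n%:R by rewrite ltr0n.
have -> : x = n%:R * (x / n%:R) by rewrite mulrC mulfVK // lt0r_neq0.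
apply: le_trans (Dif_mul _ _ _ _) _; rewrite ler_pM2l //; apply: H.
by apply/andP; split; [apply: divr_ge0 => //|rewrite ler_pdivrMr // mulrC].
Qed.

(* [n D(t) = D(n t) - sum_(i < n) D(i t) D(t)], the identity behind Marchaud's inequality *)
Lemma Dif_nat j (n : nat) t f (c : nat -> R) :
  (forall i, (i < n)%N -> `|Dif j (i%:R * t) (Dif j t f)| <= c i) ->
  `|Dif j (n%:R * t) f - n%:R *: Dif j t f| <= \sum_(i < n) c i.
Proof.
elim: n => [|n IH] H.
  by rewrite big_ord0 mul0r Dif0 scale0r subr0 normr0.
rewrite big_ord_recr /= -natr1 mulrDl mul1r Dif_add.
have -> : Dif j (n%:R * t) f + Dif j t f + Dif j (n%:R * t) (Dif j t f) - (n%:R + 1) *: Dif j t f =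
  (Dif j (n%:R * t) f - n%:R *: Dif j t f) + Dif j (n%:R * t) (Dif j t f) by lmod R.
apply: le_trans (ler_normD _ _) _; apply: lerD; last exact: H.
by apply: IH => i ni; apply: H; exact: ltnW.
Qed.

Lemma inv_nat (s : R) : 0 < s -> s <= 1 -> exists n : nat,
  [/\ (0 < n)%N, s^-1 <= n%:R & n%:R <= 2 / s].
Proof.
move=> s0 s1; exists (Num.trunc s^-1).+1.
have s1' : 1 <= s^-1 by rewrite invr_ge1 // unitfE lt0r_neq0.
have /truncn_itv/andP[H1 H2] : 0 <= s^-1 by lra.
by split => //; [exact: ltW|rewrite -natr1; lra].
Qed.

(** Marchaud's inequality at a single scale. With [n] of order [1 / s] in [Dif_nat], the difference
    [D(n t) f] is bounded trivially by [2 |f| <= 2 n c / s], and the second differences contribute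
    at most [n^2 c], where [n c <= 2 c / s]; dividing by [n] gives [4 c / s]. *)
Lemma bd2_bd1 s f c : 0 < s -> s <= 1 -> bd 2 s f c -> bd 1 s f (4 * c / s).
Proof.
move=> s0 s1 H; have c0 := bd_ge0 H; move/bd2E: H => [H1 H2].
have cs : 0 <= c / s by rewrite divr_ge0 // ltW.
have sf : s * `|f| <= c / s by rewrite ler_pdivlMr //; nra.
apply/bd1E; first exact: ltW.
rewrite -mulrA; split; first lra.
move=> j t ts.
have [n [n0 n1 n2]] := inv_nat s0 s1.
have n0' : (0 : R) < n%:R by rewrite ltr0n.
have H3 : `|Dif j (n%:R * t) f - n%:R *: Dif j t f| <= n%:R * (n%:R * c).
  apply: le_trans (@Dif_nat j n t f (fun _ => n%:R * c) _) _.
    move=> i ni; apply: le_trans (Dif_mul _ _ _ _) _.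
    apply: ler_pM => //; first by rewrite ler_nat ltnW.
    exact: H2.
  by rewrite sumr_const card_ord -[X in X <= _]mulr_natl.
have H4 := Dif_norm j (n%:R * t) f.
have : n%:R * `|Dif j t f| <= 2 * `|f| + n%:R * (n%:R * c).
  rewrite -{1}(gtr0_norm n0') -normrZ.
  have -> : n%:R *: Dif j t f = Dif j (n%:R * t) f - (Dif j (n%:R * t) f - n%:R *: Dif j t f) by lmod R.
  by apply: le_trans (ler_normB _ _) _; lra.
have : n%:R * c <= 2 * (c / s) by rewrite mulrA [2 * c]mulrC -mulrA mulrC ler_wpM2l.
have : `|f| <= n%:R * (c / s).
  apply: (@le_trans _ _ (s^-1 * (c / s))); last by rewrite ler_wpM2r.
  by rewrite mulrC ler_pdivlMr // mulrC.
nra.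
Qed.

(** The exchange rate of the whole calculus: one order costs a factor [4 / s], so a coefficient of
    size [s] makes up for one missing order. *)
Lemma bdS a s f c : 0 < s -> s <= 1 -> bd a.+1 s f c -> bd a s f (4 * c / s).
Proof.
move=> s0 s1; case: a => [|[|a]] H.
- have c0 := bd_ge0 H; move/(bd1E _ _ (ltW s0)): H => [H1 _].
  by apply/bd0E; rewrite ler_pdivlMr //; nra.
- exact: bd2_bd1.
- apply: (bd_le H); have c0 := bd_ge0 H; rewrite ler_pdivlMr //; nra.
Qed.

Lemma bdS_iter d a s f c : 0 < s -> s <= 1 -> bd (a + d) s f c -> bd a s f (4 ^+ d * c / s ^+ d).
Proof.
move=> s0 s1; elim: d c => [|d IH] c; first by rewrite addn0 !expr0 mul1r divr1.
rewrite addnS => /(bdS s0 s1)/IH.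
rewrite (_ : 4 ^+ d.+1 * c / s ^+ d.+1 = 4 ^+ d * (4 * c / s) / s ^+ d) // !exprS.
have := expf_neq0 d (lt0r_neq0 s0); have := lt0r_neq0 s0.
by move: (s ^+ d) (4 ^+ d) => b x s0' b0; field; rewrite s0' b0.
Qed.

Lemma bd_mono a s f c : 0 <= s -> s <= 1 -> bd a s f c -> bd a.+1 s f (2 * c).
Proof.
move=> s0 s1; case: a => [|[|a]] H; have c0 := bd_ge0 H.
- move/bd0E: H => H; apply/bd1E => //; split; first by have := normr_ge0 f; nra.
  by move=> j t _; apply: le_trans (Dif_norm _ _ _) _; lra.
- move/(bd1E _ _ s0): H => [H1 H2]; apply/bd2E; split.
    by have := normr_ge0 f; nra.
  by move=> j l t u _ us; apply: le_trans (Dif_norm _ _ _) _; have := H2 l u us; lra.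
- by apply: (bd_le H); lra.
Qed.

Lemma bd_mono_iter d a s f c : 0 <= s -> s <= 1 -> bd a s f c -> bd (a + d) s f (2 ^+ d * c).
Proof.
move=> s0 s1 H; elim: d => [|d IH]; first by rewrite addn0 mul1r.
by rewrite addnS exprS -mulrA; exact: bd_mono.
Qed.

(** First differences with steps of size [s^2] are of second order; commutators of two steps of size
    [s] produce just such steps. For [y <= s^2 / 2] and [n] of order [1 / s], the step [n y] is at
    most [s], so [n D(y)] is bounded by [4 c / s + n c], at most [5 n c]. The range [K s^2] is cut
    into [2 K] such steps. *)
Lemma bd2_small (K : nat) s f c j x : (0 < K)%N -> 0 < s -> s <= 1 -> bd 2 s f c ->
  0 <= x -> x <= K%:R * s ^+ 2 -> `|Dif j x f| <= (2 * K)%:R * (5 * c).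
Proof.
move=> K0 s0 s1 H x0 xs.
apply: (@Dif_far j (2 * K) (s ^+ 2 / 2)) => //; first by rewrite muln_gt0.
  move=> y /andP[y0 ys].
  have [n [n0 n1 n2]] := inv_nat s0 s1.
  have n0' : (0 : R) < n%:R by rewrite ltr0n.
  have /bd2E [_ H2] := H.
  have /(bd1E _ _ (ltW s0)) [_ H1] := bd2_bd1 s0 s1 H.
  have ny : n%:R * y <= s.
    apply: (@le_trans _ _ (2 / s * (s ^+ 2 / 2))); first by apply: ler_pM => //; exact: ltW.
    rewrite (_ : 2 / s * (s ^+ 2 / 2) = s) //; field; exact: lt0r_neq0.
  have ny0 : 0 <= n%:R * y by apply: mulr_ge0.
  have iy i : (i <= n)%N -> 0 <= i%:R * y <= s.
    move=> ni; rewrite mulr_ge0 //=; apply: le_trans ny; rewrite ler_wpM2r // ler_nat //.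
  have H3 : `|Dif j (n%:R * y) f - n%:R *: Dif j y f| <= n%:R * c.
    apply: le_trans (@Dif_nat j n y f (fun _ => c) _) _.
      move=> i ni; apply: H2; first by apply: iy; exact: ltnW.
      by have := iy 1%N n0; rewrite mul1r.
    by rewrite sumr_const card_ord -[X in X <= _]mulr_natl.
  have : n%:R * `|Dif j y f| <= 4 * c / s + n%:R * c.
    rewrite -{1}(gtr0_norm n0') -normrZ.
    have -> : n%:R *: Dif j y f = Dif j (n%:R * y) f - (Dif j (n%:R * y) f - n%:R *: Dif j y f) by lmod R.
    apply: le_trans (ler_normB _ _) _; apply: lerD => //.
    by apply: H1; exact: iy.
  have c0 := bd_ge0 H.
  have : 4 * c / s <= n%:R * (4 * c) by rewrite mulrC ler_wpM2r //; lra.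
  nra.
rewrite natrM; lra.
Qed.

(** Only a difference of [T_1] passing a translation by [T_2] leaves a remainder, with step
    [x = (e^t - 1) tau]. A difference of [T_2] passing [T_1] merely shrinks its step by
    [e^{-tau}]. *)
Lemma Dif_conj b j t tau f : 0 <= t -> t <= 1 -> 0 <= tau -> exists tau' t' x,
  [/\ 0 <= t' <= t, 0 <= tau' <= 4 * tau, 0 <= x <= 3 * t * tau &
   Dif b t (S j tau f) = S j tau' (Dif b t' f) + S true tau (Dif true x f)].
Proof.
move=> t0 t1 tau0.
have tt : 0 <= 3 * t * tau by rewrite !mulr_ge0.
case: j; case: b.
- exists tau, t, 0; split; rewrite ?lexx ?t0 ?tau0 //=; first lra.
  by rewrite Dif0 (blin0 (Sb _ _)) addr0 /Dif (S_comm_self hT) (blinB (Sb _ _)).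
- have e1 := expR_ge1Dx t; have e2 := expR_le_lin t0 t1.
  exists (expR t * tau), t, ((expR t - 1) * tau); split; rewrite ?lexx ?t0 //=.
  + by apply/andP; split; nra.
  + by apply/andP; split; nra.
  rewrite /Dif (S_comm hT) !(blinB (Sb _ _)) -(S_add hT).
  rewrite (_ : tau + (expR t - 1) * tau = expR t * tau); last by ring.
  lmod R.
- exists tau, (expR (- tau) * t), 0.
  have e1 : 1 <= expR tau by have := expR_ge1Dx tau; lra.
  have e2 := expR_gt0 (- tau).
  have e3 : expR (- tau) <= 1 by rewrite expRN invf_le1 //; lra.
  split; rewrite ?lexx ?tau0 //=; [by apply/andP; split; nra|lra|].
  rewrite Dif0 (blin0 (Sb _ _)) addr0 /Dif (blinB (Sb _ _)) (S_comm hT).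
  by rewrite mulrA -expRD subrr expR0 mul1r.
- exists tau, t, 0; split; rewrite ?lexx ?t0 ?tau0 //=; first lra.
  by rewrite Dif0 (blin0 (Sb _ _)) addr0 /Dif (S_comm_self hT) (blinB (Sb _ _)).
Qed.

End Moduli.

(** * Calculus of averaging and difference operators *)

Section Operators.
Context {R : realType} {E : completeNormedModType R}.
Variable T : R -> R -> E -> E.
Hypothesis hT : contractive_rep T.
Local Notation S := (Tj T).
Local Notation isgen := (isgen T).
Local Notation bd := (bd T).
Let Sb := S_blin hT.
Let Db := Dif_blin hT.

(** Each difference is conjugated past [S j tau]. The remainders have steps of size at most
    [12 s^2]: [Dif_far] handles them where one order is left to gain, and [bd2_small] handles the
    one that must count as second order. *)
Lemma bd_S a s j tau f c : 0 < s -> s <= 1 -> 0 <= tau <= s -> bd a s f c ->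
  bd a s (S j tau f) (100 * c).
Proof.
move=> s0 s1 /andP[tau0 taus]; case: a => [|[|a]] H; have c0 := bd_ge0 H.
- by move/bd0E: H => H; apply/bd0E; have := S_norm hT j tau f; lra.
- move/(bd1E _ _ _ (ltW s0)): H => [H1 H2]; apply/bd1E; first exact: ltW.
  split.
    have : s * `|S j tau f| <= s * `|f| by rewrite ler_wpM2l ?(ltW s0) //; exact: S_norm.
    lra.
  move=> b t /andP[t0 ts].
  have [tau' [t' [x [/andP[t'0 t's] _ /andP[x0 xs] ->]]]] :=
    Dif_conj hT b j f t0 (ltac:(lra)) tau0.
  apply: le_trans (ler_normD _ _) _.
  have := le_trans (S_norm hT j tau' _) (H2 b t' (ltac:(lra))).
  have H3 : `|Dif T true x f| <= 3%:R * c.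
    by apply: (@Dif_far _ _ _ hT _ _ s) => //; [exact: H2|nra].
  by have := S_norm hT true tau (Dif T true x f); lra.
- have Hs x := @bd2_small _ _ _ hT 3 s f c true x isT s0 s1 H; move/bd2E: H => [H1 H2]; apply/bd2E.
  split.
    have : s ^+ 2 * `|S j tau f| <= s ^+ 2 * `|f|.
      by rewrite ler_wpM2l ?sqr_ge0 //; exact: S_norm.
    lra.
  move=> a' b t u /andP[t0 ts] /andP[u0 us].
  have [tau' [t' [x [/andP[t'0 t's] /andP[tau'0 tau's] /andP[x0 xs] ->]]]] :=
    Dif_conj hT b j f u0 (ltac:(lra)) tau0.
  rewrite (blinD (Db _ _)).
  have [tau2 [t2 [x2 [/andP[t20 t2s] _ /andP[x20 x2s] ->]]]] :=
    Dif_conj hT a' j (Dif T b t' f) t0 (ltac:(lra)) tau'0.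
  apply: le_trans (ler_normD _ _) _.
  apply: le_trans (lerD (ler_normD _ _) (lexx _)) _.
  have A1 := le_trans (S_norm hT j tau2 _) (H2 a' b t2 t' (ltac:(lra)) (ltac:(lra))).
  have A2 : `|Dif T true x2 (Dif T b t' f)| <= 12%:R * c.
    apply: (@Dif_far _ _ _ hT _ _ s) => //; last nra.
    by move=> y ys; apply: H2 => //; lra.
  have A3 := S_norm hT true tau' (Dif T true x2 (Dif T b t' f)).
  have A4 : `|Dif T true x f| <= (2 * 3)%:R * (5 * c) by apply: Hs => //; nra.
  have A5 := Dif_norm hT a' t (S true tau (Dif T true x f)).
  have A6 := S_norm hT true tau (Dif T true x f).
  (* Total [1 + 12 + 2 * 30] times [c]; 30 is [6 * 5] from [bd2_small], doubled by the outer
     difference. *)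
  by rewrite natrM in A4; lra.
Qed.

(** A difference consumes one order. From order 2 on the scale is constant, and there the bound is
    merely that of [bd_S] plus the identity, whence 101. *)
Lemma bd_Dif a s j tau f c : 0 < s -> s <= 1 -> 0 <= tau <= s -> bd a.+1 s f c ->
  bd a s (Dif T j tau f) (101 * c).
Proof.
move=> s0 s1 taus; case: a => [|[|a]] H; have c0 := bd_ge0 H.
- move/(bd1E _ _ _ (ltW s0)): H => [_ H2]; apply/bd0E.
  by apply: le_trans (H2 j tau taus) _; lra.
- have /(bd1E _ _ _ (ltW s0)) [_ H1] := bd2_bd1 hT s0 s1 H.
  move/bd2E: H => [_ H2]; apply/bd1E; first exact: ltW.
  split.
    have := ler_wpM2l (ltW s0) (H1 j tau taus).
    rewrite (_ : s * (4 * c / s) = 4 * c); last by field; exact: lt0r_neq0.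
    by lra.
  by move=> b t ts; apply: le_trans (H2 b j t tau ts taus) _; lra.
- have H' := bdD hT (bd_S j s0 s1 taus H) (bdZ hT (-1) H).
  by rewrite scaleN1r in H'; apply: (bd_le H'); rewrite normrN1; lra.
Qed.

(* [BD d i]: [f] lies in E^i and every derivative of order at most [i] satisfies [bd d] *)
Fixpoint BD (d i : nat) (s : R) (f : E) (c : R) : Prop :=
  bd d s f c /\ match i with
  | 0%N => True
  | i'.+1 => forall j, exists g, isgen j f g /\ BD d i' s g c
  end.

Lemma BD_bd d i s f c : BD d i s f c -> bd d s f c.
Proof. by case: i => [|i] []. Qed.

Lemma BD_le d i s f c c' : BD d i s f c -> c <= c' -> BD d i s f c'.
Proof.
elim: i f => [|i IH] f [H1 H2] cc; split=> //; try exact: bd_le H1 cc.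
by move=> j; have [g [Hg /IH H]] := H2 j; exists g; split => //; exact: H.
Qed.

Lemma BDD d i s f g c c' : BD d i s f c -> BD d i s g c' -> BD d i s (f + g) (c + c').
Proof.
elim: i f g => [|i IH] f g [H1 H2] [H1' H2']; split=> //; try exact: (bdD hT).
move=> j; have [h [Hh H]] := H2 j; have [h' [Hh' H']] := H2' j.
by exists (h + h'); split; [exact: isgenD|exact: IH].
Qed.

Lemma BDZ d i s k f c : BD d i s f c -> BD d i s (k *: f) (`|k| * c).
Proof.
elim: i f => [|i IH] f [H1 H2]; split=> //; try exact: (bdZ hT).
move=> j; have [h [Hh H]] := H2 j.
by exists (k *: h); split; [exact: isgenZ|exact: IH].
Qed.

Lemma BDB d i s f g c c' : BD d i s f c -> BD d i s g c' -> BD d i s (f - g) (c + c').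
Proof.
move=> H H'; have := BDD H (BDZ (-1) H').
by rewrite scaleN1r normrN1 mul1r.
Qed.

Lemma BD0v d i s : BD d i s 0 0.
Proof.
elim: i => [|i IH]; split=> //; try exact: (bd0v hT).
by move=> j; exists 0; split => //; exact: isgen0.
Qed.

Lemma BD_pred d i s f c : BD d i.+1 s f c -> BD d i s f c.
Proof.
elim: i f => [|i IH] f [H1 H2]; split=> // j.
by have [g [Hg /IH Hg']] := H2 j; exists g.
Qed.

Lemma BD_sub d i i' s f c : (i' <= i)%N -> BD d i s f c -> BD d i' s f c.
Proof.
move=> /subnK <-; elim: (_ - _)%N => [//|n IH].
by rewrite addSn => /BD_pred.
Qed.

Lemma BD_gen d i s f c j g : BD d i.+1 s f c -> isgen j f g -> BD d i s g c.
Proof. by move=> [_ /(_ j) [g' [Hg' H]]] Hg; rewrite (isgen_unique Hg Hg'). Qed.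

(* [gbase d B]: [B s] gains [d] orders in the scale [bd], uniformly in [s] *)
Definition gbase (d : nat) (B : R -> E -> E) : Prop :=
  (forall s, 0 < s -> s <= 1 -> blin (B s)) /\
  exists C : R, 0 <= C /\ forall s, 0 < s -> s <= 1 -> forall a f c,
    bd (a + d) s f c -> bd a s (B s f) (C * c).

(* [good i d B]: moreover [A_j B = sum_l B'_{jl} A_l] with [B'_{jl}] of the same kind, [i] times *)
Fixpoint good (i d : nat) (B : R -> E -> E) : Prop :=
  gbase d B /\ match i with
  | 0%N => True
  | i'.+1 => exists B' : bool -> bool -> R -> E -> E, (forall j l, good i' d (B' j l)) /\
      forall s, 0 < s -> s <= 1 -> forall f g1 g2, isgen false f g1 -> isgen true f g2 ->
      forall j, isgen j (B s f) (B' j false s g1 + B' j true s g2)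
  end.

Lemma good_base i d B : good i d B -> gbase d B.
Proof. by case: i => [|i] []. Qed.

Lemma good_blin i d B s : good i d B -> 0 < s -> s <= 1 -> blin (B s).
Proof. by move=> /good_base [H _]; exact: H. Qed.

(** [A_j B f] is expressed by the [B'_{jl}] applied to the [A_l f], for which the bound holds by
    induction; summing four constants makes it uniform in [j] and [l]. *)
Lemma good_BD i d B : good i d B -> exists C : R, 0 <= C /\ forall s, 0 < s -> s <= 1 ->
  forall a f c, BD (a + d) i s f c -> BD a i s (B s f) (C * c).
Proof.
elim: i B => [|i IH] B.
  by move=> [[_ [C [C0 HC]]] _]; exists C; split => // s s0 s1 a f c [H _]; split => //; exact: HC.
move=> [[_ [C [C0 HC]]] [B' [HB' HB]]].
have [D [D0 HD]] : exists D : R, 0 <= D /\ forall j l s, 0 < s -> s <= 1 ->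
    forall a f c, BD (a + d) i s f c -> BD a i s (B' j l s f) (D * c).
  have [D1 [D10 HD1]] := IH _ (HB' false false).
  have [D2 [D20 HD2]] := IH _ (HB' false true).
  have [D3 [D30 HD3]] := IH _ (HB' true false).
  have [D4 [D40 HD4]] := IH _ (HB' true true).
  exists (D1 + D2 + D3 + D4); split; first lra.
  move=> j l s s0 s1 a f c H; have c0 := bd_ge0 (BD_bd H).
  case: j; case: l; [move: (HD4 s s0 s1 a f c H)|move: (HD3 s s0 s1 a f c H)|
    move: (HD2 s s0 s1 a f c H)|move: (HD1 s s0 s1 a f c H)] => /BD_le; apply;
    rewrite ler_wpM2r //; lra.
exists (C + 2 * D); split; first lra.
move=> s s0 s1 a f c H; have c0 := bd_ge0 (BD_bd H).
move: H => [H1 H2]; split; first by apply: (bd_le (HC s s0 s1 a f c H1)); nra.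
have [g1 [Hg1 G1]] := H2 false; have [g2 [Hg2 G2]] := H2 true.
move=> j; exists (B' j false s g1 + B' j true s g2); split; first exact: HB.
apply: BD_le (BDD (HD j false s s0 s1 a g1 c G1) (HD j true s s0 s1 a g2 c G2)) _.
nra.
Qed.

Lemma gbaseD d B1 B2 : gbase d B1 -> gbase d B2 -> gbase d (fun s f => B1 s f + B2 s f).
Proof.
move=> [L1 [C1 [C10 HC1]]] [L2 [C2 [C20 HC2]]].
split=> [s s0 s1|]; first by apply: blin_add; [exact: L1|exact: L2].
exists (C1 + C2); split; first lra.
move=> s s0 s1 a f c H; rewrite mulrDl; apply: (bdD hT); [exact: HC1|exact: HC2].
Qed.

Lemma gbase_comp d1 d2 B1 B2 : gbase d1 B1 -> gbase d2 B2 ->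
  gbase (d1 + d2) (fun s f => B1 s (B2 s f)).
Proof.
move=> [L1 [C1 [C10 HC1]]] [L2 [C2 [C20 HC2]]].
split=> [s s0 s1|]; first by apply: blin_comp; [exact: L1|exact: L2].
exists (C1 * C2); split; first exact: mulr_ge0.
by move=> s s0 s1 a f c H; rewrite -mulrA; apply: HC1 => //; apply: HC2 => //; rewrite -addnA.
Qed.

Lemma gbaseZ d k B : gbase d B -> gbase d (fun s f => k *: B s f).
Proof.
move=> [L [C [C0 HC]]].
split=> [s s0 s1|]; first by apply: (blin_comp (blin_scale k)); exact: L.
exists (`|k| * C); split; first exact: mulr_ge0.
by move=> s s0 s1 a f c H; rewrite -mulrA; apply: (bdZ hT); exact: HC.
Qed.

Lemma gbase_weaken d d' B : (d' <= d)%N -> gbase d B -> gbase d' B.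
Proof.
move=> dd [L [C [C0 HC]]]; split => //.
exists (C * 2 ^+ (d - d')); split; first by rewrite mulr_ge0 // exprn_ge0.
move=> s s0 s1 a f c H; rewrite -mulrA; apply: HC => //.
by rewrite -(subnKC dd) addnA addKn; apply: (bd_mono_iter hT) => //; exact: ltW.
Qed.

Lemma goodD i d B1 B2 : good i d B1 -> good i d B2 -> good i d (fun s f => B1 s f + B2 s f).
Proof.
elim: i B1 B2 => [|i IH] B1 B2 [b1 H1] [b2 H2]; split => //; try exact: gbaseD.
move: H1 H2 => [B1' [H1 G1]] [B2' [H2 G2]].
exists (fun j l s f => B1' j l s f + B2' j l s f); split.
  by move=> j l; exact: (IH _ _ (H1 j l) (H2 j l)).
move=> s s0 s1 f g1 g2 Hg1 Hg2 j; rewrite addrACA; apply: isgenD => //; [exact: G1|exact: G2].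
Qed.

(** The commuted families multiply like 2 by 2 matrices, and the orders add. *)
Lemma good_comp i d1 d2 B1 B2 : good i d1 B1 -> good i d2 B2 ->
  good i (d1 + d2) (fun s f => B1 s (B2 s f)).
Proof.
elim: i B1 B2 => [|i IH] B1 B2 [b1 H1] [b2 H2]; split => //; try exact: gbase_comp.
move: H1 H2 => [B1' [H1 G1]] [B2' [H2 G2]].
exists (fun j l s f => B1' j false s (B2' false l s f) + B1' j true s (B2' true l s f)); split.
  move=> j l; apply: goodD; [exact: (IH _ _ (H1 j false) (H2 false l))|].
  exact: (IH _ _ (H1 j true) (H2 true l)).
move=> s s0 s1 f g1 g2 Hg1 Hg2 j.
have := G1 s s0 s1 _ _ _ (G2 s s0 s1 f g1 g2 Hg1 Hg2 false) (G2 s s0 s1 f g1 g2 Hg1 Hg2 true) j.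
by rewrite !(blinD (good_blin (H1 _ _) s0 s1)) addrACA.
Qed.

Lemma goodZ i d k B : good i d B -> good i d (fun s f => k *: B s f).
Proof.
elim: i B => [|i IH] B [b H]; split => //; try exact: gbaseZ.
move: H => [B' [H G]]; exists (fun j l s f => k *: B' j l s f); split; first by move=> j l; exact: (IH _ (H j l)).
by move=> s s0 s1 f g1 g2 Hg1 Hg2 j; rewrite -scalerDr; apply: isgenZ => //; exact: G.
Qed.

Lemma good_weaken i d d' B : (d' <= d)%N -> good i d B -> good i d' B.
Proof.
move=> dd; elim: i B => [|i IH] B [b H]; split => //; try exact: gbase_weaken dd b.
by move: H => [B' [H G]]; exists B'; split => // j l; exact: (IH _ (H j l)).
Qed.

Lemma good_zero i d : good i d (fun _ _ => 0).
Proof.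
have b : gbase d (fun _ _ => 0).
  split=> [s _ _|].
    split=> [c x y|]; first by rewrite scaler0 addr0.
    by exists 0; split => // x; rewrite normr0 mul0r.
  by exists 0; split => // s _ _ a f c _; rewrite mul0r; exact: (bd0v hT).
elim: i => [|i IH]; split => //.
exists (fun _ _ _ _ => 0); split => // s s0 s1 f g1 g2 _ _ j.
by rewrite addr0; exact: isgen0.
Qed.

Lemma good_id i : good i 0 (fun _ f => f).
Proof.
have b : gbase 0 (fun _ f => f).
  split=> [s _ _|]; first exact: blin_id.
  by exists 1; split => // s _ _ a f c; rewrite addn0 mul1r.
elim: i => [|i IH]; split => //.
exists (fun j l s f => if j == l then f else 0); split.
  by case; case => //=; exact: good_zero.
by move=> s s0 s1 f g1 g2 H1 H2 [] /=; rewrite ?addr0 ?add0r.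
Qed.

Lemma good_ext i d B1 B2 : (forall s, 0 < s -> s <= 1 -> forall f, B1 s f = B2 s f) ->
  good i d B1 -> good i d B2.
Proof.
move=> H H1.
have b : gbase d B2.
  have [L [C [C0 HC]]] := good_base H1; split=> [s s0 s1|].
    by rewrite (_ : B2 s = B1 s); [exact: L|apply/funext => f; rewrite H].
  by exists C; split => // s s0 s1 a f c; rewrite -H //; exact: HC.
case: i H1 => [|i] [_ H1]; split => //.
by have [B' [G1 G2]] := H1; exists B'; split => // s s0 s1 f; rewrite -H //; exact: G2.
Qed.

(* Families depending on an additional parameter tau in [0, 1], to be averaged over tau *)
Definition pbase (d : nat) (V : R -> R -> E -> E) : Prop :=
  (forall s, 0 < s -> s <= 1 -> forall tau, 0 <= tau <= 1 -> blin (V tau s)) /\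
  (forall s, 0 < s -> s <= 1 -> forall f, contu (fun tau => V tau s f)) /\
  exists C : R, 0 <= C /\ forall s, 0 < s -> s <= 1 -> forall tau, 0 <= tau <= 1 -> forall a f c,
    bd (a + d) s f c -> bd a s (V tau s f) (C * c).

Fixpoint pgood (i d : nat) (V : R -> R -> E -> E) : Prop :=
  pbase d V /\ match i with
  | 0%N => True
  | i'.+1 => exists V' : bool -> bool -> R -> R -> E -> E, (forall j l, pgood i' d (V' j l)) /\
      forall s, 0 < s -> s <= 1 -> forall tau, 0 <= tau <= 1 ->
      forall f g1 g2, isgen false f g1 -> isgen true f g2 ->
      forall j, isgen j (V tau s f) (V' j false tau s g1 + V' j true tau s g2)
  end.

Definition avg (V : R -> R -> E -> E) (s : R) (f : E) : E := prim (fun tau => V tau s f) 1.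

Lemma pgood_base i d V : pgood i d V -> pbase d V.
Proof. by case: i => [|i] []. Qed.

Lemma pgood_at1 i d V : pgood i d V -> good i d (V 1).
Proof.
have i1 : 0 <= (1 : R) <= 1 by rewrite ler01 lexx.
have b W : pbase d W -> gbase d (W 1).
  move=> [L [_ [C [C0 HC]]]]; split=> [s s0 s1|]; first exact: L.
  by exists C; split => // s s0 s1 a f c; exact: HC.
elim: i V => [|i IH] V [/b bV H]; split => //.
move: H => [V' [H G]]; exists (fun j l => V' j l 1); split; first by move=> j l; exact: (IH _ (H j l)).
by move=> s s0 s1; exact: G.
Qed.

Lemma pbase_avg d V : pbase d V -> gbase d (avg V).
Proof.
move=> [L [K [C [C0 HC]]]]; split=> [s s0 s1|].
  split=> [c x y|].
    have cZ : contu (fun t => c *: V t s x) by apply: (contu_lin (blin_scale c)); exact: K.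
    rewrite /avg (prim_lin (blin_scale c)) //; last exact: K.
    rewrite -primD //; last exact: K.
    apply: prim_eq => //; [exact: K|by apply: contuD => //; exact: K|].
    by move=> t tt; have [-> _] := L s s0 s1 t tt.
  (* Boundedness on [E] is the bound at [a = 0], entered by raising [|x|] from order 0 to order [d]
     at the cost [2^d]. *)
  exists (C * 2 ^+ d); split; first by rewrite mulr_ge0 // exprn_ge0.
  move=> x; rewrite -[X in _ <= X]mulr1; apply: prim_norm => //; first exact: K.
  move=> t tt; apply/(bd0E T s); rewrite -mulrA; apply: HC => //.
  by apply: (bd_mono_iter hT) => //; [exact: ltW|exact/bd0E].
exists C; split => // s s0 s1 a f c Hf; apply: (bd_avg hT) => //; first exact: K.
by move=> t tt; exact: HC.
Qed.

(** A closed generator passes under the integral, so the commuted families of an average are the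
    averages of the commuted families. *)
Lemma pgood_avg i d V : pgood i d V -> good i d (avg V).
Proof.
elim: i V => [|i IH] V [b H]; split => //; try exact: pbase_avg.
move: H => [V' [H G]].
exists (fun j l => avg (V' j l)); split; first by move=> j l; exact: (IH _ (H j l)).
move=> s s0 s1 f g1 g2 Hg1 Hg2 j.
have K' l g : contu (fun t => V' j l t s g) by have [_ [K' _]] := pgood_base (H j l); exact: K'.
have K : contu (fun t => V t s f) by have [_ [K _]] := b; exact: K.
rewrite /avg -primD //; apply: isgen_prim_closed => //; first exact: contuD.
by move=> t tt; exact: G.
Qed.

Lemma pgood_zero i d : pgood i d (fun _ _ _ => 0).
Proof.
have b : pbase d (fun _ _ _ => 0).
  have [[L _]] := good_zero 0 d; split=> [s s0 s1 tau _|]; first exact: L.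
  split=> [s _ _ f|]; first exact: contu_cst.
  by exists 0; split => // s _ _ tau _ a f c _; rewrite mul0r; exact: (bd0v hT).
elim: i => [|i IH]; split => //.
exists (fun _ _ _ _ _ => 0); split => // s s0 s1 tau _ f g1 g2 _ _ j.
by rewrite addr0; exact: isgen0.
Qed.
End Operators.

(** * The averages [P_s] and their derivatives *)

Section Smoothing.
Context {R : realType} {E : completeNormedModType R}.
Variable T : R -> R -> E -> E.
Hypothesis hT : contractive_rep T.
Local Notation S := (Tj T).
Local Notation isgen := (isgen T).
Local Notation bd := (bd T).
Local Notation BD := (BD T).
Local Notation good := (good T).
Local Notation pgood := (pgood T).
Let Sb := S_blin hT.
Let Db := Dif_blin hT.

Lemma cont_eps (w : R -> R) : continuous w -> forall x, 0 <= x -> forall e : R, 0 < e ->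
  exists d : R, 0 < d /\ forall y, 0 <= y -> `|y - x| <= d -> `|w y - w x| <= e.
Proof.
move=> wc x _ e e0; have /cvgrPdist_le/(_ e e0) := wc x.
move=> /nbhs_ballP[d /= d0 Hd]; exists (d / 2); split; first lra.
by move=> y _ yd; rewrite distrC; apply: Hd; rewrite /ball /= distrC; lra.
Qed.

(** The exponential weight makes the family stable under commutation: [A_2] passes [wS1 n] by
    turning it into [wS1 n.+1], while [A_1] leaves it as it is. *)
Definition wS1 (n : nat) (tau s : R) (f : E) : E :=
  expR (- (n%:R * (s * tau))) *: S false (s * tau) f.
Definition wD1 (n : nat) (tau s : R) (f : E) : E := f - wS1 n tau s f.
(** The counterpart for [T_2]: [A_1] passing [wS2 k m] leaves [wS2 k m] in front of [A_1] and
    [wS2 k m.+1] in front of [A_2]. *)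
Definition wS2 (k : R) (m : nat) (tau s : R) (f : E) : E :=
  (k * (s * tau) ^+ m) *: S true (s * tau) f.
Definition wD2 (tau s : R) (f : E) : E := f - S true (s * tau) f.

Lemma wS1_contu n s f : 0 < s -> contu (fun tau => wS1 n tau s f).
Proof.
move=> s0; apply: (@contu_scale _ _ (fun t => expR (- (n%:R * t)) *: S false t f)) => //.
apply: contu_rscale; last exact: S_contu.
apply: cont_eps => x; apply: continuous_comp; last exact: continuous_expR.
by apply: cvgN; apply: cvgM; [exact: cvg_cst|exact: cvg_id].
Qed.

Lemma wS2_contu k m s f : 0 < s -> contu (fun tau => wS2 k m tau s f).
Proof.
move=> s0; apply: (@contu_scale _ _ (fun t => (k * t ^+ m) *: S true t f)) => //.
apply: contu_rscale; last exact: S_contu.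
apply: cont_eps => x; apply: cvgM; first exact: cvg_cst.
exact: exprn_continuous.
Qed.

Lemma scaled_param (s tau : R) : 0 < s -> s <= 1 -> 0 <= tau <= 1 -> 0 <= s * tau <= s.
Proof. by move=> s0 s1 /andP[t0 t1]; apply/andP; split; nra. Qed.

Lemma weight1 (n : nat) (t : R) : 0 <= t ->
  0 <= expR (- (n%:R * t)) <= 1 /\ 1 - expR (- (n%:R * t)) <= n%:R * t.
Proof.
move=> t0; have nt : 0 <= n%:R * t by apply: mulr_ge0.
have := expR_ge1Dx (- (n%:R * t)); have := expR_gt0 (- (n%:R * t)).
have : expR (- (n%:R * t)) <= 1 by rewrite -[leRHS]expR0 ler_expR oppr_le0.
by move=> *; split; [apply/andP; split|]; lra.
Qed.

Lemma pgood_wS1 i n : pgood i 0 (wS1 n).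
Proof.
have b m : pbase T 0 (wS1 m).
  split=> [s s0 s1 tau tt|].
    by apply: (blin_comp (blin_scale _)); exact: Sb.
  split=> [s s0 s1 f|]; first exact: wS1_contu.
  exists 100; split => // s s0 s1 tau tt a f c; rewrite addn0 => H.
  have st := scaled_param s0 s1 tt; have /andP[st0 _] := st.
  have [/andP[w0 w1] _] := weight1 m st0.
  have c0 := bd_ge0 H.
  apply: (bd_le (bdZ hT _ (bd_S hT false s0 s1 st H))).
  by rewrite ger0_norm //; nra.
elim: i n => [|i IH] n; split => //.
exists (fun j l => if j == l then (if j then wS1 n.+1 else wS1 n) else fun _ _ _ => 0); split.
  by case; case => //=; exact: pgood_zero.
move=> s s0 s1 tau tt f g1 g2 H1 H2 [] /=; rewrite ?add0r ?addr0.
  have -> : wS1 n.+1 tau s g2 =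
     expR (- (n%:R * (s * tau))) *: (expR (- (s * tau)) *: S false (s * tau) g2).
    rewrite /wS1 scalerA -expRD; congr (expR _ *: _).
    by rewrite -natr1; ring.
  by apply: (isgenZ hT); exact: isgen_S12.
by apply: (isgenZ hT); exact: isgen_S.
Qed.

(** [I - e^{-n t} T_1(t)] is a difference plus [(1 - e^{-n t}) T_1(t)]. The scalar is at most [n s],
    and by [bdS] a factor [s] is as good as an order; hence [400 m] next to the 101 of [bd_Dif]. *)
Lemma pgood_wD1 i n : pgood i 1 (wD1 n).
Proof.
have b m : pbase T 1 (wD1 m).
  have [L [K _]] := pgood_base (pgood_wS1 0 m).
  split=> [s s0 s1 tau tt|].
    have -> : wD1 m tau s = (fun f => f + (-1) *: wS1 m tau s f).
      by apply/funext => f; rewrite scaleN1r.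
    by apply: blin_add; [exact: blin_id|apply: (blin_comp (blin_scale _)); exact: L].
  split=> [s s0 s1 f|].
    have -> : (fun tau => wD1 m tau s f) = (fun tau => f + (-1) *: wS1 m tau s f).
      by apply/funext => tau; rewrite scaleN1r.
    apply: contuD; first exact: contu_cst.
    by apply: (contu_lin (blin_scale _)); exact: K.
  exists (101 + 400 * m%:R); split; first by have := ler0n R m; lra.
  move=> s s0 s1 tau tt a f c; rewrite addn1 => H.
  have st := scaled_param s0 s1 tt; have /andP[st0 sts] := st.
  have [/andP[w0 w1] w2] := weight1 m st0.
  have c0 := bd_ge0 H.
  have -> : wD1 m tau s f = (-1) *: Dif T false (s * tau) f +
     (1 - expR (- (m%:R * (s * tau)))) *: S false (s * tau) f.
    by rewrite /wD1 /wS1 /Dif; set z := S _ _ _; lmod R.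
  rewrite mulrDl; apply: (bdD hT).
    by apply: (bd_le (bdZ hT _ (bd_Dif hT false s0 s1 st H))); rewrite normrN1 mul1r.
  apply: (bd_le (bdZ hT _ (bd_S hT false s0 s1 st (bdS hT s0 s1 H)))).
  rewrite ger0_norm; last lra.
  have -> : 100 * (4 * c / s) = 400 * c / s by ring.
  have m0 := ler0n R m.
  apply: (@le_trans _ _ (m%:R * s * (400 * c / s))).
    apply: ler_wpM2r; first by apply: divr_ge0; [exact: mulr_ge0 (ler0n R 400) c0|exact: ltW].
    by apply: le_trans w2 _; rewrite ler_wpM2l.
  rewrite (_ : m%:R * s * (400 * c / s) = 400 * m%:R * c) //; field; exact: lt0r_neq0.
elim: i n => [|i IH] n; split => //.
exists (fun j l => if j == l then (if j then wD1 n.+1 else wD1 n) else fun _ _ _ => 0); split.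
  by case; case => //=; exact: pgood_zero.
have [_ [V' [_ HV]]] := pgood_wS1 1 n.
move=> s s0 s1 tau tt f g1 g2 H1 H2 [] /=; rewrite ?add0r ?addr0; apply: (isgenB hT) => //.
  have -> : wS1 n.+1 tau s g2 =
     expR (- (n%:R * (s * tau))) *: (expR (- (s * tau)) *: S false (s * tau) g2).
    rewrite /wS1 scalerA -expRD; congr (expR _ *: _).
    by rewrite -natr1; ring.
  by apply: (isgenZ hT); exact: isgen_S12.
by apply: (isgenZ hT); exact: isgen_S.
Qed.

Lemma isgen_wS2 k m s tau f g1 g2 : 0 < s -> s <= 1 -> 0 <= tau <= 1 ->
  isgen false f g1 -> isgen true f g2 ->
  isgen false (wS2 k m tau s f) (wS2 k m tau s g1 + wS2 k m.+1 tau s g2).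
Proof.
move=> s0 s1 tt H1 H2; have /andP[st0 _] := scaled_param s0 s1 tt.
have := isgenZ hT (k * (s * tau) ^+ m) (isgen_S21 hT st0 H1 H2).
by rewrite scalerDr scalerA -mulrA -exprSr.
Qed.

(** The weight [(s tau)^m] pays for [d <= m] orders at the rate [4 / s] each, and commutation only
    raises [m]. *)
Lemma pgood_wS2 i d k m : (d <= m)%N -> pgood i d (wS2 k m).
Proof.
have b p : (d <= p)%N -> pbase T d (wS2 k p).
  move=> dp; split=> [s s0 s1 tau tt|].
    by apply: (blin_comp (blin_scale _)); exact: Sb.
  split=> [s s0 s1 f|]; first exact: wS2_contu.
  exists (`|k| * (100 * 4 ^+ d)); split; first by rewrite !mulr_ge0 // exprn_ge0.
  move=> s s0 s1 tau tt a f c H.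
  have st := scaled_param s0 s1 tt; have /andP[st0 sts] := st.
  have c0 := bd_ge0 H.
  apply: (bd_le (bdZ hT _ (bd_S hT true s0 s1 st (bdS_iter hT s0 s1 H)))).
  have sd : 0 < s ^+ d by apply: exprn_gt0.
  have F0 : (0 : R) <= 4 ^+ d by rewrite exprn_ge0.
  rewrite normrM (ger0_norm (exprn_ge0 p st0)).
  have X0 : 0 <= 100 * (4 ^+ d * c / s ^+ d).
    by rewrite !mulr_ge0 // invr_ge0 ltW.
  have W : (s * tau) ^+ p <= s ^+ d.
    apply: (@le_trans _ _ (s ^+ p)); first by rewrite lerXn2r // nnegrE // ltW.
    by apply: ler_wiXn2l => //; exact: ltW.
  apply: (@le_trans _ _ (`|k| * s ^+ d * (100 * (4 ^+ d * c / s ^+ d)))).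
    by rewrite ler_wpM2r // ler_wpM2l.
  move: (s ^+ d) (4 ^+ d) sd => x y x0.
  rewrite (_ : `|k| * x * (100 * (y * c / x)) = `|k| * (100 * y) * c) //.
  by field; exact: lt0r_neq0.
elim: i m => [|i IH] m dm; split; try exact: b; try by [].
exists (fun j l => if j == l then wS2 k m else (if j then fun _ _ _ => 0 else wS2 k m.+1)); split.
  case; case => /=; [exact: IH|exact: pgood_zero|apply: IH; exact: leqW|exact: IH].
move=> s s0 s1 tau tt f g1 g2 H1 H2 [] /=; rewrite ?add0r.
  by apply: (isgenZ hT); exact: isgen_S.
exact: isgen_wS2.
Qed.

Lemma wS2_10 tau s f : wS2 1 0 tau s f = S true (s * tau) f.
Proof. by rewrite /wS2 expr0 mulr1 scale1r. Qed.

(** The identity commutes with [A_1] but [T_2] does not; the remainder [wS2 (-1) 1] carries a factor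
    [s] and so has order 1 as well. *)
Lemma pgood_wD2 i : pgood i 1 wD2.
Proof.
have b : pbase T 1 wD2.
  split=> [s s0 s1 tau tt|].
    have -> : wD2 tau s = (fun f => f + (-1) *: S true (s * tau) f).
      by apply/funext => f; rewrite scaleN1r.
    by apply: blin_add; [exact: blin_id|apply: (blin_comp (blin_scale _)); exact: Sb].
  split=> [s s0 s1 f|].
    have -> : (fun tau => wD2 tau s f) = (fun tau => f + wS2 (-1) 0 tau s f).
      by apply/funext => tau; rewrite /wS2 expr0 mulr1 scaleN1r.
    by apply: contuD; [exact: contu_cst|exact: wS2_contu].
  exists 101; split => // s s0 s1 tau tt a f c; rewrite addn1 => H.
  have st := scaled_param s0 s1 tt.
  have -> : wD2 tau s f = (-1) *: Dif T true (s * tau) f by rewrite /wD2 /Dif; set z := S _ _ _; lmod R.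
  by apply: (bd_le (bdZ hT _ (bd_Dif hT true s0 s1 st H))); rewrite normrN1 mul1r.
elim: i => [|i IH]; split => //.
exists (fun j l => if j == l then wD2 else (if j then fun _ _ _ => 0 else wS2 (-1) 1)); split.
  by case; case => //=; [exact: pgood_zero|exact: pgood_wS2].
move=> s s0 s1 tau tt f g1 g2 H1 H2 [] /=; rewrite ?add0r.
  by apply: (isgenB hT) => //; exact: isgen_S.
have -> : wD2 tau s g1 + wS2 (-1) 1 tau s g2 = g1 - (wS2 1 0 tau s g1 + wS2 1 1 tau s g2).
  by rewrite /wD2 /wS2; lmod R.
by apply: (isgenB hT) => //; rewrite -wS2_10; exact: isgen_wS2.
Qed.

Definition avgS1 n := avg (wS1 n).
Definition avgS2 := avg (wS2 1 0).
Definition Pav (s : R) (f : E) : E := avgS1 0 s (avgS2 s f).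
(** This is [s A_j P_s]: a generator turns the average along its own subgroup into an endpoint
    difference. [A_1] meets the outer average at once; [A_2] first passes it, which moves the weight
    from [n = 0] to [n = 1]. *)
Definition eP (j : bool) (s : R) (f : E) : E :=
  if j then avgS1 1 s (- wD2 1 s f) else - wD1 0 1 s (avgS2 s f).

Lemma good_avgS1 i n : good i 0 (avgS1 n).
Proof. exact: (pgood_avg hT (pgood_wS1 i n)). Qed.
Lemma good_avgS2 i : good i 0 avgS2.
Proof. exact: (pgood_avg hT (pgood_wS2 i 1 (leqnn 0))). Qed.
Lemma good_Pav i : good i 0 Pav.
Proof. exact: (good_comp hT (good_avgS1 i 0) (good_avgS2 i)). Qed.

Lemma good_opp i d B : good i d B -> good i d (fun s f => - B s f).
Proof.
move=> H; apply: (good_ext (B1 := fun s f => (-1) *: B s f)); last exact: goodZ.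
by move=> s _ _ f; rewrite scaleN1r.
Qed.

Lemma good_eP i j : good i 1 (eP j).
Proof.
case: j.
  exact: (good_comp hT (good_avgS1 i 1) (good_opp (pgood_at1 (pgood_wD2 i)))).
exact: (good_comp hT (good_opp (pgood_at1 (pgood_wD1 i 0))) (good_avgS2 i)).
Qed.

(** [I - P = (I - avgS1 0) + avgS1 0 (I - avgS2)], and both deficits are averages of differences. *)
Lemma good_IP i : good i 1 (fun s f => f - Pav s f).
Proof.
have H1 : good i 1 (avg (wD1 0)) by apply: pgood_avg => //; exact: pgood_wD1.
have H2 : good i 1 (avg wD2) by apply: pgood_avg => //; exact: pgood_wD2.
have H3 := goodD hT H1 (good_comp hT (good_avgS1 i 0) H2).
apply: good_ext H3 => s s0 s1 f.
have a1 g : avg (wD1 0) s g = g - avgS1 0 s g.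
  have c1 := wS1_contu 0 g s0.
  rewrite /avgS1 /avg -scaleN1r (prim_lin (blin_scale _)) // -[X in X + _]scale1r -prim_cst //.
  rewrite -primD //; [|exact: contu_cst|exact: contu_lin (blin_scale _) c1].
  apply: prim_eq => //.
  - by have [_ [K _]] := pgood_base (pgood_wD1 0 0); apply: K.
  - by apply: contuD; [exact: contu_cst|exact: contu_lin (blin_scale _) c1].
  - by move=> t _; rewrite /wD1 scaleN1r.
have a2 g : avg wD2 s g = g - avgS2 s g.
  have c1 := wS2_contu 1 0 g s0.
  rewrite /avgS2 /avg -scaleN1r (prim_lin (blin_scale _)) // -[X in X + _]scale1r -prim_cst //.
  rewrite -primD //; [|exact: contu_cst|exact: contu_lin (blin_scale _) c1].
  apply: prim_eq => //.
  - by have [_ [K _]] := pgood_base (pgood_wD2 0); apply: K.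
  - by apply: contuD; [exact: contu_cst|exact: contu_lin (blin_scale _) c1].
  - by move=> t _; rewrite wS2_10 scaleN1r.
rewrite a1 a2 (blinB (good_blin (good_avgS1 0 0) s0 s1)) /Pav.
by lmod R.
Qed.

Lemma avgS1_0 s f : 0 < s -> avgS1 0 s f = s^-1 *: prim (S false ^~ f) s.
Proof.
move=> s0; rewrite -[X in prim _ X]mulr1 -(prim_scale s0) //; last exact: S_contu.
apply: prim_eq => //; [exact: wS1_contu|exact: contu_scale s0 (S_contu hT false f)|].
by move=> t _; rewrite /wS1 mul0r oppr0 expR0 scale1r.
Qed.

Lemma avgS2_0 s f : 0 < s -> avgS2 s f = s^-1 *: prim (S true ^~ f) s.
Proof.
move=> s0; rewrite -[X in prim _ X]mulr1 -(prim_scale s0) //; last exact: S_contu.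
apply: prim_eq => //; [exact: wS2_contu|exact: contu_scale s0 (S_contu hT true f)|].
by move=> t _; rewrite wS2_10.
Qed.

Lemma avgS1_1 s f g : 0 < s -> s <= 1 -> isgen true f g -> isgen true (avgS1 0 s f) (avgS1 1 s g).
Proof.
move=> s0 s1 H; apply: isgen_prim_closed => //; [exact: wS1_contu|exact: wS1_contu|].
move=> t tt; have /andP[st0 _] := scaled_param s0 s1 tt.
have -> : wS1 0 t s f = S false (s * t) f by rewrite /wS1 mul0r oppr0 expR0 scale1r.
by rewrite /wS1 mul1r; exact: isgen_S12.
Qed.

Lemma isgen_Pav j s f : 0 < s -> s <= 1 -> isgen j (Pav s f) (s^-1 *: eP j s f).
Proof.
move=> s0 s1; case: j.
  rewrite /eP -(blinZ (good_blin (good_avgS1 0 1) s0 s1)); apply: avgS1_1 => //.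
  rewrite avgS2_0 //; apply: (isgenZ hT).
  by rewrite /wD2 mulr1 opprB; apply: isgen_smooth => //; exact: ltW.
rewrite /Pav avgS1_0 //; apply: (isgenZ hT).
rewrite /eP /wD1 /wS1 mul0r oppr0 expR0 scale1r mulr1 opprB.
by apply: isgen_smooth => //; exact: ltW.
Qed.
End Smoothing.

(** * Jackson and Bernstein estimates *)

Section Approximation.
Context {R : realType} {E : completeNormedModType R}.
Variable T : R -> R -> E -> E.
Hypothesis hT : contractive_rep T.
Local Notation S := (Tj T).
Local Notation isgen := (isgen T).
Local Notation bd := (bd T).
Local Notation BD := (BD T).
Local Notation good := (good T).
Local Notation P := (Pav T).
Let Sb := S_blin hT.
Let Db := Dif_blin hT.

Lemma BD0_ind i s f c : BD 0 i s f c -> `|f| <= c.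
Proof. by move=> /BD_bd/bd0E. Qed.

Lemma BD0_s i s s' f c : BD 0 i s f c -> BD 0 i s' f c.
Proof.
elim: i f => [|i IH] f [H1 H2]; split=> //.
by move=> j; have [g [Hg /IH H]] := H2 j; exists g.
Qed.

Lemma good_BD0 i B : good i 0 B -> exists C : R, 0 <= C /\ forall s, 0 < s -> s <= 1 ->
  forall f c, BD 0 i s f c -> BD 0 i s (B s f) (C * c).
Proof. by move=> /(good_BD hT)[C [C0 H]]; exists C; split => // s s0 s1 f c; exact: (H s s0 s1 0%N). Qed.

(** [A_j P_s] is [s^-1] times the [good] family [eP j], so each derivative gained costs [1 / s]. *)
Lemma smooth1 i : exists C : R, 0 <= C /\ forall s, 0 < s -> s <= 1 -> forall f c,
  BD 0 i s f c -> BD 0 i.+1 s (P s f) (C * (c / s)).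
Proof.
have [C [C0 HC]] := good_BD0 (good_Pav hT 0).
have [C1 [C10 HC1]] := good_BD0 (good_weaken hT (leq0n 1) (good_eP hT i false)).
have [C2 [C20 HC2]] := good_BD0 (good_weaken hT (leq0n 1) (good_eP hT i true)).
exists (C + C1 + C2); split; first lra.
move=> s s0 s1 f c H; have c0 := bd_ge0 (BD_bd H).
have cs : c <= c / s by rewrite ler_pdivlMr //; nra.
have s' : `|s^-1| = s^-1 by rewrite gtr0_norm // invr_gt0.
split.
  have [H1 _] := HC s s0 s1 f c (BD_sub (leq0n i) H).
  by apply: (bd_le H1); nra.
move=> j; exists (s^-1 *: eP T j s f); split; first exact: isgen_Pav.
case: j.
  by apply: BD_le (BDZ hT s^-1 (HC2 s s0 s1 f c H)) _; rewrite s' mulrCA [s^-1 * c]mulrC; nra.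
by apply: BD_le (BDZ hT s^-1 (HC1 s s0 s1 f c H)) _; rewrite s' mulrCA [s^-1 * c]mulrC; nra.
Qed.

(** Two derivatives fall on two factors [P_s]: the outer one is replaced by [s^-1 eP j], and the
    second generator, moved past [eP j], replaces the inner one. Both replacements have order 1,
    together order 2, which is what [BD 2] feeds; so only the modulus, and not the norm, is charged
    with [s^-2]. *)
Lemma smooth2 i B : (forall i', good i' 0 B) -> exists C : R, 0 <= C /\ forall s, 0 < s -> s <= 1 ->
  forall f c, BD 2 i s f c -> BD 0 i.+2 s (P s (P s (B s f))) (C * (c / s ^+ 2)).
Proof.
move=> gB.
have g0 : good 0 0 (fun s f => P s (P s (B s f))).
  exact: (good_comp hT (good_Pav hT 0) (good_comp hT (good_Pav hT 0) (gB 0%N))).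
have [C [C0 HC]] := good_BD0 g0.
have g1 j : good 0 1 (fun s f => eP T j s (P s (B s f))).
  exact: (good_comp hT (good_eP hT 0 j) (good_comp hT (good_Pav hT 0) (gB 0%N))).
have [e' He'] : exists e' : bool -> bool -> bool -> R -> E -> E,
   forall j, (forall m l, good i 1 (e' j m l)) /\
   forall s, 0 < s -> s <= 1 -> forall f h1 h2, isgen false f h1 -> isgen true f h2 ->
   forall m, isgen m (eP T j s f) (e' j m false s h1 + e' j m true s h2).
  have [_ [a Ha]] := good_eP hT i.+1 false; have [_ [b Hb]] := good_eP hT i.+1 true.
  by exists (fun j => if j then b else a); case.
have g2 j m : good i 2 (fun s f => e' j m false s (eP T false s (B s f)) + e' j m true s (eP T true s (B s f))).
  have [H _] := He' j; apply: goodD => //.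
    exact: (good_comp hT (H m false) (good_comp hT (good_eP hT i false) (gB i))).
  exact: (good_comp hT (H m true) (good_comp hT (good_eP hT i true) (gB i))).
have [C1 [C10 HC1]] : exists C : R, 0 <= C /\ forall j s, 0 < s -> s <= 1 -> forall f c,
    bd 1 s f c -> bd 0 s (eP T j s (P s (B s f))) (C * c).
  have [_ [a [a0 Ha]]] := good_base (g1 false); have [_ [b [b0 Hb]]] := good_base (g1 true).
  exists (a + b); split; first lra.
  move=> j s s0 s1 f c H; have c0 := bd_ge0 H; case: j.
    by apply: (bd_le (Hb s s0 s1 0%N f c H)); nra.
  by apply: (bd_le (Ha s s0 s1 0%N f c H)); nra.
have [C2 [C20 HC2]] : exists C : R, 0 <= C /\ forall j m s, 0 < s -> s <= 1 -> forall f c,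
    BD 2 i s f c -> BD 0 i s (e' j m false s (eP T false s (B s f)) + e' j m true s (eP T true s (B s f))) (C * c).
  have [a1 [a10 A1]] := good_BD hT (g2 false false).
  have [a2 [a20 A2]] := good_BD hT (g2 false true).
  have [a3 [a30 A3]] := good_BD hT (g2 true false).
  have [a4 [a40 A4]] := good_BD hT (g2 true true).
  exists (a1 + a2 + a3 + a4); split; first lra.
  move=> j m s s0 s1 f c H; have c0 := bd_ge0 (BD_bd H).
  case: j; case: m; [move: (A4 s s0 s1 0%N f c H)|move: (A3 s s0 s1 0%N f c H)|
    move: (A2 s s0 s1 0%N f c H)|move: (A1 s s0 s1 0%N f c H)] => /BD_le; apply;
    rewrite ler_wpM2r //; lra.
(* 16 and 4 stem from lowering the order of the hypothesis by two and by one with [bdS]. *)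
exists (16 * C + 4 * C1 + C2); split; first lra.
move=> s s0 s1 f c H; have c0 := bd_ge0 (BD_bd H).
have cs : 0 <= c / s ^+ 2 by rewrite divr_ge0 // exprn_ge0 // ltW.
have s' : `|s^-1| = s^-1 by rewrite gtr0_norm // invr_gt0.
have b1 := bdS hT s0 s1 (BD_bd H).
have b0 := bdS hT s0 s1 b1.
have E1 : 4 * (4 * c / s) / s = 16 * (c / s ^+ 2) by field; exact: lt0r_neq0.
split.
  have [H1 _] := HC s s0 s1 f _ (conj b0 I).
  by apply: (bd_le H1); rewrite E1; nra.
move=> j; exists (s^-1 *: eP T j s (P s (B s f))); split; first exact: isgen_Pav.
split.
  apply: (bd_le (bdZ hT s^-1 (HC1 j s s0 s1 f _ b1))); rewrite s'.
  rewrite (_ : s^-1 * (C1 * (4 * c / s)) = 4 * C1 * (c / s ^+ 2)); first nra.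
  by field; exact: lt0r_neq0.
move=> m; exists (s^-1 *: (e' j m false s (s^-1 *: eP T false s (B s f)) +
    e' j m true s (s^-1 *: eP T true s (B s f)))); split.
  apply: (isgenZ hT); have [_ H2] := He' j.
  by apply: H2 => //; exact: isgen_Pav.
have [ge _] := He' j.
rewrite (blinZ (good_blin (ge m false) s0 s1)) (blinZ (good_blin (ge m true) s0 s1)) -scalerDr.
apply: BD_le (BDZ hT s^-1 (BDZ hT s^-1 (HC2 j m s s0 s1 f c H))) _.
rewrite s' (_ : s^-1 * (s^-1 * (C2 * c)) = C2 * (c / s ^+ 2)); first nra.
by field; exact: lt0r_neq0.
Qed.

Lemma bd_up s f c : 0 < s -> `|f| <= c -> (forall j, exists g, isgen j f g /\ `|g| <= c) ->
  bd 1 s f (s * c).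
Proof.
move=> s0 H1 H2; apply/bd1E; first exact: ltW.
split; first by rewrite ler_wpM2l // ltW.
move=> j t /andP[t0 ts]; have [g [Hg G]] := H2 j.
rewrite /Dif (isgen_prim hT Hg t0).
apply: (@le_trans _ _ (c * t)); last by (have := le_trans (normr_ge0 g) G; nra).
apply: prim_norm => //; first exact: S_contu.
by move=> u _; apply: le_trans (S_norm hT _ _ _) G.
Qed.

Lemma BD_up i s f c : 0 < s -> BD 0 i.+1 s f c -> BD 1 i s f (s * c).
Proof.
move=> s0; have b i' h : BD 0 i'.+1 s h c -> bd 1 s h (s * c).
  move=> [/bd0E H1 H2]; apply: bd_up => // j.
  by have [g [Hg /BD0_ind G]] := H2 j; exists g.
elim: i f => [|i IH] f H; split=> //; try exact: b H.
by have [_ H2] := H => j; have [g [Hg G]] := H2 j; exists g; split => //; exact: IH.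
Qed.

(** [Dif b u f] is an integral of translates of [A_b f] over a length [u <= s], and the other
    difference falls on [A_b f]. Marchaud's [4 c / s] and the 100 of [bd_S] give 400. Thus moduli of
    top order derivatives control the lower ones. *)
Lemma bd2_low s f g1 g2 c : 0 < s -> s <= 1 -> isgen false f g1 -> isgen true f g2 ->
  bd 2 s g1 c -> bd 2 s g2 c -> s ^+ 2 * `|f| <= c -> bd 2 s f (400 * c).
Proof.
move=> s0 s1 H1 H2 B1 B2 sf; have c0 := bd_ge0 B1.
apply/bd2E; split; first lra.
move=> a b t u tt /andP[u0 us].
have [g [Hg Bg]] : exists g, isgen b f g /\ bd 2 s g c.
  by case: b; [exists g2|exists g1].
rewrite [Dif T b u f]/Dif (isgen_prim hT Hg u0).
apply: (@le_trans _ _ (100 * (4 * c / s) * u)).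
  apply: (prim_bound (L := Dif T a t)) => //; [exact: S_contu|move=> x /andP[x0 xu]].
  have /(bd1E _ _ _ (ltW s0)) [_ H] := bd_S hT b s0 s1 (ltac:(lra) : 0 <= x <= s) (bd2_bd1 hT s0 s1 Bg).
  exact: H.
apply: (@le_trans _ _ (100 * (4 * c / s) * s)).
  by rewrite ler_wpM2l // !mulr_ge0 // invr_ge0 ltW.
by rewrite (_ : 100 * (4 * c / s) * s = 400 * c) //; field; exact: lt0r_neq0.
Qed.

(* [ZD i s f c]: the second order moduli of the derivatives of top order [i] only *)
Fixpoint ZD (i : nat) (s : R) (f : E) (c : R) : Prop :=
  match i with
  | 0%N => bd 2 s f c
  | i'.+1 => s ^+ 2 * `|f| <= c /\ forall j, exists g, isgen j f g /\ ZD i' s g c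
  end.

Lemma ZD_BD i s f c : 0 < s -> s <= 1 -> ZD i s f c -> BD 2 i s f (400 ^+ i * c).
Proof.
move=> s0 s1; elim: i f => [|i IH] f /=; first by rewrite mul1r.
move=> [H1 H2].
have [g1 [G1 /IH Z1]] := H2 false; have [g2 [G2 /IH Z2]] := H2 true.
have c0 : 0 <= c by apply: le_trans H1; apply: mulr_ge0 => //; apply: exprn_ge0; exact: ltW.
have e1 : (1 : R) <= 400 ^+ i by apply: exprn_ege1; lra.
split.
  rewrite exprS -mulrA; apply: (bd2_low s0 s1 G1 G2 (BD_bd Z1) (BD_bd Z2)); nra.
have E1 : 400 ^+ i * c <= 400 ^+ i.+1 * c by rewrite exprS; nra.
by case; [exists g2|exists g1]; split => //; apply: BD_le E1.
Qed.

(** * Iterated averages: approximation and interpolation *)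

Section Iterates.
Variable N : nat.

Definition Pow n (s : R) (f : E) : E := iter n (P s) f.
Definition PowN := Pow N.
(** [(I - P_s^N)^p]. By the finite geometric series its complement factors through [P_s^N], so
    approximation order and smoothness can be chosen independently. *)
Definition defect p (s : R) (f : E) : E := iter p (fun g => g - PowN s g) f.
Fixpoint geomsum p (s : R) (f : E) : E :=
  match p with 0%N => 0 | p'.+1 => geomsum p' s f + defect p' s f end.

Lemma good_Pow i n : good i 0 (Pow n).
Proof.
elim: n => [|n IH]; first exact: good_id.
exact: (good_comp hT (good_Pav hT i) IH).
Qed.

Lemma good_IPow i n : good i 1 (fun s f => f - Pow n s f).
Proof.
elim: n => [|n IH].
  apply: (good_ext (B1 := fun _ _ => 0)); last exact: good_zero.
  by move=> s _ _ f; rewrite subrr.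
have H := goodD hT (good_IP hT i) (good_comp hT (good_Pav hT i) IH).
apply: good_ext H => s s0 s1 f.
by rewrite (blinB (good_blin (good_Pav hT 0) s0 s1)) /=; lmod R.
Qed.

Lemma good_defect i p : good i p (defect p).
Proof.
elim: p => [|p IH]; first exact: good_id.
by have := good_comp hT (good_IPow i N) IH; rewrite add1n.
Qed.

Lemma good_geomsum i p : good i 0 (geomsum p).
Proof.
elim: p => [|p IH]; first exact: good_zero.
exact: (goodD hT IH (good_weaken hT (leq0n p) (good_defect i p))).
Qed.

Lemma sub_defect p s f : 0 < s -> s <= 1 -> f - defect p s f = PowN s (geomsum p s f).
Proof.
move=> s0 s1; have b := good_blin (good_Pow 0 N) s0 s1.
elim: p => [|p IH]; first by rewrite /= subrr /PowN (blin0 b).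
have -> : defect p.+1 s f = defect p s f - PowN s (defect p s f) by [].
have -> : PowN s (geomsum p.+1 s f) = PowN s (geomsum p s f) + PowN s (defect p s f) by rewrite /PowN /= (blinD b).
by rewrite -IH; lmod R.
Qed.

(** Each factor [I - P_s^N] turns one spare derivative into a factor [s]: [BD_up] converts the
    derivative into first order smoothness, which [good_IPow] consumes. *)
Lemma defect_order i p : exists C : R, 0 <= C /\ forall s, 0 < s -> s <= 1 -> forall f c,
  BD 0 (i + p) s f c -> BD 0 i s (defect p s f) (C * (s ^+ p * c)).
Proof.
elim: p i => [|p IH] i.
  by exists 1; split => // s s0 s1 f c; rewrite addn0 expr0 !mul1r.
have [C [C0 HC]] := IH i.+1.
have [D [D0 HD]] := good_BD hT (good_IPow i N).
exists (D * C); split; first exact: mulr_ge0.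
move=> s s0 s1 f c; rewrite addnS -addSn => /(HC s s0 s1)/(BD_up s0) H.
have := HD s s0 s1 0%N _ _ H.
rewrite (_ : D * C * (s ^+ p.+1 * c) = D * (s * (C * (s ^+ p * c)))) //.
by rewrite exprS; ring.
Qed.

Lemma Pow_gain m l : exists C : R, 0 <= C /\ forall s, 0 < s -> s <= 1 -> forall f c,
  BD 0 m s f c -> BD 0 (m + l) s (Pow l s f) (C * (c / s ^+ l)).
Proof.
elim: l => [|l [C [C0 HC]]].
  by exists 1; split => // s s0 s1 f c; rewrite addn0 expr0 mul1r divr1.
have [D [D0 HD]] := smooth1 (m + l).
exists (D * C); split; first exact: mulr_ge0.
move=> s s0 s1 f c /(HC s s0 s1)/(HD s s0 s1); rewrite addnS /=.
rewrite (_ : D * C * (c / s ^+ l.+1) = D * (C * (c / s ^+ l) / s)) // exprS.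
have := expf_neq0 l (lt0r_neq0 s0); have := lt0r_neq0 s0.
by move: (s ^+ l) => x s0' x0; field; rewrite s0' x0.
Qed.

Lemma PowN_geomsum_gain m l p : (l <= N)%N -> exists C : R, 0 <= C /\ forall s, 0 < s -> s <= 1 -> forall f c,
  BD 0 m s f c -> BD 0 (m + l) s (PowN s (geomsum p s f)) (C * (c / s ^+ l)).
Proof.
move=> lN; have [C [C0 HC]] := Pow_gain m l.
have [D [D0 HD]] := good_BD0 (good_comp hT (good_Pow m (N - l)) (good_geomsum m p)).
exists (C * D); split; first exact: mulr_ge0.
move=> s s0 s1 f c /(HD s s0 s1)/(HC s s0 s1).
by rewrite /PowN /Pow -iterD subnKC // -!mulrA.
Qed.

Lemma PowN_gain2 i : (2 <= N)%N -> exists C : R, 0 <= C /\ forall s, 0 < s -> s <= 1 -> forall f c,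
  BD 2 i s f c -> BD 0 i.+2 s (PowN s (geomsum 2 s f)) (C * (c / s ^+ 2)).
Proof.
move=> N2.
have gB i' : good i' 0 (fun s f => Pow (N - 2) s (geomsum 2 s f)).
  exact: (good_comp hT (good_Pow i' (N - 2)) (good_geomsum i' 2)).
have [C [C0 HC]] := smooth2 i gB; exists C; split => // s s0 s1 f c /(HC s s0 s1).
by rewrite /PowN -[in Pow N](subnKC N2).
Qed.

(** The approximant is [(I - (I - P_s^N)^m) f]; the error is [defect m], and [N - m] of the factors
    [P_s] supply the missing derivatives. *)
Lemma jackson m : (m <= N)%N -> exists C : R, 0 <= C /\ forall s, 0 < s -> s <= 1 -> forall f c,
  BD 0 m s f c -> exists f1, `|f - f1| <= C * (s ^+ m * c) /\
                             BD 0 N s f1 (C * (s ^+ m * c / s ^+ N)).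
Proof.
move=> mN.
have [C [C0 HC]] := defect_order 0 m.
have [D [D0 HD]] := @PowN_geomsum_gain m (N - m) m (leq_subr _ _).
exists (C + D); split; first lra.
move=> s s0 s1 f c H; have c0 := bd_ge0 (BD_bd H).
have sm : 0 < s ^+ m by rewrite exprn_gt0.
exists (PowN s (geomsum m s f)); split.
  rewrite -sub_defect // opprB addrC subrK.
  apply: le_trans (BD0_ind (HC s s0 s1 f c H)) _.
  by rewrite ler_wpM2r ?mulr_ge0 ?(ltW sm) //; lra.
have := HD s s0 s1 f c H; rewrite subnKC // => /BD_le; apply.
have -> : s ^+ m * c / s ^+ N = c / s ^+ (N - m).
  rewrite -[in s ^+ N](subnKC mN) exprD.
  have := expf_neq0 (N - m) (lt0r_neq0 s0); have := lt0r_neq0 sm.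
  by move: (s ^+ (N - m)) (s ^+ m) => x y x0 y0; field; rewrite x0 y0.
rewrite ler_wpM2r; [by []| |lra].
by rewrite divr_ge0 // exprn_ge0 // ltW.
Qed.

(** The same splitting for an element already in [E^N]: its smooth part is estimated through [|u|]
    alone, its defect through the [E^N] norm. *)
Lemma interpolation m : (m <= N)%N -> exists C : R, 0 <= C /\ forall s, 0 < s -> s <= 1 ->
  forall u c0 c1, `|u| <= c0 -> BD 0 N s u c1 ->
    BD 0 m s u (C * (c0 / s ^+ m + s ^+ (N - m) * c1)).
Proof.
move=> mN.
have [C [C0 HC]] := defect_order m (N - m).
have [D [D0 HD]] := @PowN_geomsum_gain 0 m (N - m) mN.
exists (C + D); split; first lra.
move=> s s0 s1 u c0 c1 H0 H1.
have c0p : 0 <= c0 by apply: le_trans H0.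
have c1p := bd_ge0 (BD_bd H1).
rewrite -[u](subrK (defect (N - m) s u)) sub_defect //.
have A : BD 0 m s (PowN s (geomsum (N - m) s u)) (D * (c0 / s ^+ m)).
  by apply: HD => //; split => //; apply/bd0E.
have B : BD 0 m s (defect (N - m) s u) (C * (s ^+ (N - m) * c1)).
  by apply: HC => //; rewrite subnKC.
apply: BD_le (BDD hT A B) _.
have p1 : 0 <= c0 / s ^+ m by rewrite divr_ge0 // exprn_ge0 // ltW.
have p2 : 0 <= s ^+ (N - m) * c1 by rewrite mulr_ge0 // exprn_ge0 // ltW.
nra.
Qed.

(** The [bd 2] bound is spent in two ways: on [defect 2], which becomes an element of [E^k] with
    norm of size [c], and on the complement, which lies in [E^{k+2}] with norm of size [c / s^2].
    [jackson] with [m = k] and [m = k + 2] gives the same power [s^k c] for both. *)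
Lemma K_upper k : (k.+2 <= N)%N -> exists C : R, 0 <= C /\ forall s, 0 < s -> s <= 1 -> forall f c,
  ZD k s f c -> exists f1, `|f - f1| <= C * (s ^+ k * c) /\
                           BD 0 N s f1 (C * (s ^+ k * c / s ^+ N)).
Proof.
move=> kN.
have [C [C0 HC]] := PowN_gain2 k (leq_trans (leq_addl k 2) (ltac:(rewrite addn2; exact: kN))).
have [D [D0 HD]] := good_BD hT (good_defect k 2).
have [J [J0 HJ]] := jackson (ltnW (ltnW kN)).
have [J' [J'0 HJ']] := jackson kN.
pose c4 : R := 400 ^+ k.
have c40 : 0 <= c4 := exprn_ge0 k (ler0n R 400).
exists ((J * D + J' * C) * c4); split; first by rewrite mulr_ge0 // addr_ge0 // mulr_ge0.
move=> s s0 s1 f c /(ZD_BD s0 s1) H.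
have := HC s s0 s1 f _ H; have := HD s s0 s1 0%N f _ H.
set f1 := PowN s (geomsum 2 s f); rewrite -/c4 => H1 H2.
have [g1 [A1 B1]] := HJ s s0 s1 _ _ H1.
have [g2 [A2 B2]] := HJ' s s0 s1 _ _ H2.
have sk : s ^+ k.+2 * (C * (c4 * c / s ^+ 2)) = s ^+ k * (C * (c4 * c)).
  rewrite -addn2 exprD; move: (s ^+ k) => x; field; exact: lt0r_neq0.
rewrite sk in A2 B2.
have fE : f = defect 2 s f + f1 by rewrite /f1 -sub_defect // addrC subrK.
exists (g1 + g2); split.
  rewrite [in X in X <= _]fE.
  have -> : defect 2 s f + f1 - (g1 + g2) = (defect 2 s f - g1) + (f1 - g2) by lmod R.
  apply: le_trans (ler_normD _ _) _; apply: le_trans (lerD A1 A2) _.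
  rewrite le_eqVlt; apply/orP; left; apply/eqP; ring.
apply: BD_le (BDD hT B1 B2) _.
by rewrite le_eqVlt; apply/orP; left; apply/eqP; ring.
Qed.

End Iterates.
End Approximation.

(** * The spaces E^r and the K-functional *)

Section Interface.
Context {R : realType} {E : completeNormedModType R}.
Variable T : R -> R -> E -> E.
Hypothesis hT : contractive_rep T.
Local Notation S := (Tj T).
Local Notation isgen := (isgen T).
Local Notation bd := (bd T).
Local Notation BD := (BD T).

Lemma Aprod_rcons js j f : Aprod T (rcons js j) f = Aprod T js (gen (S j) f).
Proof. by rewrite /Aprod foldr_rcons. Qed.

Lemma Adom_rcons js j f : Adom T (rcons js j) f <-> gen_dom (S j) f /\ Adom T js (gen (S j) f).
Proof.
elim: js => [|l js IH] /=; first by tauto.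
rewrite IH Aprod_rcons; tauto.
Qed.

Lemma inErP i f : inEr T i f <-> forall js, (size js <= i)%N -> Adom T js f.
Proof.
split=> [H js si|H k /andP[_ ki] js]; last by apply: H; rewrite size_tuple.
case: (posnP (size js)) => [/size0nil -> //|s0].
by have := H (size js) (ltac:(by rewrite s0 si)) (in_tuple js).
Qed.

Lemma inErS i f : inEr T i.+1 f <->
  forall j, gen_dom (S j) f /\ inEr T i (gen (S j) f).
Proof.
rewrite inErP; split=> [H j|H js].
  split; first by have /Adom_rcons [] := H (rcons [::] j) isT.
  by apply/inErP => js si; have /Adom_rcons [] := H (rcons js j) (ltac:(by rewrite size_rcons)).
case/lastP: js => [//|js j]; rewrite size_rcons ltnS => si; apply/Adom_rcons.
by have [H1 /inErP H2] := H j; split => //; exact: H2.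
Qed.

Lemma inEr_le i i' f : (i' <= i)%N -> inEr T i f -> inEr T i' f.
Proof. by move=> ii /inErP H; apply/inErP => js sj; apply: H; exact: leq_trans ii. Qed.

(** [BD] peels off the generator applied first, which is the last letter of the word in [Aprod];
    hence the [rcons] forms. *)
Lemma BD_inEr d i s f c : BD d i s f c <->
  inEr T i f /\ forall js, (size js <= i)%N -> bd d s (Aprod T js f) c.
Proof.
elim: i f => [|i IH] f.
  split=> [[H _]|[_ H]]; last by split => //; exact: (H [::]).
  by split=> [|[]//]; apply/inErP; case.
rewrite inErS; split=> [[H1 H2]|[H1 H2]].
  have G j : isgen j f (gen (S j) f) /\ BD d i s (gen (S j) f) c.
    by have [g [Hg G]] := H2 j; rewrite (isgen_gen Hg).
  split=> [j|js].
    by have [Hg /IH [G1 _]] := G j; split => //; exact: isgen_dom Hg.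
  case/lastP: js => [//|js j]; rewrite size_rcons ltnS => si; rewrite Aprod_rcons.
  by have [_ /IH [_]] := G j; apply.
split; first exact: (H2 [::]).
move=> j; have [D1 D2] := H1 j; exists (gen (S j) f); split; first exact: gen_domP.
by apply/IH; split => // js si; rewrite -Aprod_rcons; apply: H2; rewrite size_rcons.
Qed.

Lemma ZD_inEr i s f c : inEr T i f -> (forall js, (size js <= i)%N -> s ^+ 2 * `|Aprod T js f| <= c) ->
  (forall js, size js = i -> bd 2 s (Aprod T js f) c) -> ZD T i s f c.
Proof.
elim: i f => [|i IH] f; first by move=> _ _ H; exact: (H [::]).
move=> /inErS H1 H2 H3 /=; split; first exact: (H2 [::]).
move=> j; have [D1 D2] := H1 j; exists (gen (S j) f); split; first exact: gen_domP.
by apply: IH => // js si; rewrite -Aprod_rcons; [apply: H2|apply: H3]; rewrite size_rcons ?si.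
Qed.

Lemma normEr_ge0 i f : 0 <= normEr T i f.
Proof. by rewrite addr_ge0 // sumr_ge0 // => k _; rewrite sumr_ge0. Qed.

Lemma sum_ge_term (I : finType) (F : I -> R) i : (forall i, 0 <= F i) -> F i <= \sum_i F i.
Proof. by move=> F0; rewrite (bigD1 i) //= lerDl sumr_ge0. Qed.

Lemma Aprod_normEr i f js : (size js <= i)%N -> `|Aprod T js f| <= normEr T i f.
Proof.
rewrite /normEr => si; case: (posnP (size js)) => [/size0nil ->|s0].
  by rewrite lerDl sumr_ge0 // => k _; rewrite sumr_ge0.
apply: ler_wpDl => //.
rewrite (bigD1_seq (size js)) ?mem_index_iota ?iota_uniq ?s0 ?ltnS //=.
rewrite -[leLHS]addr0; apply: lerD; last by rewrite sumr_ge0 // => k _; rewrite sumr_ge0.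
exact: (@sum_ge_term _ (fun js : (size js).-tuple bool => `|Aprod T js f|) (in_tuple js)).
Qed.

(** The number of words of length at most [i]: [BD] is a maximum over words, [normEr] a sum. *)
Definition ncount (i : nat) : R := 1 + \sum_(1 <= k < i.+1) \sum_(js : k.-tuple bool) 1.

Lemma ncount_ge1 i : 1 <= ncount i.
Proof. by rewrite lerDl sumr_ge0 // => k _; rewrite sumr_ge0. Qed.

Lemma normEr_le i f c : (forall js, (size js <= i)%N -> `|Aprod T js f| <= c) ->
  normEr T i f <= ncount i * c.
Proof.
move=> H; rewrite /ncount mulrDl mul1r mulr_suml; apply: lerD; first exact: (H [::]).
rewrite big_nat_cond [leRHS]big_nat_cond; apply: ler_sum => k /andP[/andP[_ ki] _].
by rewrite mulr_suml; apply: ler_sum => js _; rewrite mul1r; apply: H; rewrite size_tuple.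
Qed.

Lemma BD_normEr i s f : inEr T i f -> BD 0 i s f (normEr T i f).
Proof. by move=> H; apply/BD_inEr; split => // js si; apply/bd0E; exact: Aprod_normEr. Qed.

Lemma normEr_BD i s f c : BD 0 i s f c -> normEr T i f <= ncount i * c.
Proof. by move=> /BD_inEr [_ H]; apply: normEr_le => js /H /bd0E. Qed.

Lemma inEr_BD i s f c : BD 0 i s f c -> inEr T i f.
Proof. by move=> /BD_inEr []. Qed.

Lemma AprodD js f g : Adom T js f -> Adom T js g ->
  Adom T js (f + g) /\ Aprod T js (f + g) = Aprod T js f + Aprod T js g.
Proof.
elim: js => [//|j js IH] /= [/IH{}IH H1] [/IH[I1 I2] H2].
have H : isgen j (Aprod T js (f + g)) (gen (S j) (Aprod T js f) + gen (S j) (Aprod T js g)).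
  by rewrite I2; apply: (isgenD hT); exact: gen_domP.
by split; [split=> //; exact: isgen_dom H|exact: (isgen_gen H)].
Qed.

Lemma AprodZ js k f : Adom T js f ->
  Adom T js (k *: f) /\ Aprod T js (k *: f) = k *: Aprod T js f.
Proof.
elim: js => [//|j js IH] /= [/IH[I1 I2] H2].
have H : isgen j (Aprod T js (k *: f)) (k *: gen (S j) (Aprod T js f)).
  by rewrite I2; apply: (isgenZ hT); exact: gen_domP.
by split; [split=> //; exact: isgen_dom H|exact: (isgen_gen H)].
Qed.

Lemma inErD i f g : inEr T i f -> inEr T i g -> inEr T i (f + g).
Proof.
move=> /inErP H /inErP G; apply/inErP => js si.
by have [] := AprodD (H js si) (G js si).
Qed.

Lemma inErZ i k f : inEr T i f -> inEr T i (k *: f).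
Proof. by move=> /inErP H; apply/inErP => js si; have [] := AprodZ k (H js si). Qed.

Lemma inErB i f g : inEr T i f -> inEr T i g -> inEr T i (f - g).
Proof. by move=> H G; rewrite -scaleN1r; apply: inErD => //; exact: inErZ. Qed.

Lemma inEr0 i : inEr T i 0.
Proof. by have := BD0v hT 0 i 0; exact: inEr_BD. Qed.

Lemma normErD i f g : inEr T i f -> inEr T i g -> normEr T i (f + g) <= normEr T i f + normEr T i g.
Proof.
move=> /inErP H /inErP G; rewrite /normEr addrACA; apply: lerD; first exact: ler_normD.
rewrite -big_split /= !big_nat; apply: ler_sum => k /andP[_ ki].
rewrite -big_split /=; apply: ler_sum => js _.
have sj : (size js <= i)%N by rewrite size_tuple.
by have [_ ->] := AprodD (H js sj) (G js sj); exact: ler_normD.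
Qed.

Lemma normEr0 i : normEr T i 0 = 0.
Proof.
apply/eqP; rewrite eq_le normEr_ge0 andbT -(mulr0 (ncount i)).
exact: (normEr_BD (BD0v hT 0 i 0)).
Qed.

Lemma normEr_mono i i' f : (i <= i')%N -> normEr T i f <= normEr T i' f.
Proof.
move=> ii; rewrite /normEr lerD2l [leRHS](@big_cat_nat _ _ _ i.+1) //=.
by rewrite lerDl sumr_ge0 // => k _; rewrite sumr_ge0.
Qed.

Definition om_set s (f : E) (js : 2.-tuple bool) : set R :=
  [set x : R | exists ts : 2.-tuple R, (forall i : 'I_2, 0 <= tnth ts i <= s) /\
      x = `|foldr (fun p g => S p.1 p.2 g - g) f (zip js ts)| ].

Lemma tuple2E (A : Type) (t : 2.-tuple A) : exists a b, t = [tuple a; b].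
Proof.
case: t => [[|a [|b [|c s]]]] // i; exists a, b; exact: val_inj.
Qed.

Lemma om_setE s f a b x : om_set s f [tuple a; b] x <->
  exists t u, [/\ 0 <= t <= s, 0 <= u <= s & x = `|Dif T a t (Dif T b u f)|].
Proof.
split=> [[ts]|[t [u [ts us ->]]]].
  have [t [u ->]] := tuple2E ts => -[H ->]; exists t, u; split => //.
    exact: (H ord0).
  exact: (H ord_max).
exists [tuple t; u]; split=> [i|//].
by have := mem_tnth i [tuple t; u]; rewrite !inE => /orP[] /eqP ->.
Qed.

Lemma om_set_ub s f js : has_ubound (om_set s f js).
Proof.
have [a [b ->]] := tuple2E js; exists (4 * `|f|) => x /om_setE [t [u [_ _ ->]]].
by have := Dif_norm hT a t (Dif T b u f); have := Dif_norm hT b u f; lra.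
Qed.

Lemma om_set_ne s f js : 0 <= s -> om_set s f js !=set0.
Proof.
move=> s0; have [a [b ->]] := tuple2E js; exists `|Dif T a 0 (Dif T b 0 f)|; apply/om_setE.
by exists 0, 0; rewrite lexx s0.
Qed.

Lemma om_sup_ge0 s f js : 0 <= s -> 0 <= sup (om_set s f js).
Proof.
move=> s0; have [x Hx] := om_set_ne f js s0.
apply: le_trans (ub_le_sup (om_set_ub s f js) Hx).
by have [a [b jE]] := tuple2E js; move: Hx; rewrite jE => /om_setE [t [u [_ _ ->]]].
Qed.

Lemma Omega_ge s f a b t u : 0 <= s -> 0 <= t <= s -> 0 <= u <= s ->
  `|Dif T a t (Dif T b u f)| <= Omega T 2 s f.
Proof.
move=> s0 ts us.
apply: (@le_trans _ _ (sup (om_set s f [tuple a; b]))).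
  by apply: (ub_le_sup (om_set_ub s f _)); apply/om_setE; exists t, u.
apply: (@sum_ge_term _ (fun js => sup (om_set s f js))) => js; exact: om_sup_ge0.
Qed.

Lemma Omega_le s f c : 0 <= s -> (forall a b t u, 0 <= t <= s -> 0 <= u <= s ->
  `|Dif T a t (Dif T b u f)| <= c) -> Omega T 2 s f <= 4 * c.
Proof.
move=> s0 H; rewrite /Omega.
apply: (@le_trans _ _ (\sum_(js : 2.-tuple bool) c)).
  apply: ler_sum => js _; apply: ge_sup; first exact: om_set_ne.
  have [a [b ->]] := tuple2E js; move=> x /om_setE [t [u [ts us ->]]]; exact: H.
by rewrite sumr_const card_tuple card_bool -[leLHS]mulr_natl.
Qed.

Lemma Omega_ge0 s f : 0 <= s -> 0 <= Omega T 2 s f.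
Proof. by move=> s0; apply: sumr_ge0 => js _; exact: om_sup_ge0. Qed.

Lemma Omega_mono s s' f : 0 <= s -> s <= s' -> Omega T 2 s f <= Omega T 2 s' f.
Proof.
move=> s0 ss; apply: ler_sum => js _; apply: ge_sup; first exact: om_set_ne.
move=> x Hx; apply: (ub_le_sup (om_set_ub s' f js)).
move: Hx; have [a [b ->]] := tuple2E js; move=> /om_setE [t [u [ts us ->]]].
by apply/om_setE; exists t, u; split => //; lra.
Qed.

Lemma Omega_norm s f : 0 <= s -> Omega T 2 s f <= 16 * `|f|.
Proof.
move=> s0; rewrite (_ : 16 * `|f| = 4 * (4 * `|f|)); last by ring.
apply: Omega_le => // a b t u _ _.
by have := Dif_norm hT a t (Dif T b u f); have := Dif_norm hT b u f; lra.
Qed.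

Lemma bd2_Omega s f : 0 <= s -> bd 2 s f (Omega T 2 s f + s ^+ 2 * `|f|).
Proof.
move=> s0; have O := Omega_ge0 f s0.
have sf : 0 <= s ^+ 2 * `|f| by rewrite mulr_ge0 // sqr_ge0.
apply/bd2E; split; first lra.
by move=> a b t u ts us; have := Omega_ge f a b s0 ts us; lra.
Qed.

Section KFunctional.
Variable r : nat.
Definition K_set t (f : E) : set R :=
  [set x : R | exists f1 : E, inEr T r f1 /\ x = `|f - f1| + t * normEr T r f1].

Lemma K_lb t f : 0 <= t -> has_lbound (K_set t f).
Proof.
move=> t0; exists 0 => x [f1 [_ ->]].
by rewrite addr_ge0 // mulr_ge0 // normEr_ge0.
Qed.

Lemma K_ne t f : K_set t f !=set0.
Proof. by exists (`|f - 0| + t * normEr T r 0), 0; split => //; exact: inEr0. Qed.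

Lemma K_le t f f1 : 0 <= t -> inEr T r f1 -> Kfun T r t f <= `|f - f1| + t * normEr T r f1.
Proof. by move=> t0 H; apply: (ge_inf (K_lb f t0)); exists f1. Qed.

Lemma K_norm t f : 0 <= t -> Kfun T r t f <= `|f|.
Proof.
by move=> t0; have := K_le f t0 (@inEr0 r); rewrite subr0 normEr0 mulr0 addr0.
Qed.

Lemma K_ge t f c : (forall f1, inEr T r f1 -> c <= `|f - f1| + t * normEr T r f1) -> c <= Kfun T r t f.
Proof. by move=> H; apply: lb_le_inf; [exact: K_ne|move=> x [f1 [H1 ->]]; exact: H]. Qed.

Lemma K_ge0 t f : 0 <= t -> 0 <= Kfun T r t f.
Proof. by move=> t0; apply: K_ge => f1 _; rewrite addr_ge0 // mulr_ge0 // normEr_ge0. Qed.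

Lemma K_mono t t' f : 0 <= t -> t <= t' -> Kfun T r t f <= Kfun T r t' f.
Proof.
move=> t0 tt; apply: K_ge => f1 H; apply: le_trans (K_le f t0 H) _.
by rewrite lerD2l ler_wpM2r // normEr_ge0.
Qed.

Lemma K_scale t l f : 0 <= t -> 0 <= l -> l <= 1 -> l * Kfun T r t f <= Kfun T r (l * t) f.
Proof.
move=> t0 l0 l1; apply: K_ge => f1 H.
have := K_le f t0 H; have := normr_ge0 (f - f1); have := normEr_ge0 r f1; nra.
Qed.

Lemma normr_K t f : 0 < t -> t <= 1 -> t * `|f| <= Kfun T r t f.
Proof.
move=> t0 t1; apply: K_ge => f1 H.
have : `|f1| <= normEr T r f1 by exact: (@Aprod_normEr r f1 [::]).
have : `|f| <= `|f - f1| + `|f1| by rewrite -{1}(subrK f1 f); exact: ler_normD.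
by have := normr_ge0 (f - f1); nra.
Qed.

(** For nonzero [f] the infimum is positive by [normr_K], so doubling it leaves room for an element;
    for [f = 0] it is attained at [0]. *)
Lemma K_opt t f : 0 < t -> t <= 1 -> exists f1, inEr T r f1 /\
  `|f - f1| + t * normEr T r f1 <= 2 * Kfun T r t f.
Proof.
move=> t0 t1; have [->|fn0] := eqVneq f 0.
  exists 0; split; first exact: inEr0.
  by rewrite subr0 normr0 normEr0 mulr0 addr0 mulr_ge0 // K_ge0 // ltW.
have K0 : 0 < Kfun T r t f.
  by apply: lt_le_trans (normr_K f t0 t1); rewrite mulr_gt0 // normr_gt0.
have hi : has_inf (K_set t f) by split; [exact: K_ne|apply: K_lb; exact: ltW].
have [x [f1 [H1 ->]] Hx] := inf_adherent K0 hi.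
by exists f1; split => //; apply: ltW; apply: lt_le_trans Hx _; rewrite mulr2n mulrDl !mul1r.
Qed.
End KFunctional.
End Interface.

(** * Discretisation of the weighted norms *)

Section WeightedSequences.
Context {R : realType}.
Implicit Types (q x y X Y : R) (a b : nat -> R).

Lemma powR_le q x y : 0 <= q -> 0 <= x -> x <= y -> x `^ q <= y `^ q.
Proof.
move=> q0 x0 xy; apply: ge0_ler_powR => //; rewrite nnegrE //; exact: le_trans xy.
Qed.

Lemma powR_le_inv q x y : 0 < q -> 0 <= y -> x `^ q <= y `^ q -> x <= y.
Proof.
move=> q0 y0 H; rewrite leNgt; apply/negP => yx.
have : y `^ q < x `^ q by apply: gt0_ltr_powR => //; rewrite nnegrE //; lra.
lra.
Qed.

(** [x^q = x x^{q-1} <= x (x + y)^{q-1}], and likewise for [y]; zero bases are split off for the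
    exponent law. *)
Lemma powR_super q x y : 1 <= q -> 0 <= x -> 0 <= y -> x `^ q + y `^ q <= (x + y) `^ q.
Proof.
move=> q1 x0 y0.
have key z w : 0 <= z -> z <= w -> z `^ q <= z * w `^ (q - 1).
  move=> z0 zw; have [->|zn0] := eqVneq z 0.
    by rewrite mul0r powR0 // gt_eqF //; lra.
  have zE : z `^ q = z * z `^ (q - 1).
    rewrite -[X in X * _](powRr1 z0) -powRD ?zn0 ?implybT //.
    by congr (_ `^ _); ring.
  by rewrite zE; apply: ler_wpM2l => //; apply: powR_le => //; lra.
have [/eqP xy0|xy0] := eqVneq (x + y) 0.
  have -> : x = 0 by lra.
  have -> : y = 0 by lra.
  by rewrite !addr0 powR0 ?addr0 // gt_eqF //; lra.
have -> : (x + y) `^ q = x * (x + y) `^ (q - 1) + y * (x + y) `^ (q - 1).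
  rewrite -mulrDl -[X in X * _]powRr1; last exact: addr_ge0.
  rewrite -powRD ?xy0 ?implybT //.
  by congr (_ `^ _); ring.
by apply: lerD; apply: key => //; lra.
Qed.

Lemma powR_half q x y : 1 <= q -> 0 <= x -> 0 <= y ->
  (2^-1 * x + 2^-1 * y) `^ q <= 2^-1 * x `^ q + 2^-1 * y `^ q.
Proof.
move=> q1 x0 y0.
have t : 0 <= (2^-1 : R) <= 1 by apply/andP; split; lra.
have := @convex_powR R q q1 (Itv01 (proj1 (andP t)) (proj2 (andP t))) x y.
rewrite !inE /= !in_itv /= !andbT => /(_ x0 y0).
move=> H.
have {H} : (2^-1 * x + (1 - 2^-1) * y) `^ q <= 2^-1 * x `^ q + (1 - 2^-1) * y `^ q by exact: H.
have -> : 1 - 2^-1 = 2^-1 :> R by field.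
by [].
Qed.

Lemma powR_sub q x y : 1 <= q -> 0 <= x -> 0 <= y ->
  (x + y) `^ q <= 2 `^ q * (x `^ q + y `^ q).
Proof.
move=> q1 x0 y0; wlog xy : x y x0 y0 / x <= y.
  move=> H; case: (leP x y) => [|/ltW] h; first exact: H.
  by rewrite addrC [X in _ * X]addrC; exact: H.
apply: (@le_trans _ _ ((2 * y) `^ q)); first by apply: powR_le; lra.
by rewrite powRM // ler_wpM2l ?powR_ge0 // lerDr powR_ge0.
Qed.

(* [lqb q a X]: the norm of [a] in l^q is at most [X] *)
Definition lqb (q : \bar R) a X : Prop :=
  match q with
  | q'%:E => forall n, \sum_(i < n) a i `^ q' <= X `^ q'
  | _ => forall i, a i <= X
  end.

Variable q : \bar R.
Hypothesis hq : (1 <= q)%E.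

Lemma lqb_term a X i : 0 <= X -> (forall i, 0 <= a i) -> lqb q a X -> a i <= X.
Proof.
move=> X0 a0; case: q hq => [q'||] //= q1.
rewrite lee_fin in q1.
move=> /(_ i.+1) H; apply: (@powR_le_inv q') => //; first lra.
apply: le_trans H; rewrite big_ord_recr /= lerDr sumr_ge0 // => j _; exact: powR_ge0.
Qed.

Lemma lqb_le a b X Y : 0 <= X -> X <= Y -> (forall i, 0 <= a i <= b i) -> lqb q b X -> lqb q a Y.
Proof.
move=> X0 XY ab; case: q hq => [q'||] //= q1 H.
  rewrite lee_fin in q1.
  move=> n; apply: le_trans (powR_le _ X0 XY); last lra.
  apply: le_trans (H n); apply: ler_sum => i _; have /andP[a0 ai] := ab i.
  by apply: powR_le => //; lra.
by move=> i; apply: le_trans XY; have /andP[_ ai] := ab i; exact: le_trans ai (H i).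
Qed.

Lemma lqbZ a X c : 0 <= c -> 0 <= X -> (forall i, 0 <= a i) -> lqb q a X ->
  lqb q (fun i => c * a i) (c * X).
Proof.
move=> c0 X0 a0; case: q hq => [q'||] //= q1 H; last by move=> i; exact: ler_wpM2l.
move=> n; under eq_bigr do rewrite powRM //.
by rewrite -mulr_sumr powRM // ler_wpM2l // powR_ge0.
Qed.

Lemma lqbD a b X Y : 0 <= X -> 0 <= Y -> (forall i, 0 <= a i) -> (forall i, 0 <= b i) ->
  lqb q a X -> lqb q b Y -> lqb q (fun i => a i + b i) (2 * (X + Y)).
Proof.
move=> X0 Y0 a0 b0; case: q hq => [q'||] //= q1 HX HY; last first.
  by move=> i; have := HX i; have := HY i; lra.
rewrite lee_fin in q1.
move=> n; rewrite powRM //; last lra.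
apply: (@le_trans _ _ (2 `^ q' * (X `^ q' + Y `^ q'))); last first.
  by rewrite ler_wpM2l ?powR_ge0 //; exact: powR_super.
apply: (@le_trans _ _ (\sum_(i < n) 2 `^ q' * (a i `^ q' + b i `^ q'))).
  by apply: ler_sum => i _; exact: powR_sub.
by rewrite -mulr_sumr big_split /= ler_wpM2l ?powR_ge0 // lerD.
Qed.

(* Discrete Hardy inequalities: the recursion is summed and absorbed by convexity *)
Lemma hardy_down al b X A : 0 <= X -> 0 <= A -> (forall i, 0 <= b i) -> lqb q b X ->
  (forall i, 0 <= al i <= A) -> (forall i, al i <= 2^-1 * al i.+1 + b i) -> lqb q al (A + 2 * X).
Proof.
move=> X0 A0 b0; case: q hq => [q'||] //= q1 HX HA Hr; last first.
  by move=> i; have /andP[_ ?] := HA i; lra.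
rewrite lee_fin in q1.
move=> n; have step i : al i `^ q' <= 2^-1 * al i.+1 `^ q' + 2^-1 * (2 `^ q' * b i `^ q').
  have /andP[ai0 _] := HA i; have /andP[ai1 _] := HA i.+1.
  rewrite -powRM //.
  apply: le_trans (powR_half q1 ai1 (_ : 0 <= 2 * b i)); last by rewrite mulr_ge0.
  by apply: powR_le; [lra|lra|rewrite mulrA mulVf ?mul1r].
(* Summation shifts the index of [al]: half of the sum returns on the right together with a last
   term, which the a priori bound [A] controls. *)
have : \sum_(i < n) al i `^ q' <=
    2^-1 * (\sum_(i < n) al i `^ q' + al n `^ q') + 2^-1 * (2 `^ q' * \sum_(i < n) b i `^ q').
  elim: n => [|n IH].
    by rewrite !big_ord0 mulr0 mulr0 addr0 add0r mulr_ge0 // powR_ge0.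
  rewrite !big_ord_recr /=; have := step n; nra.
have := HX n; have := powR_ge0 2 q'; set B := \sum_(i < n) _ => p2 HB.
have An : al n `^ q' <= A `^ q' by have /andP[? ?] := HA n; apply: powR_le => //; lra.
have := ler_wpM2l p2 HB.
have := @powR_super q' A (2 * X) q1 A0 (ltac:(lra)); rewrite powRM //.
lra.
Qed.

Lemma hardy_up be b X A : 0 <= X -> 0 <= A -> (forall i, 0 <= b i) -> lqb q b X ->
  (forall i, 0 <= be i) -> be 0%N <= A -> (forall i, be i.+1 <= 2^-1 * be i + b i) ->
  lqb q be (2 * A + 2 * X).
Proof.
move=> X0 A0 b0; case: q hq => [q'||] //= q1 HX Hb HA Hr; last first.
  by elim=> [|i IH]; [lra|have := Hr i; have := HX i; lra].
rewrite lee_fin in q1.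
move=> n; have step i : be i.+1 `^ q' <= 2^-1 * be i `^ q' + 2^-1 * (2 `^ q' * b i `^ q').
  rewrite -powRM //.
  apply: le_trans (powR_half q1 (Hb i) (_ : 0 <= 2 * b i)); last by rewrite mulr_ge0.
  by apply: powR_le; [lra|exact: Hb|rewrite mulrA mulVf ?mul1r].
(* Keeping [be n] on the left closes the induction; the half sum is absorbed afterwards. *)
have : \sum_(i < n) be i `^ q' + be n `^ q' <=
    A `^ q' + 2^-1 * (\sum_(i < n) be i `^ q') + 2^-1 * (2 `^ q' * \sum_(i < n) b i `^ q').
  elim: n => [|n IH].
    by rewrite !big_ord0 !mulr0 !addr0 add0r; apply: powR_le => //; lra.
  rewrite !big_ord_recr /=; have := step n; nra.
have := HX n; have := powR_ge0 2 q'; set B := \sum_(i < n) _ => p2 HB.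
have pn := powR_ge0 (be n) q'.
have := ler_wpM2l p2 HB.
have := @powR_super q' (2 * A) (2 * X) q1 (ltac:(lra)) (ltac:(lra)); rewrite !powRM //.
have : 2 * A `^ q' <= 2 `^ q' * A `^ q'.
  rewrite ler_wpM2r ?powR_ge0 // -{1}(@powRr1 _ 2) //.
  by apply: ler_powR => //; lra.
lra.
Qed.

(** A geometric sequence solves the recursion of [hardy_up] with zero forcing term. *)
Lemma lqb_geometric c : 0 <= c -> lqb q (fun i => c * 2^-1 ^+ i) (2 * c).
Proof.
move=> c0; have := @hardy_up (fun i => c * 2^-1 ^+ i) (fun=> 0) 0 c (lexx 0) c0.
rewrite mulr0 addr0; apply => //.
- case: q hq => [q'||] //= q1 n; rewrite lee_fin in q1.
  by rewrite powR0 ?big1 // gt_eqF //; lra.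
- by move=> i; rewrite mulr_ge0 // exprn_ge0.
- by rewrite expr0 mulr1.
- by move=> i; rewrite exprS addr0 mulrCA.
Qed.
End WeightedSequences.

(** * Dyadic comparison of weighted integrals with sequences *)

Section Dyadic.
Context {R : realType}.
Local Notation mu := (@lebesgue_measure R).
Local Notation h := (2^-1 : R).

Definition ilow (i : nat) : interval R := `]h ^+ i.+1, h ^+ i].
Definition ihigh (i : nat) : interval R := `]2 ^+ i, 2 ^+ i.+1].

Lemma half_pow_gt0 i : 0 < h ^+ i.
Proof. by rewrite exprn_gt0. Qed.

Lemma natr_lt_exp2 n : n%:R < 2 ^+ n :> R.
Proof. by rewrite -natrX ltr_nat ltn_expl. Qed.

Lemma ilow_cover s : 0 < s -> s <= 1 -> exists i, s \in ilow i.
Proof.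
move=> s0 s1.
have ex : exists i, h ^+ i.+1 < s.
  have [N HN] := small_inv s0.
  exists N; apply: lt_le_trans (HN N (leqnn N)).
  rewrite exprVn ltf_pV2 ?posrE ?exprn_gt0 ?ltr0n //; exact: natr_lt_exp2.
case: (ex_minnP ex) => i Hi Hm; exists i; rewrite in_itv /= Hi /=.
case: i Hi Hm => [|i] Hi Hm; first by rewrite expr0.
by rewrite leNgt; apply/negP => /Hm; rewrite ltnn.
Qed.

Lemma ihigh_cover s : 1 < s -> exists i, s \in ihigh i.
Proof.
move=> s1.
have ex : exists i, s <= 2 ^+ i.+1.
  exists (Num.trunc s).+1.
  have /truncn_itv/andP[_ H] : 0 <= s by lra.
  apply: le_trans (ltW H) _; apply: le_trans (ltW (natr_lt_exp2 _)) _.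
  by rewrite ler_eXn2l // ltr1n.
case: (ex_minnP ex) => i Hi Hm; exists i; rewrite in_itv /= Hi andbT.
case: i Hi Hm => [|i] Hi Hm; first by rewrite expr0.
by rewrite ltNge; apply/negP => /Hm; rewrite ltnn.
Qed.

Lemma ilow_disj s i j : s \in ilow i -> s \in ilow j -> i = j.
Proof.
wlog ij : i j / (i <= j)%N => [H|].
  by case/orP: (leq_total i j) => ij Hi Hj; [|apply/esym]; apply: H.
rewrite !in_itv /= => /andP[a1 a2] /andP[b1 b2].
move: ij; rewrite leq_eqVlt => /orP[/eqP //|ij].
have hij : h ^+ j <= h ^+ i.+1 by apply: ler_wiXn2l => //; lra.
by have := lt_le_trans a1 (le_trans b2 hij); rewrite ltxx.
Qed.

Lemma mu_ilow i : mu [set` ilow i] = (h ^+ i.+1)%:E.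
Proof.
rewrite lebesgue_measure_itv /= lte_fin.
have p := half_pow_gt0 i.
have -> : h ^+ i.+1 < h ^+ i by rewrite exprS; lra.
by rewrite -EFinB; congr (_%:E); rewrite exprS; lra.
Qed.

Lemma mu_ihigh i : mu [set` ihigh i] = (2 ^+ i)%:E.
Proof.
rewrite lebesgue_measure_itv /= lte_fin.
have p : 0 < 2 ^+ i :> R by rewrite exprn_gt0.
have -> : 2 ^+ i < 2 ^+ i.+1 :> R by rewrite exprS; lra.
by rewrite -EFinB; congr (_%:E); rewrite exprS; lra.
Qed.

Local Notation D := (`]0%R, +oo[%classic : set R).

(** The integral of a nonnegative function is the supremum over the simple functions below it, hence
    monotone whether or not the functions are measurable. *)
Lemma le_integral_nomeas (f g : R -> \bar R) : (forall x, D x -> (0 <= f x)%E) ->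
  (forall x, D x -> (f x <= g x)%E) -> (\int[mu]_(x in D) f x <= \int[mu]_(x in D) g x)%E.
Proof.
move=> f0 fg; rewrite integral_mkcond [leRHS]integral_mkcond.
have fD x : (0 <= (f \_ D) x)%E.
  by rewrite patchE; case: ifPn => // /set_mem; exact: f0.
have gD x : ((f \_ D) x <= (g \_ D) x)%E.
  by rewrite !patchE; case: ifPn => // /set_mem; exact: fg.
rewrite !ge0_integralTE //; last by move=> x; exact: le_trans (gD x).
apply: ereal_sup_le => _ [w Hw <-]; exists w => // x.
exact: le_trans (Hw x) (gD x).
Qed.

Lemma integral_step (i : interval R) (c m : R) : 0 <= c -> [set` i] `<=` D ->
  mu [set` i] = m%:E -> (\int[mu]_(x in D) (c * \1_[set` i] x)%:E = (c * m)%:E)%E.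
Proof.
move=> c0 iD im.
have H := @integralZl_indic _ _ R mu D (measurable_itv _) (fun=> [set` i]) c.
rewrite H //; last by rewrite ltNge c0.
by rewrite integral_indic // setIidl // EFinM -im.
Qed.

Lemma meas_step (i : interval R) (c : R) : measurable_fun D (fun x : R => (c * \1_[set` i] x)%:E).
Proof.
apply/measurable_EFinP; apply: measurable_funM; first exact: measurable_cst.
by apply: measurable_indic.
Qed.

Lemma ilowD i : [set` ilow i] `<=` D.
Proof.
by move=> x /=; rewrite !in_itv /= => /andP[xi _]; rewrite andbT; apply: lt_trans xi; exact: half_pow_gt0.
Qed.

Lemma ihighD i : [set` ihigh i] `<=` D.
Proof.
by move=> x /=; rewrite !in_itv /= => /andP[xi _]; rewrite andbT; apply: lt_trans xi; exact: exprn_gt0.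
Qed.

(** [f s / s] lies below steps of height [2^{i+1} a_i] and [2^{-i} c_i]. Multiplied by the lengths
    of the dyadic intervals these give exactly [a_i] and [c_i]. *)
Lemma integral_upper (f : R -> R) (a c : nat -> R) (A C : R) :
  (forall s, 0 < s -> 0 <= f s) ->
  (forall i, 0 <= a i) -> (forall i, 0 <= c i) ->
  (forall i s, s \in ilow i -> f s <= a i) -> (forall i s, s \in ihigh i -> f s <= c i) ->
  (forall n, \sum_(i < n) a i <= A) -> (forall n, \sum_(i < n) c i <= C) ->
  (\int[mu]_(s in D) (f s / s)%:E <= (A + C)%:E)%E.
Proof.
move=> f0 a0 c0 fa fc HA HC.
pose u (i : nat) (x : R) := ((2 ^+ i.+1 * a i * \1_[set` ilow i] x)%:E
   + (h ^+ i * c i * \1_[set` ihigh i] x)%:E)%E.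
have p2 n : 0 <= 2 ^+ n :> R by rewrite exprn_ge0.
have ph n : 0 <= h ^+ n by rewrite exprn_ge0.
have u0 i x : (0 <= u i x)%E.
  by rewrite /u -EFinD lee_fin addr_ge0 // mulr_ge0 // ?mulr_ge0.
have iu i : (\int[mu]_(x in D) u i x = (a i + c i)%:E)%E.
  rewrite ge0_integralD //; first last.
  - exact: meas_step.
  - by move=> x _; rewrite lee_fin mulr_ge0 // mulr_ge0.
  - exact: meas_step.
  - by move=> x _; rewrite lee_fin mulr_ge0 // mulr_ge0.
  rewrite (integral_step _ (@ilowD i) (mu_ilow i)) ?mulr_ge0 //.
  rewrite (integral_step _ (@ihighD i) (mu_ihigh i)) ?mulr_ge0 //.
  rewrite -EFinD; congr (_%:E).
  have e1 : 2 ^+ i.+1 * h ^+ i.+1 = 1 by rewrite -exprMn mulfV // expr1n.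
  have e2 : h ^+ i * 2 ^+ i = 1 by rewrite -exprMn mulVf // expr1n.
  by rewrite mulrAC e1 mul1r mulrAC e2 mul1r.
apply: (@le_trans _ _ (\int[mu]_(x in D) (\sum_(0 <= i <oo) u i x))%E).
  apply: le_integral_nomeas => s.
    rewrite /= in_itv /= andbT => s0.
    by rewrite lee_fin divr_ge0 ?f0 // ltW.
  rewrite /= in_itv /= andbT => s0.
  have term i v : ((f s / s)%:E <= v)%E -> v = u i s -> ((f s / s)%:E <= \sum_(0 <= i <oo) u i s)%E.
    move=> H vE; apply: le_trans H _; rewrite vE.
    apply: le_trans (@nneseries_lim_ge _ (u ^~ s) xpredT 0 i.+1 _); last by move=> *; exact: u0.
    by rewrite big_nat_recr //= leeDr // sume_ge0.
  have [s1|s1] := leP s 1.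
    have [i Hi] := ilow_cover s0 s1.
    apply: (term i _ _ erefl); rewrite /u -EFinD lee_fin.
    rewrite [X in X + _]mulrC indicE mem_set // mul1r.
    rewrite -[leLHS]addr0; apply: lerD; last by rewrite mulr_ge0 // mulr_ge0.
    have fs := fa i s Hi; move: (Hi); rewrite in_itv /= => /andP[s2 _].
    rewrite ler_pdivrMr //; apply: le_trans fs _.
    have : 1 <= 2 ^+ i.+1 * s.
      have e1 : 2 ^+ i.+1 * h ^+ i.+1 = 1 by rewrite -exprMn mulfV // expr1n.
      by rewrite -{1}e1 ler_wpM2l // ltW.
    by have := a0 i; nra.
  have [i Hi] := ihigh_cover s1.
  apply: (term i _ _ erefl); rewrite /u -EFinD lee_fin.
  rewrite [X in _ + X]mulrC [X in _ + X * _]indicE mem_set // mul1r.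
  rewrite -[leLHS]add0r; apply: lerD; first by rewrite mulr_ge0 // mulr_ge0.
  have fs := fc i s Hi; move: (Hi); rewrite in_itv /= => /andP[s2 _].
  rewrite ler_pdivrMr //; apply: le_trans fs _.
  have : 1 <= h ^+ i * s.
    have e2 : h ^+ i * 2 ^+ i = 1 by rewrite -exprMn mulVf // expr1n.
    by rewrite -{1}e2 ler_wpM2l // ltW.
  by have := c0 i; nra.
rewrite integral_nneseries //; last first.
  by move=> i; apply: emeasurable_funD; exact: meas_step.
apply: lime_le; first by apply: is_cvg_nneseries => i _ _; rewrite iu lee_fin addr_ge0.
apply: nearW => n; under eq_bigr do rewrite iu.
rewrite sumEFin lee_fin big_mkord big_split /=.
by apply: lerD; [exact: HA|exact: HC].
Qed.

(** On [ilow i] one has [1 / s >= 2^i], and the length is [2^{-(i+1)}]; hence the factor [1/2]. *)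
Lemma integral_lower (f : R -> R) (a : nat -> R) n :
  (forall s, 0 < s -> 0 <= f s) -> (forall i, 0 <= a i) ->
  (forall i s, s \in ilow i -> a i <= f s) ->
  ((2^-1 * \sum_(i < n) a i)%:E <= \int[mu]_(s in D) (f s / s)%:E)%E.
Proof.
move=> f0 a0 fa.
pose u (i : nat) (x : R) := (2 ^+ i * a i * \1_[set` ilow i] x)%:E.
have p2 m : 0 <= 2 ^+ m :> R by rewrite exprn_ge0.
have u0 i x : (0 <= u i x)%E by rewrite lee_fin mulr_ge0 // mulr_ge0.
have -> : (2^-1 * \sum_(i < n) a i)%:E = (\int[mu]_(x in D) (\sum_(i < n) u i x))%E.
  rewrite ge0_integral_sum //; last by move=> i; exact: meas_step.
  rewrite mulr_sumr -sumEFin; apply: eq_bigr => i _.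
  rewrite (integral_step _ (@ilowD i) (mu_ilow i)) ?mulr_ge0 //; congr (_%:E).
  have e1 : 2 ^+ i * h ^+ i = 1 by rewrite -exprMn mulfV // expr1n.
  rewrite exprS (_ : 2^-1 * a i = 2^-1 * a i * (2 ^+ i * h ^+ i)); last by rewrite e1 mulr1.
  by ring.
apply: le_integral_nomeas => s; first by move=> _; rewrite sume_ge0.
rewrite /= in_itv /= andbT => s0.
have fs0 : 0 <= f s / s by rewrite divr_ge0 ?f0 // ltW.
have [[i Hi]|Hn] := pselect (exists i : 'I_n, s \in ilow i).
  rewrite (bigD1 i) //= big1 ?adde0; last first.
    move=> j ji; rewrite /u indicE memNset ?mulr0 //= => Hj.
    by move/eqP: ji; apply; apply/val_inj; exact: ilow_disj Hj Hi.
  rewrite /u indicE mem_set // mulr1 lee_fin ler_pdivlMr //.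
  have H := fa _ s Hi; apply: le_trans H.
  move: Hi; rewrite in_itv /= => /andP[_ s2].
  have : 2 ^+ i * s <= 1.
    have e1 : 2 ^+ i * h ^+ i = 1 by rewrite -exprMn mulfV // expr1n.
    by rewrite -[leRHS]e1 ler_wpM2l.
  by have := a0 i; nra.
rewrite big1 ?lee_fin // => i _; rewrite /u indicE memNset ?mulr0 //= => Hi.
by apply: Hn; exists i.
Qed.

Variable q : \bar R.
Hypothesis hq : (1 <= q)%E.

Lemma Lq_upper (F : R -> R) (a c : nat -> R) (X Y : R) : 0 <= X -> 0 <= Y ->
  (forall s, 0 < s -> 0 <= F s) ->
  (forall i s, s \in ilow i -> F s <= a i) -> (forall i s, s \in ihigh i -> F s <= c i) ->
  lqb q a X -> lqb q c Y -> (Lq_dsds q F <= (X + Y)%:E)%E.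
Proof.
move=> X0 Y0 F0 Fa Fc.
have a0 i : 0 <= a i.
  apply: le_trans (Fa i (h ^+ i) _); first by apply: F0; exact: half_pow_gt0.
  by rewrite in_itv /= lexx andbT exprS; have := half_pow_gt0 i; lra.
have c0 i : 0 <= c i.
  have p : 0 < 2 ^+ i.+1 :> R by rewrite exprn_gt0.
  apply: le_trans (Fc i (2 ^+ i.+1) _); first by apply: F0.
  by rewrite in_itv /= lexx andbT; move: p; rewrite exprS; lra.
case: q hq => [q'||] //= q1 HX HY; last first.
  apply: ub_ereal_sup => _ [s /= s0 <-]; rewrite in_itv /= andbT in s0.
  rewrite lee_fin; have [s1|s1] := leP s 1.
    by have [i /Fa Hi] := ilow_cover s0 s1; have := HX i; lra.
  by have [i /Fc Hi] := ihigh_cover s1; have := HY i; lra.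
rewrite lee_fin in q1.
have q0 : 0 < q' by lra.
have XY0 : 0 <= X + Y by lra.
have I : (\int[mu]_(s in D) (F s `^ q' / s)%:E <= ((X + Y) `^ q')%:E)%E.
  apply: (@le_trans _ _ (X `^ q' + Y `^ q')%:E); last by rewrite lee_fin; exact: powR_super.
  apply: (@integral_upper _ (fun i => a i `^ q') (fun i => c i `^ q')) => //.
  - by move=> s _; exact: powR_ge0.
  - by move=> i; exact: powR_ge0.
  - by move=> i; exact: powR_ge0.
  - move=> i s Hi; apply: powR_le; [lra| |exact: Fa].
    by apply: F0; have := ilowD Hi; rewrite /= in_itv /= andbT.
  - move=> i s Hi; apply: powR_le; [lra| |exact: Fc].
    by apply: F0; have := ihighD Hi; rewrite /= in_itv /= andbT.
apply: (@le_trans _ _ (((X + Y) `^ q')%:E `^ q'^-1)%E); last first.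
  by rewrite poweR_EFin -powRrM mulfV ?powRr1 // lt0r_neq0.
apply: gt0_ler_poweR => //; first by rewrite invr_ge0 ltW.
- rewrite in_itv /= leey andbT; apply: integral_ge0 => s.
  rewrite /= in_itv /= andbT => s0.
  by rewrite lee_fin divr_ge0 ?powR_ge0 // ltW.
- by rewrite in_itv /= leey andbT lee_fin powR_ge0.
Qed.

Lemma Lq_ge0 (F : R -> R) : (forall s, 0 < s -> 0 <= F s) -> (0 <= Lq_dsds q F)%E.
Proof.
move=> F0; case: q hq => [q'||] //= q1; first exact: poweR_ge0.
apply: (@le_trans _ _ (F 1)%:E); first by rewrite lee_fin F0.
by apply: ereal_sup_ubound; exists 1 => //=; rewrite in_itv /= ltr01.
Qed.

Lemma Lq_lower (F : R -> R) (a : nat -> R) :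
  (forall s, 0 < s -> 0 <= F s) -> (forall i, 0 <= a i) ->
  (forall i s, s \in ilow i -> a i <= F s) -> (Lq_dsds q F < +oo)%E ->
  lqb q a (2 * fine (Lq_dsds q F)).
Proof.
move=> F0 a0 aF.
have := Lq_ge0 F0.
case: q hq => [q'||] //= q1; last first.
  move=> L0 Loo i.
  have Lf : (ereal_sup [set (F s)%:E | s in `]0%R, +oo[]) \is a fin_num by rewrite ge0_fin_numE.
  have : ((F (h ^+ i))%:E <= ereal_sup [set (F s)%:E | s in `]0%R, +oo[])%E.
    by apply: ereal_sup_ubound; exists (h ^+ i) => //=; rewrite in_itv /= half_pow_gt0.
  move: L0; rewrite -(fineK Lf) !lee_fin => L0.
  have : a i <= F (h ^+ i).
    by apply: aF; rewrite in_itv /= lexx andbT exprS; have := half_pow_gt0 i; lra.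
  by rewrite /=; lra.
rewrite lee_fin in q1.
have q0 : 0 < q' by lra.
move=> _ /(lty_poweRy (invr_neq0 (lt0r_neq0 q0))) Ioo.
have I0 : (0 <= \int[mu]_(s in D) (F s `^ q' / s)%:E)%E.
  apply: integral_ge0 => s; rewrite /= in_itv /= andbT => s0.
  by rewrite lee_fin divr_ge0 ?powR_ge0 // ltW.
have If : (\int[mu]_(s in D) (F s `^ q' / s)%:E)%E \is a fin_num by rewrite ge0_fin_numE.
move=> n.
have := @integral_lower (fun s => F s `^ q') (fun i => a i `^ q') n
  (fun s _ => powR_ge0 _ _) (fun i => powR_ge0 _ _)
  (fun i s Hi => powR_le (ltW q0) (a0 i) (aF i s Hi)).
move: I0; rewrite -(fineK If) poweR_EFin /= !lee_fin.
set v := fine _ => v0 H.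
rewrite powRM ?powR_ge0 // -powRrM mulVf ?lt0r_neq0 // powRr1 //.
(* As [q >= 1], doubling the norm pays for the factor [1/2] of [integral_lower]. *)
have : 2 <= 2 `^ q' by rewrite -{1}(@powRr1 _ 2) //; apply: ler_powR => //; lra.
nra.
Qed.
End Dyadic.

Section SumOfSequences.
Context {R : realType}.
Variable q : \bar R.
Hypothesis hq : (1 <= q)%E.

Lemma lqb_zero : lqb q (fun=> 0 : R) 0.
Proof.
case: q hq => [q'||] //= q1 n; rewrite lee_fin in q1.
by rewrite powR0 ?big1 // gt_eqF //; lra.
Qed.

Lemma lqb_sum (I : Type) (s : seq I) (a : I -> nat -> R) (X : I -> R) :
  (forall j, 0 <= X j) -> (forall j i, 0 <= a j i) -> (forall j, lqb q (a j) (X j)) ->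
  lqb q (fun i => \sum_(j <- s) a j i) (2 ^+ size s * \sum_(j <- s) X j).
Proof.
move=> X0 a0 H; elim: s => [|j s IH].
  apply: (lqb_le hq (lexx 0) (b := fun=> 0)); last exact: lqb_zero.
    by rewrite big_nil mulr0.
  by move=> i; rewrite big_nil lexx.
have S0 : 0 <= \sum_(j <- s) X j by apply: sumr_ge0.
have p0 : 0 <= 2 ^+ size s :> R by rewrite exprn_ge0.
have p1 : 1 <= 2 ^+ size s :> R by rewrite exprn_ege1 //; lra.
have a0s i : 0 <= \sum_(j <- s) a j i by apply: sumr_ge0.
apply: (lqb_le hq _ _ _ (lqbD hq (X0 j) (mulr_ge0 p0 S0) (a0 j) a0s (H j) IH)).
- by have := X0 j; have := mulr_ge0 p0 S0; lra.
- by rewrite big_cons /= exprS; have := X0 j; nra.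
- by move=> i; rewrite big_cons lexx andbT addr_ge0.
Qed.
End SumOfSequences.

(** * The two embeddings *)

Section Assembly.
Context {R : realType} {E : completeNormedModType R}.
Variable T : R -> R -> E -> E.
Hypothesis hT : contractive_rep T.
Local Notation S := (Tj T).
Local Notation isgen := (isgen T).
Local Notation bd := (bd T).
Local Notation BD := (BD T).
Local Notation h := (2^-1 : R).

(** [Dif b u g] integrates translates of [A_b g] over a length at most [s]. The first order modulus
    of [A_b g] is at most [s c], and translation costs the 100 of [bd_S]. *)
Lemma bd_up2 s g c : 0 < s -> s <= 1 -> BD 0 2 s g c -> bd 2 s g (100 * (s ^+ 2 * c)).
Proof.
move=> s0 s1 H; have c0 := bd_ge0 (BD_bd H).
have s20 : 0 <= s ^+ 2 by rewrite sqr_ge0.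
apply/bd2E; split.
  have gc := BD0_ind H.
  have : s ^+ 2 * `|g| <= s ^+ 2 * c by rewrite ler_wpM2l.
  by have := mulr_ge0 s20 c0; lra.
move=> a b t u tt /andP[u0 us].
have [_ /(_ b) [gb [Hg Bg]]] := H.
have {}Bg := BD_bd (BD_up (i := 0) hT s0 Bg).
rewrite [Dif T b u g]/Dif (isgen_prim hT Hg u0).
apply: (@le_trans _ _ (100 * (s * c) * u)).
  apply: (prim_bound (L := Dif T a t)) => //; [exact: Dif_blin|exact: S_contu|move=> x /andP[x0 xu]].
  have /(bd1E _ _ _ (ltW s0)) [_ H1] := bd_S hT b s0 s1 (ltac:(lra) : 0 <= x <= s) Bg.
  exact: H1.
rewrite expr2 -!mulrA; apply: ler_wpM2l => //; apply: ler_wpM2l; first exact: ltW.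
by rewrite mulrC; apply: ler_wpM2r.
Qed.

Lemma BD_Aprod d i s g c js : BD d (size js + i) s g c -> BD d i s (Aprod T js g) c.
Proof.
elim/last_ind: js g => [//|js j IH] g; rewrite size_rcons addSn => H.
rewrite Aprod_rcons; apply: IH.
by have [_ /(_ j) [g' [Hg' B]]] := H; rewrite (isgen_gen Hg').
Qed.

Lemma geometric_step (x : nat -> E) (A : R) : (forall n, `|x n.+1 - x n| <= A * h ^+ n) ->
  forall n p, `|x (n + p)%N - x n| <= 2 * A * (h ^+ n - h ^+ (n + p)).
Proof.
move=> H n; elim=> [|p IH]; first by rewrite addn0 !subrr normr0 mulr0.
rewrite addnS; have -> : x (n + p).+1 - x n = (x (n + p).+1 - x (n + p)%N) + (x (n + p)%N - x n).
  by rewrite addrA subrK.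
apply: le_trans (ler_normD _ _) _; apply: le_trans (lerD (H _) IH) _.
by rewrite [h ^+ _.+1]exprS; lra.
Qed.

Lemma geometric_tail (x : nat -> E) (A : R) : 0 <= A -> (forall n, `|x n.+1 - x n| <= A * h ^+ n) ->
  forall n m, (n <= m)%N -> `|x m - x n| <= 2 * A * h ^+ n.
Proof.
move=> A0 H n m /subnKC <-; apply: le_trans (geometric_step H n _) _.
by apply: ler_wpM2l; [lra|rewrite gerBl exprn_ge0].
Qed.

Lemma half_small (A e : R) : 0 <= A -> 0 < e -> exists N : nat, 2 * A * h ^+ N <= e.
Proof.
move=> A0 e0.
have [N HN] := small_inv (ltac:(apply: divr_gt0; lra) : 0 < e / (2 * A + 1)).
exists N; have := HN N (leqnn N); rewrite ler_pdivlMr; last lra.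
have : h ^+ N <= N.+1%:R^-1.
  rewrite exprVn lef_pV2 ?posrE ?exprn_gt0 ?ltr0n //.
  by rewrite -natrX ler_nat ltn_expl.
have : 0 <= h ^+ N by rewrite exprn_ge0.
by set y := N.+1%:R^-1; nra.
Qed.

Lemma geometric_cvg (x : nat -> E) (A : R) : 0 <= A ->
  (forall n, `|x n.+1 - x n| <= A * h ^+ n) -> exists l, seqlim x l.
Proof.
move=> A0 H; apply: seqlim_complete => e e0; have [N HN] := half_small A0 e0.
by exists N, (x N) => n Nn; apply: le_trans (geometric_tail A0 H Nn) HN.
Qed.

Lemma geometric_lim (x : nat -> E) f (A : R) : 0 <= A ->
  (forall n, `|x n.+1 - x n| <= A * h ^+ n) -> seqlim x f ->
  forall n, `|f - x n| <= 2 * A * h ^+ n.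
Proof.
move=> A0 H xf n; apply/ler_addgt0Pr => e e0; have [N HN] := xf e e0.
have H1 := HN _ (leq_maxr n N); have H2 := geometric_tail A0 H (leq_maxl n N).
have -> : f - x n = (x (maxn n N) - x n) - (x (maxn n N) - f) by lmod R.
by apply: le_trans (ler_normB _ _) _; lra.
Qed.

(** Completeness of [E^m] for geometric convergence: the derivatives converge by induction, and
    closedness of the generators identifies their limits. *)
Lemma BD_complete m (x : nat -> E) f (A : R) : 0 <= A -> (forall n, inEr T m (x n)) ->
  (forall n, BD 0 m 1 (x n.+1 - x n) (A * h ^+ n)) -> seqlim x f ->
  forall n, BD 0 m 1 (f - x n) (2 * A * h ^+ n).
Proof.
elim: m x f => [|m IH] x f A0 Hx H xf n.
  split=> //; apply/bd0E; apply: geometric_lim => // i; exact: BD0_ind (H i).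
split.
  by apply/bd0E; apply: geometric_lim => // i; exact: BD0_ind (H i).
move=> j; pose y i := gen (S j) (x i).
have Hy i : isgen j (x i) (y i) by have /inErS /(_ j) [D _] := Hx i; exact: gen_domP.
have By i : BD 0 m 1 (y i.+1 - y i) (A * h ^+ i).
  by apply: BD_gen (H i) _; apply: isgenB.
have [g yg] := geometric_cvg A0 (fun i => BD0_ind (By i)).
exists (g - y n); split; first by apply: isgenB => //; exact: isgen_limit xf yg Hy.
apply: IH => // i; by have /inErS /(_ j) [_] := Hx i.
Qed.

Variables (r k : nat).
Hypothesis hkr : (k.+1 < r)%N.
Variable q : \bar R.
Hypothesis hq : (1 <= q)%E.

(** From here on [k] is the integer order minus one: the smoothness is [k + 1] and the moduli act on
    derivatives of order [k]. *)
Definition wK (f : E) (s : R) : R := powR s (- k.+1%:R) * Kfun T r (s ^+ r) f.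
Definition wOmega (js : seq bool) (f : E) (s : R) : R := s^-1 * Omega T 2 s (Aprod T js f).

Lemma wKE f s : 0 < s -> wK f s = Kfun T r (s ^+ r) f / s ^+ k.+1.
Proof. by move=> s0; rewrite /wK powRN powR_mulrn ?ltW // mulrC. Qed.

Lemma wK_ge0 f s : 0 < s -> 0 <= wK f s.
Proof.
move=> s0; rewrite wKE // divr_ge0 //; last by rewrite exprn_ge0 // ltW.
by apply: K_ge0 => //; rewrite exprn_ge0 // ltW.
Qed.

Lemma wOmega_ge0 js f s : 0 < s -> 0 <= wOmega js f s.
Proof.
by move=> s0; apply: mulr_ge0; [rewrite invr_ge0 ltW|apply: Omega_ge0 => //; exact: ltW].
Qed.

Lemma K_half f i : Kfun T r ((h ^+ i) ^+ r) f <= 2 ^+ r * Kfun T r ((h ^+ i.+1) ^+ r) f.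
Proof.
have p : 0 < h ^+ r by rewrite exprn_gt0.
have := K_scale hT r f (exprn_ge0 r (exprn_ge0 i (ltac:(lra) : 0 <= h))) (ltW p)
  (exprn_ile1 r (ltac:(lra) : 0 <= h) (ltac:(lra) : h <= 1)).
rewrite -exprMn -exprS => /(ler_wpM2l (exprn_ge0 r (ler0n R 2))).
by rewrite mulrA -exprMn mulfV // expr1n mul1r.
Qed.

(** The bracket majorizes every hypothesis of [ZD] at once; [ncount r] passes from the maximum in
    [BD] to the sum in [normEr], and the powers [s^r] cancel. *)
Lemma K_modulus : exists C : R, 0 <= C /\ forall f, inEr T k f -> forall s, 0 < s -> s <= 1 ->
  Kfun T r (s ^+ r) f <=
    C * s ^+ k * (\sum_(js : k.-tuple bool) Omega T 2 s (Aprod T js f) + s ^+ 2 * normEr T k f).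
Proof.
have [C [C0 HC]] := K_upper hT hkr.
have nc := ncount_ge1 (R := R) r.
exists (C * (1 + ncount r)); split; first by rewrite mulr_ge0 //; lra.
move=> f Hf s s0 s1.
set c := (X in _ <= _ * X).
have N0 := normEr_ge0 T k f.
have s20 : 0 <= s ^+ 2 by rewrite sqr_ge0.
have O0 (js : k.-tuple bool) : 0 <= Omega T 2 s (Aprod T js f) by apply: Omega_ge0 => //; exact: ltW.
have sO : 0 <= \sum_(js : k.-tuple bool) Omega T 2 s (Aprod T js f) by apply: sumr_ge0.
have Z : ZD T k s f c.
  apply: ZD_inEr => // js sj.
    have : s ^+ 2 * `|Aprod T js f| <= s ^+ 2 * normEr T k f.
      by rewrite ler_wpM2l //; exact: Aprod_normEr.
    by rewrite /c; lra.
  apply: bd_le (bd2_Omega hT (Aprod T js f) (ltW s0)) _; rewrite /c; apply: lerD.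
    move: (sj) => <-.
    have := @sum_ge_term _ _ (fun js : k.-tuple bool => Omega T 2 s (Aprod T js f)) (tcast sj (in_tuple js)) O0.
    rewrite /= val_tcast /=. by rewrite sj.
  by rewrite ler_wpM2l //; apply: Aprod_normEr; rewrite sj.
have [f1 [H1 H2]] := HC s s0 s1 f c Z.
apply: le_trans (K_le f (exprn_ge0 r (ltW s0)) (inEr_BD H2)) _.
have H3 := normEr_BD H2.
have sr : 0 < s ^+ r by rewrite exprn_gt0.
have : s ^+ r * normEr T r f1 <= s ^+ r * (ncount r * (C * (s ^+ k * c / s ^+ r))).
  by rewrite ler_wpM2l // ltW.
have -> : s ^+ r * (ncount r * (C * (s ^+ k * c / s ^+ r))) = ncount r * (C * (s ^+ k * c)).
  by move: sr; move: (s ^+ r) (s ^+ k) => x y x0; field; exact: lt0r_neq0.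
have -> : C * (1 + ncount r) * s ^+ k * c = C * (s ^+ k * c) + ncount r * (C * (s ^+ k * c)) by ring.
lra.
Qed.

Lemma Lq_wK_upper : exists C : R, 0 <= C /\ forall f, inEr T k f ->
  (forall js : k.-tuple bool, (Lq_dsds q (wOmega js f) < +oo)%E) ->
  (Lq_dsds q (wK f) <=
    (C * (normEr T k f + \sum_(js : k.-tuple bool) fine (Lq_dsds q (wOmega js f))))%:E)%E.
Proof.
have [C [C0 HC]] := K_modulus.
have hh i : 0 < h ^+ i by rewrite exprn_gt0.
pose M : R := 2 ^+ size (index_enum {: k.-tuple bool}).
have M0 : 0 <= M by rewrite exprn_ge0.
pose C' := 2 ^+ r * C.
have C'0 : 0 <= C' by rewrite mulr_ge0 // exprn_ge0.
exists (C' * (8 * M + 4) + 2); split; first by rewrite addr_ge0 // mulr_ge0 //; lra.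
move=> f Hf HG.
set N := normEr T k f; have N0 : 0 <= N := normEr_ge0 T k f.
set L := \sum_(js : k.-tuple bool) _.
(* Weight and step are the smallest on [ilow i], so [g js i] stays below the integrand there;
   [2 * g js i] is the integrand's value at [h ^+ i.+1]. *)
pose g (js : k.-tuple bool) i := (h ^+ i)^-1 * Omega T 2 (h ^+ i.+1) (Aprod T js f).
have g0 js i : 0 <= g js i.
  by rewrite mulr_ge0 ?invr_ge0 ?(ltW (hh _)) //; apply: Omega_ge0 => //; exact: ltW.
have l0 (js : k.-tuple bool) : 0 <= fine (Lq_dsds q (wOmega js f)).
  by apply: fine_ge0; apply: Lq_ge0 => // s; exact: wOmega_ge0.
have L0 : 0 <= L by apply: sumr_ge0.
have gl js : lqb q (g js) (2 * fine (Lq_dsds q (wOmega js f))).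
  apply: Lq_lower => // [s|i s]; first exact: wOmega_ge0.
  rewrite in_itv /= => /andP[s1 s2]; have s0 := lt_trans (hh i.+1) s1.
  apply: ler_pM; rewrite ?invr_ge0 ?(ltW (hh _)) //.
  - by apply: Omega_ge0 => //; exact: ltW.
  - by rewrite lef_pV2 ?posrE.
  - by apply: Omega_mono => //; exact: ltW.
have gs := lqb_sum hq (index_enum {: k.-tuple bool}) (fun js => mulr_ge0 (ler0n R 2) (l0 js)) g0 gl.
rewrite -mulr_sumr -/M -/L in gs.
have gs0 i : 0 <= \sum_(js : k.-tuple bool) g js i by apply: sumr_ge0.
have G1 := lqbZ hq (ler0n R 2) (ltac:(rewrite !mulr_ge0 //) : 0 <= M * (2 * L)) gs0 gs.
have G2 := lqb_geometric hq N0.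
have g20 i : 0 <= 2 * \sum_(js : k.-tuple bool) g js i by rewrite mulr_ge0.
have n0 i : 0 <= N * h ^+ i by rewrite mulr_ge0 // ltW.
have G3 := lqbD hq (ltac:(rewrite !mulr_ge0 //) : 0 <= 2 * (M * (2 * L)))
  (ltac:(lra) : 0 <= 2 * N) g20 n0 G1 G2.
have X0 : 0 <= 2 * (2 * (M * (2 * L)) + 2 * N) by rewrite mulr_ge0 // addr_ge0 // ?mulr_ge0 // mulr_ge0.
have G4 := lqbZ hq C'0 X0 (fun i => addr_ge0 (g20 i) (n0 i)) G3.
apply: le_trans (Lq_upper hq (mulr_ge0 C'0 X0) (ltac:(lra) : 0 <= 2 * N) (@wK_ge0 f) _ _ G4 G2) _.
- move=> i s; rewrite in_itv /= => /andP[s1 s2]; have s0 := lt_trans (hh i.+1) s1.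
  rewrite wKE //.
  (* The estimate is made at the left endpoint [x], where the modulus is the one in [g]; moving [K]
     there costs [2^r]. *)
  set x := h ^+ i.+1 in s1 *; have x0 : 0 < x by exact: hh.
  have x1 : x <= 1 by apply: exprn_ile1; lra.
  have K1 : Kfun T r (s ^+ r) f <= 2 ^+ r * Kfun T r (x ^+ r) f.
    apply: le_trans (K_half f i); apply: K_mono => //; first by rewrite exprn_ge0 // ltW.
    by rewrite lerXn2r // nnegrE ?(ltW (hh _)) // ltW.
  have K2 := HC f Hf x x0 x1.
  set c := (X in _ <= _ * X) in K2.
  have c0 : 0 <= c.
    apply: addr_ge0; last by rewrite mulr_ge0 // sqr_ge0.
    by apply: sumr_ge0 => js _; apply: Omega_ge0 => //; exact: ltW.
  have xk : 0 < x ^+ k by rewrite exprn_gt0.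
  have sk : 0 < s ^+ k.+1 by rewrite exprn_gt0.
  have K3 : Kfun T r (s ^+ r) f / s ^+ k.+1 <= C' * (c / x).
    rewrite ler_pdivrMr //.
    apply: le_trans K1 _; apply: (@le_trans _ _ (2 ^+ r * (C * x ^+ k * c))).
      by rewrite ler_wpM2l // exprn_ge0.
    rewrite (_ : 2 ^+ r * (C * x ^+ k * c) = C' * (c / x) * x ^+ k.+1).
      rewrite ler_wpM2l //; last by rewrite lerXn2r // ?nnegrE ?ltW.
      by rewrite mulr_ge0 // divr_ge0 // ltW.
    by rewrite /C' exprS; move: (x ^+ k) (2 ^+ r) => y z; field; exact: lt0r_neq0.
  apply: le_trans K3 _; apply: ler_wpM2l => //.
  rewrite /c mulrDl; apply: lerD.
    rewrite mulr_suml mulr_sumr; apply: ler_sum => js _.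
    rewrite /g -/x le_eqVlt; apply/orP; left; apply/eqP.
    by rewrite /x exprS; move: (hh i); move: (h ^+ i) => y y0; field; exact: lt0r_neq0.
  rewrite (_ : x ^+ 2 * normEr T k f / x = N * x); last by rewrite -/N; field; exact: lt0r_neq0.
  by apply: ler_wpM2l => //; rewrite /x exprS; have := hh i; lra.
(* Above scale 1, [K <= |f|] and the weight is at most [2^{-i}], so a geometric sequence
   dominates. *)
- move=> i s; rewrite in_itv /= => /andP[s1 s2].
  have p : 0 < 2 ^+ i :> R by rewrite exprn_gt0.
  have p1 : 1 <= 2 ^+ i :> R by rewrite exprn_ege1 //; lra.
  have s0 := lt_trans p s1.
  rewrite wKE // ler_pdivrMr ?exprn_gt0 //.
  have K1 := K_norm hT r f (exprn_ge0 r (ltW s0)).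
  apply: le_trans K1 _.
  have fN : `|f| <= N by exact: (@Aprod_normEr _ _ T k f [::]).
  apply: le_trans fN _; rewrite -mulrA; apply: ler_peMr => //.
  have : 1 <= s ^+ k by rewrite exprn_ege1 //; lra.
  rewrite exprS exprVn => sk; rewrite mulrA.
  have : 1 <= (2 ^+ i)^-1 * s by rewrite mulrC ler_pdivlMr // mul1r ltW.
  by nra.
rewrite lee_fin.
have b1 : 0 <= C' * M * N by rewrite !mulr_ge0.
have b2 : 0 <= C' * L by rewrite mulr_ge0.
lra.
Qed.

Lemma K_iter_le f i : Kfun T r ((h ^+ i.+1) ^+ r) f <= Kfun T r ((h ^+ i) ^+ r) f.
Proof.
have p n : 0 <= h ^+ n by rewrite exprn_ge0.
apply: (K_mono hT); first by rewrite exprn_ge0.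
by rewrite lerXn2r // ?nnegrE // exprS; have := p i; lra.
Qed.

(* The telescoping decomposition of [f] along near-optimal elements at the scales [2^-i];
   [b] dominates the sequence [2^(i(k+1)) K(2^(-ir), f)] *)
Lemma K_decomposition : exists C : R, 0 <= C /\ forall f (b : nat -> R),
  (forall i, Kfun T r ((h ^+ i) ^+ r) f <= b i * (h ^+ i) ^+ k.+1) ->
  exists g : nat -> E, [/\ (forall i, inEr T r (g i)), 
    (forall i, `|f - g i| <= 2 * Kfun T r ((h ^+ i) ^+ r) f),
    (forall i, BD 0 k 1 (g i.+1 - g i) (C * (b i * h ^+ i))),
    (forall i, BD 0 k.+2 1 (g i.+1 - g i) (C * (b i / h ^+ i))) &
    normEr T r (g 0%N) <= 2 * b 0%N].
Proof.
have [C1 [C10 HC1]] := interpolation hT (ltnW (ltnW hkr)).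
have [C2 [C20 HC2]] := interpolation hT hkr.
(* Bounds the [E^r] norms of [g i.+1] and [g i] together: near-optimality gives 2 for each, and
   scale [i + 1] is worse than scale [i] by [2^r]. *)
pose c : R := 2 ^+ r.+1 + 2.
have c0 : 0 <= c by rewrite addr_ge0 // exprn_ge0.
exists ((C1 + C2) * (4 + c)); split; first by rewrite mulr_ge0 //; lra.
move=> f b Hb.
have hp i : 0 < h ^+ i by rewrite exprn_gt0.
have h1 i : h ^+ i <= 1 by apply: exprn_ile1; lra.
have hr i : 0 < (h ^+ i) ^+ r by rewrite exprn_gt0.
have hr1 i : (h ^+ i) ^+ r <= 1 by apply: exprn_ile1; [exact: ltW|].
have [g Hg] := choice (fun i => K_opt hT r f (hr i) (hr1 i)).
have K0 i : 0 <= Kfun T r ((h ^+ i) ^+ r) f by apply: K_ge0 => //; exact: ltW.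
have b0 i : 0 <= b i.
  have := le_trans (K0 i) (Hb i); rewrite pmulr_lge0 //; exact: exprn_gt0.
have D1 i : `|f - g i| <= 2 * Kfun T r ((h ^+ i) ^+ r) f.
  have [_ H] := Hg i; have := mulr_ge0 (ltW (hr i)) (normEr_ge0 T r (g i)); lra.
have D2 i : normEr T r (g i) <= 2 * Kfun T r ((h ^+ i) ^+ r) f / (h ^+ i) ^+ r.
  by have [_ H] := Hg i; rewrite ler_pdivlMr // mulrC; have := normr_ge0 (f - g i); lra.
have U0 i : `|g i.+1 - g i| <= 4 * Kfun T r ((h ^+ i) ^+ r) f.
  have -> : g i.+1 - g i = (f - g i) - (f - g i.+1) by lmod R.
  apply: le_trans (ler_normB _ _) _.
  by have := D1 i; have := D1 i.+1; have := K_iter_le f i; lra.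
have Ur i : BD 0 r (h ^+ i) (g i.+1 - g i) (c * (Kfun T r ((h ^+ i) ^+ r) f / (h ^+ i) ^+ r)).
  have [G1 _] := Hg i.+1; have [G2 _] := Hg i.
  apply: BD_le (BDB hT (BD_normEr (h ^+ i) G1) (BD_normEr (h ^+ i) G2)) _.
  rewrite /c mulrDl; apply: lerD; last by rewrite mulrA.
  apply: le_trans (D2 i.+1) _.
  have -> : 2 * Kfun T r ((h ^+ i.+1) ^+ r) f / (h ^+ i.+1) ^+ r =
      2 ^+ r.+1 * (Kfun T r ((h ^+ i.+1) ^+ r) f / (h ^+ i) ^+ r).
    rewrite [in X in _ / X = _]exprS exprMn [h ^+ r]exprVn [2 ^+ r.+1]exprS.
    have := lt0r_neq0 (hr i); have : 2 ^+ r != 0 :> R by rewrite expf_neq0.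
    move: (Kfun _ _ _ _) => K; move: ((h ^+ i) ^+ r) (2 ^+ r) => x y x0 y0.
    by field; rewrite x0 y0.
  apply: ler_wpM2l; first by rewrite exprn_ge0.
  by rewrite ler_wpM2r ?invr_ge0 ?(ltW (hr i)) //; exact: K_iter_le.
(* Interpolation at [s = 2^{-i}], where the bounds in [E] and in [E^r] balance: both contribute a
   multiple of [K / s^m]. *)
have U m C (Cp : 0 <= C) (CC : C <= C1 + C2) i : (m <= r)%N -> (forall s : R, 0 < s -> s <= 1 -> forall u c0 c1, `|u| <= c0 -> BD 0 r s u c1 ->
    BD 0 m s u (C * (c0 / s ^+ m + s ^+ (r - m) * c1))) ->
    BD 0 m 1 (g i.+1 - g i) ((C1 + C2) * (4 + c) * (b i * (h ^+ i) ^+ k.+1 / (h ^+ i) ^+ m)).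
  move=> mr H.
  apply: BD0_s; apply: BD_le (H _ (hp i) (h1 i) _ _ _ (U0 i) (Ur i)) _.
  have hm : 0 < (h ^+ i) ^+ m by rewrite exprn_gt0.
  have hrm : 0 < (h ^+ i) ^+ (r - m) by rewrite exprn_gt0.
  set K := Kfun _ _ _ _.
  have -> : (h ^+ i) ^+ (r - m) * (c * (K / (h ^+ i) ^+ r)) = c * (K / (h ^+ i) ^+ m).
    rewrite -[in (h ^+ i) ^+ r](subnKC mr) exprD.
    move: hm hrm; move: ((h ^+ i) ^+ m) ((h ^+ i) ^+ (r - m)) => x y x0 y0.
    by field; rewrite !lt0r_neq0.
  rewrite (_ : 4 * K / (h ^+ i) ^+ m + c * (K / (h ^+ i) ^+ m) = (4 + c) * (K / (h ^+ i) ^+ m)); last by ring.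
  rewrite -[leRHS]mulrA.
  have Kb : K / (h ^+ i) ^+ m <= b i * (h ^+ i) ^+ k.+1 / (h ^+ i) ^+ m.
    by apply: ler_wpM2r; [rewrite invr_ge0 ltW|exact: Hb].
  have Kp : 0 <= K / (h ^+ i) ^+ m by exact: (divr_ge0 (K0 i) (ltW hm)).
  apply: ler_pM => //; first by rewrite mulr_ge0 //; lra.
  by apply: ler_wpM2l => //; lra.
exists g; split => //.
- by move=> i; have [] := Hg i.
- move=> i; have := U k C1 C10 (ltac:(lra)) i (ltnW (ltnW hkr)) HC1.
  rewrite (_ : b i * (h ^+ i) ^+ k.+1 / (h ^+ i) ^+ k = b i * h ^+ i) // exprS.
  have := lt0r_neq0 (exprn_gt0 k (hp i)); move: ((h ^+ i) ^+ k) => x x0.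
  by field.
- move=> i; have := U k.+2 C2 C20 (ltac:(lra)) i hkr HC2.
  rewrite (_ : b i * (h ^+ i) ^+ k.+1 / (h ^+ i) ^+ k.+2 = b i / h ^+ i) // [(h ^+ i) ^+ k.+2]exprS.
  have := lt0r_neq0 (exprn_gt0 k.+1 (hp i)); have := lt0r_neq0 (hp i).
  move: ((h ^+ i) ^+ k.+1) (h ^+ i) => x y y0 x0.
  by field; rewrite y0 x0.
have := D2 0%N; have := Hb 0%N; rewrite expr0 !expr1n mulr1 divr1; lra.
Qed.
End Assembly.

(** * From the K-functional to the Zygmund condition *)

Section Converse.
Context {R : realType} {E : completeNormedModType R}.
Variable T : R -> R -> E -> E.
Hypothesis hT : contractive_rep T.
Local Notation BD := (BD T).
Local Notation h := (2^-1 : R).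
Variables (r k : nat).
Hypothesis hkr : (k.+1 < r)%N.
Variable q : \bar R.
Hypothesis hq : (1 <= q)%E.
Local Notation wK := (wK T r k).
Local Notation wOmega := (wOmega T).

(** The rough part is bounded trivially by [16 |f|], the smooth part by [bd_up2]; 400 is the 4 pairs
    of directions times the 100 there. *)
Lemma Omega_split : exists K : R, [/\ 0 <= K,
  forall s f, 0 <= s -> Omega T 2 s f <= K * `|f| &
  forall s (f g : E) (c1 c2 : R), 0 < s -> s <= 1 -> `|f| <= c1 -> BD 0 2 s g c2 ->
    Omega T 2 s (f + g) <= K * c1 + K * (s ^+ 2 * c2)].
Proof.
exists 400; split; [exact: ler0n|move=> s f s0|move=> s f g c1 c2 s0 s1 fc Hg].
  by apply: le_trans (Omega_norm hT f s0) _; rewrite ler_wpM2r //; lra.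
have c10 := le_trans (normr_ge0 f) fc.
apply: (@le_trans _ _ (4 * (4 * c1 + 100 * (s ^+ 2 * c2)))); last lra.
apply: Omega_le => //; first exact: ltW.
move=> a b t u tt uu; rewrite (blinD (Dif_blin hT _ _)) (blinD (Dif_blin hT _ _)).
have /bd2E [_ H] := bd_up2 hT s0 s1 Hg.
apply: le_trans (ler_normD _ _) _; apply: lerD; last exact: H.
by have := Dif_norm hT a t (Dif T b u f); have := Dif_norm hT b u f; lra.
Qed.

Lemma Lq_wOmega_upper : exists C : R, 0 <= C /\ forall f, (Lq_dsds q (wK f) < +oo)%E ->
  [/\ inEr T k f, normEr T k f <= C * fine (Lq_dsds q (wK f)) &
      forall js : k.-tuple bool, (Lq_dsds q (wOmega js f) <= (C * fine (Lq_dsds q (wK f)))%:E)%E].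
Proof.
have [C [C0 HC]] := K_decomposition hT hkr.
have [K [Kp OK1 OK2]] := Omega_split.
have nk := ncount_ge1 (R := R) k; have nk2 := ncount_ge1 (R := R) k.+2.
pose B0 : R := 2 ^+ r.+1.
have B00 : 0 <= B0 by rewrite exprn_ge0.
pose c1 := ncount k * (2 * C); pose c2 := ncount k * C; pose c3 := ncount k.+2 * C.
have c10 : 0 <= c1 by rewrite mulr_ge0 //; lra.
have c20 : 0 <= c2 by rewrite mulr_ge0 //; lra.
have c30 : 0 <= c3 by rewrite mulr_ge0 //; lra.
pose c4 := c1 + 2.
pose c5 := 2 * (2 * K * (c1 + 2 * c2) + K * (4 + 2 * c3)) + 2 * K * c4.
have c50 : 0 <= c5.
  have := mulr_ge0 Kp c10; have := mulr_ge0 Kp c20; have := mulr_ge0 Kp c30.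
  by rewrite /c5 /c4; lra.
exists ((c4 + c5) * B0); split; first by rewrite mulr_ge0 // /c4; lra.
move=> f Lf.
set L := fine _.
have L0 : 0 <= L by apply: fine_ge0; apply: Lq_ge0 => // s; exact: wK_ge0.
have hp i : 0 < h ^+ i by rewrite exprn_gt0.
have h1 i : h ^+ i <= 1 by apply: exprn_ile1; lra.
have K0 i : 0 <= Kfun T r ((h ^+ i) ^+ r) f.
  by apply: (K_ge0 hT); rewrite exprn_ge0 // ltW.
pose b i := Kfun T r ((h ^+ i) ^+ r) f / (h ^+ i) ^+ k.+1.
have hk i : 0 < (h ^+ i) ^+ k.+1 by rewrite exprn_gt0.
have b0 i : 0 <= b i by exact: divr_ge0 (K0 i) (ltW (hk i)).
pose B := B0 * L.
have Bp : 0 <= B by rewrite mulr_ge0.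
(* The factor [h ^+ r] allows for the passage from [h ^+ i] to a smaller [s] in the same dyadic
   interval. Dividing it out, with the 2 of [Lq_lower], gives [B0 = 2^{r+1}]. *)
have lb : lqb q b B.
  have H : lqb q (fun i => h ^+ r * b i) (2 * L).
    apply: Lq_lower => // [s|i|i s]; first exact: wK_ge0.
      by rewrite mulr_ge0 // ltW.
    rewrite in_itv /= => /andP[s1 s2]; have s0 := lt_trans (hp i.+1) s1.
    rewrite wKE // /b mulrA; apply: ler_pM.
    - by rewrite mulr_ge0 // ltW.
    - by rewrite invr_ge0 ltW.
    - have := K_half hT r f i => /(ler_wpM2l (ltW (hp r))).
      rewrite mulrA -exprMn mulVf // expr1n mul1r => /le_trans; apply.
      apply: (K_mono hT); first by rewrite exprn_ge0 // ltW.
      by rewrite lerXn2r // ?nnegrE; exact: ltW.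
    - rewrite lef_pV2 ?posrE ?(hk i) ?exprn_gt0 //.
      by rewrite lerXn2r // nnegrE; exact: ltW.
  have := lqbZ hq (exprn_ge0 r (ler0n R 2)) (ltac:(lra) : 0 <= 2 * L)
    (fun i => mulr_ge0 (ltW (hp r)) (b0 i)) H.
  apply: lqb_le => //.
  - by rewrite mulr_ge0 ?exprn_ge0 //; lra.
  - by rewrite /B /B0 exprS; lra.
  - by move=> i; rewrite b0 mulrA -exprMn mulfV // expr1n mul1r lexx.
have bB i := lqb_term hq i Bp b0 lb.
have Hb i : Kfun T r ((h ^+ i) ^+ r) f <= b i * (h ^+ i) ^+ k.+1.
  by rewrite /b divfK // lt0r_neq0.
have [g [Hg fg Uk Uk2 g0]] := HC f b Hb.
have Hgk i m : (m <= r)%N -> inEr T m (g i) by move=> mr; exact: inEr_le mr (Hg i).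
have kr : (k <= r)%N := ltnW (ltnW hkr).
(* Near-optimality gives convergence in [E] only; [BD_complete] then upgrades it to [E^k]. *)
have gf : seqlim g f.
  move=> e e0; have [N HN] := half_small Bp e0; exists N => n Nn.
  rewrite distrC; apply: le_trans (fg n) _; apply: le_trans HN.
  rewrite -mulrA; apply: ler_wpM2l => //.
  apply: le_trans (Hb n) _; apply: ler_pM; [exact: b0|exact: ltW (hk n)|exact: bB|].
  rewrite exprS; apply: (@le_trans _ _ (h ^+ n)).
    by apply: ler_piMr; [exact: ltW (hp n)|apply: exprn_ile1; [exact: ltW (hp n)|exact: h1]].
  by apply: ler_wiXn2l => //; lra.
have Uk' i : BD 0 k 1 (g i.+1 - g i) (C * B * h ^+ i).
  apply: BD_le (Uk i) _; rewrite -mulrA; apply: ler_wpM2l => //.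
  by apply: ler_wpM2r; [exact: ltW|exact: bB].
have CB : 0 <= C * B by rewrite mulr_ge0.
have Hc := BD_complete hT CB (fun i => Hgk i k kr) Uk' gf.
have Hfg i : inEr T k (f - g i) by exact: inEr_BD (Hc i).
have Hf : inEr T k f by rewrite -(subrK (g 0%N) f); apply: (inErD hT (Hfg 0%N)); exact: Hgk.
(* The weights give both recursions the ratio [1/2]: [al] is bounded through its successor, [be]
   through its predecessor. The crude bounds [c1 * B] on [al] and [2 * B] on [be 0] supply the
   boundary terms of the Hardy inequalities. *)
pose al i := normEr T k (f - g i) / h ^+ i.
pose be i := normEr T k.+2 (g i) * h ^+ i.
have al0 i : 0 <= al i <= c1 * B.
  apply/andP; split; first exact: divr_ge0 (normEr_ge0 _ _ _) (ltW (hp i)).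
  rewrite ler_pdivrMr //; apply: le_trans (normEr_BD (Hc i)) _.
  by rewrite /c1 le_eqVlt; apply/orP; left; apply/eqP; ring.
have be0 i : 0 <= be i by exact: mulr_ge0 (normEr_ge0 _ _ _) (ltW (hp i)).
have alr i : al i <= 2^-1 * al i.+1 + c2 * b i.
  rewrite /al ler_pdivrMr //.
  have -> : (2^-1 * (normEr T k (f - g i.+1) / h ^+ i.+1) + c2 * b i) * h ^+ i =
     normEr T k (f - g i.+1) + c2 * (b i * h ^+ i).
    by rewrite exprS; have := lt0r_neq0 (hp i); move: (h ^+ i) => x x0; field.
  have -> : f - g i = (f - g i.+1) + (g i.+1 - g i) by rewrite addrA subrK.
  apply: le_trans (normErD hT (Hfg i.+1) (inErB hT (Hgk i.+1 k kr) (Hgk i k kr))) _.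
  by rewrite lerD2l /c2 -mulrA; exact: normEr_BD (Uk i).
have ber i : be i.+1 <= 2^-1 * be i + c3 * b i.
  rewrite /be.
  have -> : g i.+1 = g i + (g i.+1 - g i) by rewrite addrC subrK.
  have H1 := normErD hT (Hgk i k.+2 hkr) (inErB hT (Hgk i.+1 k.+2 hkr) (Hgk i k.+2 hkr)).
  have H2 := normEr_BD (Uk2 i).
  have : normEr T k.+2 (g i + (g i.+1 - g i)) * h ^+ i.+1 <=
     (normEr T k.+2 (g i) + ncount k.+2 * (C * (b i / h ^+ i))) * h ^+ i.+1.
    by apply: ler_wpM2r; [exact: ltW|lra].
  move=> /le_trans; apply; rewrite mulrDl.
  have -> : ncount k.+2 * (C * (b i / h ^+ i)) * h ^+ i.+1 = 2^-1 * (c3 * b i).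
    by rewrite /c3 exprS; have := lt0r_neq0 (hp i); move: (h ^+ i) => x x0; field.
  by rewrite exprS; have := mulr_ge0 c30 (b0 i); lra.
have lal := hardy_down hq (mulr_ge0 c20 Bp) (mulr_ge0 c10 Bp) (fun i => mulr_ge0 c20 (b0 i))
  (lqbZ hq c20 Bp b0 lb) al0 alr.
have be00 : be 0%N <= 2 * B.
  rewrite /be expr0 mulr1; apply: le_trans (normEr_mono T (g 0%N) hkr) _.
  by have := bB 0%N; lra.
have lbe := hardy_up hq (mulr_ge0 c30 Bp) (ltac:(lra) : 0 <= 2 * B) (fun i => mulr_ge0 c30 (b0 i))
  (lqbZ hq c30 Bp b0 lb) be0 be00 ber.
have fN : normEr T k f <= c4 * B.
  rewrite -{1}(subrK (g 0%N) f); apply: le_trans (normErD hT (Hfg 0%N) (Hgk 0%N k kr)) _.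
  have /andP[_] := al0 0%N; rewrite /al expr0 divr1.
  have := normEr_mono T (g 0%N) kr; have := bB 0%N; rewrite /c4; lra.
have N0 := normEr_ge0 T k f.
split => //.
  apply: le_trans fN _; rewrite -/L /B mulrA.
  apply: ler_wpM2r => //; apply: ler_wpM2r => //; lra.
move=> js.
have sj : size js = k by rewrite size_tuple.
have X1 : 0 <= c1 * B + 2 * (c2 * B) by have := mulr_ge0 c10 Bp; have := mulr_ge0 c20 Bp; lra.
have X2 : 0 <= 2 * (2 * B) + 2 * (c3 * B) by have := mulr_ge0 c30 Bp; lra.
have K2 : 0 <= 2 * K by lra.
have l1 := lqbZ hq K2 X1 (fun i => proj1 (andP (al0 i))) lal.
have l2 := lqbZ hq Kp X2 be0 lbe.
have pal i : 0 <= 2 * K * al i by apply: mulr_ge0 K2 _; have /andP[] := al0 i.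
have pbe i : 0 <= K * be i by exact: mulr_ge0.
have l3 := lqbD hq (mulr_ge0 K2 X1) (mulr_ge0 Kp X2) pal pbe l1 l2.
have KN : 0 <= K * normEr T k f by exact: mulr_ge0.
have l4 := lqb_geometric hq KN.
have X3 : 0 <= 2 * (2 * K * (c1 * B + 2 * (c2 * B)) + K * (2 * (2 * B) + 2 * (c3 * B))).
  by have := mulr_ge0 K2 X1; have := mulr_ge0 Kp X2; lra.
have KN2 : 0 <= 2 * (K * normEr T k f) by lra.
apply: le_trans (Lq_upper hq X3 KN2 (@wOmega_ge0 _ _ T hT js f) _ _ l3 l4) _.
- move=> i s; rewrite in_itv /= => /andP[s1 s2]; have s0 := lt_trans (hp i.+1) s1.
  have sle1 : s <= 1 by exact: le_trans (h1 i).
  (* For [s] in [ilow i] the function is split at the same [i]; then [h ^+ i <= 2 * s] and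
     [s <= h ^+ i] turn powers of [s] into the weights of [al] and [be]. *)
  have Ad : Aprod T js f = Aprod T js (f - g i) + Aprod T js (g i).
    rewrite -[in LHS](subrK (g i) f).
    have /inErP /(_ js (ltac:(by rewrite sj))) A1 := Hfg i.
    have /inErP /(_ js (ltac:(by rewrite sj))) A2 := Hgk i k kr.
    by have [_ ->] := AprodD hT A1 A2.
  have O : Omega T 2 s (Aprod T js f) <=
      K * normEr T k (f - g i) + K * (s ^+ 2 * normEr T k.+2 (g i)).
    rewrite Ad; apply: OK2 => //; first by apply: Aprod_normEr; rewrite sj.
    apply: BD_Aprod; rewrite sj addn2; apply: BD_normEr; exact: Hgk.
  have e0 := normEr_ge0 T k (f - g i); have n0 := normEr_ge0 T k.+2 (g i).
  rewrite /wOmega mulrC ler_pdivrMr //; apply: le_trans O _.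
  rewrite [leRHS]mulrDl; apply: lerD.
    rewrite /al (_ : 2 * K * (normEr T k (f - g i) / h ^+ i) * s =
      K * (normEr T k (f - g i) * (2 * s / h ^+ i))); last by field; exact: lt0r_neq0 (hp i).
    apply: ler_wpM2l => //; apply: ler_peMr => //.
    by rewrite ler_pdivlMr // mul1r; move: s1; rewrite exprS; lra.
  have -> : K * be i * s = K * (h ^+ i * s * normEr T k.+2 (g i)) by rewrite /be; ring.
  apply: ler_wpM2l => //; apply: ler_wpM2r => //.
  by rewrite expr2; apply: ler_wpM2r; first exact: ltW.
(* Above scale 1 the trivial bound of the modulus by the [E^k] norm suffices, since the weight is at
   most [2^{-i}]. *)
- move=> i s; rewrite in_itv /= => /andP[s1 s2].
  have p : 0 < 2 ^+ i :> R by rewrite exprn_gt0.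
  have s0 := lt_trans p s1.
  rewrite /wOmega mulrC; apply: ler_pM.
  + by apply: Omega_ge0 => //; exact: ltW.
  + by rewrite invr_ge0 ltW.
  + apply: le_trans (OK1 _ _ (ltW s0)) _; apply: ler_wpM2l => //.
    by apply: Aprod_normEr; rewrite sj.
  + by rewrite exprVn lef_pV2 ?posrE // ltW.
rewrite lee_fin -/L (_ : (c4 + c5) * B0 * L = (c4 + c5) * B); last by rewrite /B mulrA.
have := ler_wpM2l K2 fN.
have := mulr_ge0 c10 Bp; rewrite /c5 /c4; lra.
Qed.
End Converse.

Unset Implicit Arguments.
Set Strict Implicit.

Theorem mainTheorem6 (R : realType) (E : completeNormedModType R)
  (T : R -> R -> E -> E) (hT : contractive_rep T)
  (r k : nat) (q : \bar R) (hq : (1 <= q)%E) (hk1 : (1 <= k)%N) (hkr : (k < r)%N) :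
  exists c C : R, 0 < c /\ 0 < C /\
    forall f : E,
      ((Bnorm T r k%:R q f < +oo)%E -> inEr T k.-1 f) /\
      (inEr T k.-1 f ->
         (c%:E * Zyg T k q f <= Bnorm T r k%:R q f)%E /\
         (Bnorm T r k%:R q f <= C%:E * Zyg T k q f)%E).
Proof.
(* From here [k] stands for the order minus one, so [k.-1] in [Zyg] becomes [k]. *)
case: k hk1 hkr => // k _ hkr.
have [A [A0 HA]] := Lq_wK_upper hT hkr hq.
have [B [B0 HB]] := Lq_wOmega_upper hT hkr hq.
pose M : R := \sum_(js : k.-tuple bool) 1.
have M0 : 0 <= M by apply: sumr_ge0.
have BM : 0 <= B * (1 + M) by rewrite mulr_ge0 //; lra.
(* [1 + M] accounts for the norm term and one integral for each of the [M] words; the extra 1 keeps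
   the denominator positive. *)
exists (B * (1 + M) + 1)^-1, (1 + A); split; first by rewrite invr_gt0; lra.
split; first lra.
move=> f.
have f0 : (0 <= Lq_dsds q (wK T r k f))%E by apply: Lq_ge0 => // s; exact: wK_ge0.
have g0 (js : k.-tuple bool) : (0 <= Lq_dsds q (wOmega T js f))%E.
  by apply: Lq_ge0 => // s; exact: wOmega_ge0.
have BE : Bnorm T r k.+1%:R q f = (`|f|%:E + Lq_dsds q (wK T r k f))%E by [].
have ZE : Zyg T k.+1 q f =
  ((normEr T k f)%:E + \sum_(js : k.-tuple bool) Lq_dsds q (wOmega T js f))%E by [].
have fin_or_inf (x : \bar R) : (0 <= x)%E -> x = +oo%E \/ (x < +oo)%E.
  by case: x => [x||] //= _; [right; exact: ltry|left].
split=> [|Hf].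
  rewrite BE => Boo; have [] := fin_or_inf _ f0 => [E1|/HB []//].
  by rewrite E1 addey in Boo.
split.
  have [E1|Foo] := fin_or_inf _ f0; first by rewrite BE E1 addey // leey.
  have [_ HN HG] := HB f Foo.
  set L := fine _ in HN HG.
  have L0 : 0 <= L by exact: fine_ge0.
  have Z : (Zyg T k.+1 q f <= (B * (1 + M) * L)%:E)%E.
    rewrite ZE (_ : B * (1 + M) * L = B * L + \sum_(js : k.-tuple bool) B * L); last first.
      by rewrite /M mulrDr mulrDl mulr1 mulrAC mulr_sumr; under [in RHS]eq_bigr do rewrite -[B * L]mulr1.
    rewrite [leRHS]EFinD -sumEFin; apply: leeD; first by rewrite lee_fin.
    by apply: lee_sum => js _; exact: HG.
  apply: (@le_trans _ _ ((B * (1 + M) + 1)^-1%:E * (B * (1 + M) * L)%:E)%E).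
    by apply: lee_wpmul2l => //; rewrite lee_fin invr_ge0; lra.
  rewrite BE -[Lq_dsds q _]fineK; last by rewrite ge0_fin_numE.
  rewrite -/L -EFinM -EFinD lee_fin mulrC ler_pdivrMr; last lra.
  by have := normr_ge0 f; have := mulr_ge0 BM L0; nra.
(* One infinite integral makes [Zyg] infinite and the bound trivial; otherwise [HA] applies to real
   quantities. *)
have [Hoo|Hfin] := pselect (exists js : k.-tuple bool, Lq_dsds q (wOmega T js f) = +oo%E).
  have -> : Zyg T k.+1 q f = +oo%E.
    have [js Hjs] := Hoo; rewrite ZE (bigD1 js) //= Hjs addye ?addey //.
    by rewrite gt_eqF // (lt_le_trans (ltNyr 0)) // sume_ge0.
  by rewrite mulry gtr0_sg ?mul1e ?leey //; lra.
have Gfin (js : k.-tuple bool) : (Lq_dsds q (wOmega T js f) < +oo)%E.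
  by have [E1|//] := fin_or_inf _ (g0 js); case: Hfin; exists js.
have H := HA f Hf Gfin.
have fN : `|f| <= normEr T k f by exact: (@Aprod_normEr _ _ T k f [::]).
rewrite BE ZE.
have -> : \sum_(js : k.-tuple bool) Lq_dsds q (wOmega T js f) =
   (\sum_(js : k.-tuple bool) fine (Lq_dsds q (wOmega T js f)))%:E.
  rewrite -sumEFin; apply: eq_bigr => js _; rewrite fineK // ge0_fin_numE //.
set G := \sum_(js : k.-tuple bool) fine _ in H *.
have G0 : 0 <= G by apply: sumr_ge0 => js _; exact: fine_ge0.
apply: le_trans (leeD (lexx _) H) _.
rewrite -!EFinD -EFinM lee_fin mulrDl mul1r.
lra.
Qed.
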